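(* Let $X\subseteq K^n$ be a semi-algebraic set. Then either $X$ is finite, or there exists a semi-algebraic bijection $X\to K^k$, where $k\geq 1$ is the dimension of $X$.
   Context: Fix a prime $p$ and a finite field extension $K$ of $\mathbb{Q}_p$, with valuation $v:K\to\mathbb{Z}\cup\{+\infty\}$. For $n\geq 1$ let $P_n=\{x\in K\setminus\{0\}:\exists y\in K,\ y^n=x\}$. A subset of $K^m$ is semi-algebraic if it is a finite Boolean combination (finite unions, intersections, complements) of sets $\{x\in K^m: f(x)\in P_n\}$ with $f\in K[X_1,\dots,X_m]$, $n\geq 1$. A function between semi-algebraic sets is semi-algebraic if its graph is semi-algebraic. $K^m$ carries the topology induced by the norm $|x|=\max_i p^{-v(x_i)}$. The dimension of a nonempty semi-algebraic set $X$ is the greatest natural number $n$ such that there is a nonempty semi-algebraic subset $A\subseteq X$ and a semi-algebraic bijection from $A$ onto a nonempty semi-algebraic open subset of $K^n$; $\dim(\emptyset)=-1$. *)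

(* Defs.v *)
From HB Require Import structures.
From mathcomp Require Import all_boot all_order all_algebra all_field.
From mathcomp Require Import mpoly.
From mathcomp Require Import classical_sets functions cardinality.
From mathcomp Require Import constructive_ereal.

Set Implicit Arguments.
Unset Strict Implicit.
Unset Printing Implicit Defensive.

Import Order.TTheory GRing.Theory Num.Theory.

Local Open Scope classical_set_scope.
Local Open Scope ring_scope.

(* Valuations F -> Z u {+oo}.  The target is the library type \bar int of
   extended integers, whose extra point -oo is excluded by valuation_neqNy. *)
Record valuation (F : fieldType) (v : F -> \bar int) : Prop := Valuation {
  valuation_neqNy : forall x, v x != -oo%E;
  valuation_eqy : forall x, v x = +oo%E <-> x = 0;
  valuationM : forall x y, v (x * y) = (v x + v y)%E;
  valuationD : forall x y, (mine (v x) (v y) <= v (x + y)%R)%E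
}.

Definition padic_val_rat (p : nat) (q : rat) : \bar int :=
  if q == 0 then +oo%E
  else ((logn p `|numq q|%N)%:Z - (logn p `|denq q|%N)%:Z)%:E.

Definition val_complete (F : fieldType) (v : F -> \bar int) : Prop :=
  forall u : nat -> F,
    (forall N : int, exists M : nat, forall i j : nat,
       (M <= i)%N -> (M <= j)%N -> (N%:E <= v (u i - u j)%R)%E) ->
    exists l : F, forall N : int, exists M : nat, forall i : nat,
      (M <= i)%N -> (N%:E <= v (u i - l)%R)%E.

(* (Qp, vp) is the completion of Q for the p-adic valuation: a complete valued
   field containing (Q, v_p) as a dense valued subfield.  This determines
   (Qp, vp) up to a unique isomorphism of valued fields. *)
Record padic_numbers (p : nat) (Qp : fieldType) (vp : Qp -> \bar int) : Prop :=
  PadicNumbers {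
  padic_valuation : valuation vp;
  padic_ratr : forall q : rat, vp (ratr q) = padic_val_rat p q;
  padic_dense : forall (x : Qp) (N : int),
    exists q : rat, (N%:E <= vp (x - ratr q)%R)%E;
  padic_complete : val_complete vp
}.

(* v is a valuation on K whose restriction to Qp is equivalent to vp; for the
   normalized valuation of K, e is the ramification index of K over Qp. *)
Definition extends_valuation (Qp : fieldType) (vp : Qp -> \bar int)
    (K : fieldExtType Qp) (v : K -> \bar int) : Prop :=
  valuation v /\
  exists e : nat, (0 < e)%N /\ forall a : Qp, v (a%:A) = (e%:Z%:E * vp a)%E.

Definition padic_abs (p : nat) (K : fieldType) (v : K -> \bar int) (x : K)
    : rat :=
  if v x is EFin k then (p%:R : rat) ^ (- k) else 0.

Definition padic_norm (p : nat) (K : fieldType) (v : K -> \bar int) (m : nat)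
    (x : 'rV[K]_m) : rat :=
  \big[Order.max/0]_(i < m) padic_abs p v (x ord0 i).

Definition padic_open (p : nat) (K : fieldType) (v : K -> \bar int) (m : nat)
    (U : set 'rV[K]_m) : Prop :=
  forall x, U x -> exists2 eps : rat, 0 < eps &
    forall y, padic_norm p v (y - x) < eps -> U y.

Definition powers (K : fieldType) (n : nat) : set K :=
  [set x | x != 0 /\ exists y : K, y ^+ n = x].

Inductive semialgebraic (K : fieldType) (m : nat) : set 'rV[K]_m -> Prop :=
| SemialgBasic (f : {mpoly K[m]}) (n : nat) : (1 <= n)%N ->
    semialgebraic [set x | powers n (f.@[fun i => x ord0 i])]
| SemialgU A B : semialgebraic A -> semialgebraic B -> semialgebraic (A `|` B)
| SemialgI A B : semialgebraic A -> semialgebraic B -> semialgebraic (A `&` B)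
| SemialgC A : semialgebraic A -> semialgebraic (~` A).

(* Functions X -> K^n are represented by total functions; only the part of the
   graph lying above X is relevant. *)
Definition graph_on (K : fieldType) (m n : nat) (X : set 'rV[K]_m)
    (f : 'rV[K]_m -> 'rV[K]_n) : set 'rV[K]_(m + n) :=
  [set row_mx x (f x) | x in X].

Definition semialg_bij (K : fieldType) (m n : nat) (X : set 'rV[K]_m)
    (Y : set 'rV[K]_n) (f : 'rV[K]_m -> 'rV[K]_n) : Prop :=
  set_bij X Y f /\ semialgebraic (graph_on X f).

Definition has_chart (p : nat) (K : fieldType) (v : K -> \bar int) (m : nat)
    (X : set 'rV[K]_m) (d : nat) : Prop :=
  exists (A : set 'rV[K]_m) (U : set 'rV[K]_d) (f : 'rV[K]_m -> 'rV[K]_d),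
    [/\ A `<=` X, A !=set0 & semialgebraic A] /\
    [/\ U !=set0, semialgebraic U & padic_open p v U] /\
    semialg_bij A U f.

Definition is_dim (p : nat) (K : fieldType) (v : K -> \bar int) (m : nat)
    (X : set 'rV[K]_m) (d : int) : Prop :=
  (X = set0 /\ d = -1) \/
  (X !=set0 /\ exists k : nat,
     [/\ d = k%:Z, has_chart p v X k &
         forall j : nat, has_chart p v X j -> (j <= k)%N]).

(* Main.v *)
(** Proof idea.  Let E be a semialgebraic set in K^(n+1), fibred over K^n by its last
coordinate t.  Quantifier elimination comes with a normal form: there are finitely many
semialgebraic centers c such that E is a disjoint union of sets on which membership of t
depends only on the valuation of s = t - c, compared with semialgebraic thresholds, and on
the class of s in a finite quotient K^* / pi^(NZ) (1 + pi^N O).  The centers are found by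
induction on the degree of the polynomials describing E, as centers of the derivative
together with semialgebraic root functions supplied by Hensel's lemma.

Consequently every E is a disjoint union of graphs and of cells over semialgebraic bases
D, where a cell is an interval of valuations inside one class.  Compute with sets up to
semialgebraic bijection and write [W] for D x W.  For a ray a = pi^(NZ) (1 + pi^N O)
intersected with O, the maps t -> t^r give a = (q + 1) a and a = q x a for some x > 0,
where q is the residue characteristic, so that a = 2a; splitting off units gives
a = a + [O], and O is a finite union of rays and a point.  All this collapses to
[O] = a = 1 + [O] = 2 [O] = [K], and cells, bounded or not, are also [O].  Hence by
induction on n each semialgebraic set is finite or in bijection with some K^k.

It remains to see that K^(k+1) does not inject into K^k.  The images Y_a of the
hyperplanes x_0 = a are disjoint.  If Y_a has empty interior it lies in the zero set of a
polynomial, hence is smaller than K^k by the classification, contradicting the induction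
hypothesis; so every Y_a contains a ball.  Only finitely many disjoint balls of a given
radius fit into a bounded region, so K would be countable. *)

Require Import Defs.
From HB Require Import structures.
From mathcomp Require Import all_boot all_order all_algebra all_field.
From mathcomp Require Import mpoly.
From mathcomp Require Import boolp classical_sets functions cardinality.
From mathcomp Require Import constructive_ereal.
From mathcomp Require Import zify ring.
From Corelib Require Import Setoid Morphisms.

Set Implicit Arguments.
Unset Strict Implicit.
Unset Printing Implicit Defensive.

Import Order.TTheory GRing.Theory Num.Theory.

(** Everything about semialgebraic sets is proved from the axioms of [lfield], where the value group
    is Z, so that ramification disappears. The obstacle in quantifier elimination is circularity: a
    function with semialgebraic graph can be substituted into a formula only once projections are
    known to be semialgebraic. Semialgebraic functions are therefore defined by substitution ([sf]),
    and each root function must be shown to have this property inside the induction on the degree.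
    For a root of G of degree d, every polynomial can be reduced modulo G to degree less than d,
    where centers are already available; the leading term of root minus center is then read off from
    the root, from the center, or from one Newton step.

    Bijection classes form a monoid under disjoint union in which nothing may be cancelled, so each
    identity between them has to come from absorption. The exponent q + 1 occurs because it is
    greater than 1 and a unit: raising to this power loses no precision near 1. The same exponent
    serves to define O by powers. *)

Local Open Scope ring_scope.

(* The junk value [w 0] is never used: [dv a b] means v(a) <= v(b), with v(0) = +oo. *)
Definition dv_of (K : fieldType) (w : K -> int) (a b : K) : bool :=
  (b == 0) || ((a != 0) && (w a <= w b)).

(* [resp] replaces the residue characteristic: all that matters is that it is an integer
   greater than 1 of positive valuation. *)
HB.mixin Record isLocalField K of GRing.Field K := {
  w : K -> int;
  pi_of : K;
  resp : nat;
  wM : forall x y, x != 0 -> y != 0 -> w (x * y) = w x + w y;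
  wD : forall x y m, x != 0 -> y != 0 -> x + y != 0 ->
    m <= w x -> m <= w y -> m <= w (x + y);
  pi_neq0 : pi_of != 0;
  w_pi : w pi_of = 1;
  lf_complete : forall u : nat -> K,
    (forall n, dv_of w (pi_of ^+ n) (u n.+1 - u n)) ->
    exists l, forall n, dv_of w (pi_of ^+ n) (u n - l);
  lf_finite : forall n : nat, exists rs : seq K, forall x,
    dv_of w 1 x -> exists2 r, r \in rs & dv_of w (pi_of ^+ n) (x - r);
  lf_char0 : forall n, n.+1%:R != 0 :> K;
  resp_gt1 : (1 < resp)%N;
  w_resp : 0 < w resp%:R }.
HB.structure Definition LField := { K of isLocalField K & GRing.Field K }.
Notation lfield := LField.type.

Notation pi := pi_of.
Arguments wM {s} [x y].
Arguments wD {s} [x y m].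

Definition dv (F : lfield) (a b : F) : bool := dv_of (@w F) a b.

(** Greedy selection along [rs]. The Euclidean property and reflexivity on [P] make [R] symmetric
    and transitive there, so it is enough to represent the members of [rs]. *)
Lemma transversal (T : eqType) (R : T -> T -> bool) (P : T -> Prop) (rs : seq T) :
  (forall x, P x -> R x x) -> (forall x y z, R x y -> R x z -> R y z) ->
  (forall r, r \in rs -> P r) -> (forall x, P x -> exists2 r, r \in rs & R r x) ->
  exists rs', [/\ uniq rs', forall r, r \in rs' -> r \in rs,
    forall r r', r \in rs' -> r' \in rs' -> R r r' -> r = r' &
    forall x, P x -> exists2 r, r \in rs' & R r x].
Proof.
move=> Rr Re rsP cov.
suff [rs' [h1 h2 h3 h4]] : exists rs', [/\ uniq rs', {subset rs' <= rs},
    forall r r', r \in rs' -> r' \in rs' -> R r r' -> r = r' &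
    forall x, x \in rs -> exists2 r, r \in rs' & R r x].
  exists rs'; split=> // x Px; have [r r1 r2] := cov x Px.
  by have [r' r3 r4] := h4 r r1; exists r' => //; apply: (Re r _ _ _ r2); apply: (Re r' _ _ r4); apply/Rr/rsP/h2.
elim: rs rsP {cov} => [|a rs IH] rsP; first by exists [::].
have [|rs' [h1 h2 h3 h4]] := IH; first by move=> r h; apply: rsP; rewrite inE h orbT.
have Pa : P a by apply: rsP; rewrite inE eqxx.
have P' r : r \in rs' -> P r by move=> h; apply: rsP; rewrite inE h2 ?orbT.
have [/hasP[r r1 r2]|/hasPn ha] := boolP (has (fun r => R r a) rs').
  exists rs'; split=> // [x xr|x]; first by rewrite inE h2 ?orbT.
  by rewrite inE => /orP[/eqP->|/h4//]; exists r.
exists (a :: rs'); split.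
- by rewrite /= h1 andbT; apply/negP=> /[dup] /ha /negP h /P' /Rr.
- by move=> x; rewrite !inE => /orP[->//|/h2->]; rewrite orbT.
- move=> r r'; rewrite !inE => /orP[/eqP->|h5] /orP[/eqP->|h6] // h7.
  + by case/negP: (ha _ h6); apply: (Re a _ _ h7 (Rr _ Pa)).
  + by case/negP: (ha _ h5).
  + exact: h3.
- move=> x; rewrite inE => /orP[/eqP->|/h4[r r1 r2]].
    by exists a; rewrite ?inE ?eqxx //; apply: Rr.
  by exists r; rewrite // inE r1 orbT.
Qed.

(** * Divisibility, leading terms and classes in a discretely valued field *)

Section Valuation.
Variable F : lfield.
Implicit Types (a b c d x y s t : F) (n m k N M : nat).

Lemma dvE a b : dv a b = (b == 0) || ((a != 0) && (w a <= w b)).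
Proof. by []. Qed.

Lemma dvP a b : reflect (b = 0 \/ [/\ a != 0, b != 0 & w a <= w b]) (dv a b).
Proof.
rewrite dvE; have [->|b0] := eqVneq b 0; first by constructor; left.
apply: (iffP andP) => [[? ?]|]; first by right.
by case=> [b00|[]//]; rewrite b00 eqxx in b0.
Qed.

Lemma dv_w a b : a != 0 -> b != 0 -> dv a b = (w a <= w b).
Proof. by move=> a0 b0; rewrite dvE (negPf b0) a0. Qed.

Lemma dv0 a : dv a 0. Proof. by rewrite dvE eqxx. Qed.

Lemma dv0l b : dv 0 b = (b == 0).
Proof. by rewrite dvE eqxx orbF. Qed.

Lemma dv_refl a : dv a a.
Proof. by rewrite dvE; case: eqP => //= _; rewrite lexx. Qed.

Lemma dv_trans b a c : dv a b -> dv b c -> dv a c.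
Proof.
move=> /dvP[-> | [a0 b0 ab]]; first by rewrite dv0l => /eqP->; rewrite dv0.
move=> /dvP[-> | [_ c0 bc]]; first exact: dv0.
by rewrite dv_w // (le_trans ab).
Qed.

Lemma dv_total a b : dv a b || dv b a.
Proof.
have [->|a0] := eqVneq a 0; first by rewrite dv0 orbT.
have [->|b0] := eqVneq b 0; first by rewrite dv0.
by rewrite !dv_w // le_total.
Qed.

Lemma w1 : w (1 : F) = 0.
Proof.
have := wM (oner_neq0 F) (oner_neq0 F).
by rewrite mulr1 -[LHS]addr0 => /addrI.
Qed.

Lemma wV x : x != 0 -> w x^-1 = - w x.
Proof.
move=> x0; have := wM x0 (invr_neq0 x0); rewrite mulfV // w1; lia.
Qed.

Lemma wN x : w (- x) = w x.
Proof.
have [->|x0] := eqVneq x 0; first by rewrite oppr0.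
have n10 : (-1 : F) != 0 by rewrite oppr_eq0 oner_eq0.
have := wM n10 n10; rewrite mulrNN mulr1 w1 => h.
by rewrite -mulN1r wM // ; lia.
Qed.

Lemma wX x n : x != 0 -> w (x ^+ n) = w x * n%:Z.
Proof.
move=> x0; elim: n => [|n IH]; first by rewrite expr0 w1; lia.
by rewrite exprS wM ?expf_neq0 // IH; lia.
Qed.

Lemma pin0 n : pi ^+ n != 0 :> F. Proof. by rewrite expf_neq0 ?pi_neq0. Qed.

Lemma w_pin n : w (pi ^+ n : F) = n%:Z.
Proof. by rewrite wX ?pi_neq0 // w_pi; lia. Qed.

Lemma piz0 (i : int) : pi ^ i != 0 :> F.
Proof. by rewrite expfz_neq0 // pi_neq0. Qed.

Lemma w_piz (i : int) : w (pi ^ i : F) = i.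
Proof.
case: i => n; first exact: w_pin.
by rewrite NegzE -exprnN wV ?pin0 // w_pin.
Qed.

Lemma dvN a b : dv a (- b) = dv a b.
Proof. by rewrite !dvE oppr_eq0 wN. Qed.

Lemma dvBC a b c : dv a (b - c) = dv a (c - b).
Proof. by rewrite -dvN opprB. Qed.

Lemma dvD a b c : dv a b -> dv a c -> dv a (b + c).
Proof.
move=> /dvP[->|[a0 b0 ab]]; first by rewrite add0r.
move=> /dvP[->|[_ c0 ac]]; first by rewrite addr0 dv_w.
have [->|bc0] := eqVneq (b + c) 0; first exact: dv0.
by rewrite dv_w // wD.
Qed.

Lemma dvB a b c : dv a b -> dv a c -> dv a (b - c).
Proof. by move=> ab ac; rewrite dvD // dvN. Qed.

Lemma dvM a b c d : dv a b -> dv c d -> dv (a * c) (b * d).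
Proof.
move=> /dvP[->|[a0 b0 ab]]; first by rewrite mul0r dv0.
move=> /dvP[->|[c0 d0 cd]]; first by rewrite mulr0 dv0.
by rewrite dv_w ?mulf_neq0 // !wM // lerD.
Qed.

Lemma dvM2l c a b : c != 0 -> dv (c * a) (c * b) = dv a b.
Proof.
move=> c0; rewrite !dvE !mulf_eq0 (negPf c0) /=.
have [->|a0] := eqVneq a 0; first by rewrite !orbF.
have [->|b0] := eqVneq b 0; first by [].
by rewrite /= !wM // lerD2l.
Qed.

Lemma dvM2r c a b : c != 0 -> dv (a * c) (b * c) = dv a b.
Proof. by move=> c0; rewrite ![_ * c]mulrC dvM2l. Qed.

Lemma dvX a b n : dv a b -> dv (a ^+ n) (b ^+ n).
Proof. by move=> ab; elim: n => [|n IH]; rewrite ?expr0 ?dv_refl // !exprS dvM. Qed.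

Lemma dvXE a b n : (0 < n)%N -> dv (a ^+ n) (b ^+ n) = dv a b.
Proof.
move=> n0; apply/idP/idP; last exact: dvX.
rewrite !dvE !expf_eq0 n0 /=.
have [->|a0] := eqVneq a 0; first by rewrite !orbF.
have [->|b0] := eqVneq b 0; first by [].
rewrite /= !wX //; nia.
Qed.

Lemma dv_mulr a b c : dv a b -> dv 1 c -> dv a (b * c).
Proof. by move=> ab c1; rewrite -[a]mulr1 dvM. Qed.

Lemma dv_mull a b c : dv a b -> dv 1 c -> dv a (c * b).
Proof. by move=> ab c1; rewrite mulrC dv_mulr. Qed.

Lemma dv_pin n : dv 1 (pi ^+ n : F).
Proof. by rewrite dv_w ?pin0 ?oner_eq0 // w1 w_pin; lia. Qed.

Lemma dv_pi2 n m : dv (pi ^+ n : F) (pi ^+ m) = (n <= m)%N.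
Proof. by rewrite dv_w ?pin0 // !w_pin lez_nat. Qed.

Lemma dv_sum (I : Type) (r : seq I) (P : pred I) a (f : I -> F) :
  (forall i, P i -> dv a (f i)) -> dv a (\sum_(i <- r | P i) f i).
Proof.
by move=> h; elim/big_ind: _ => // [|x y]; [exact: dv0 | exact: dvD].
Qed.

Lemma dv1n n : dv (1 : F) n%:R.
Proof. by elim: n => [|n IH]; rewrite ?dv0 // -addn1 natrD dvD ?dv_refl. Qed.

(** Discreteness of the valuation: the strict inequality v(a) < v(b) becomes a non-strict one, so
    that [dv] expresses both. *)
Lemma sdv a b : a != 0 -> dv (pi * a) b = ~~ dv b a.
Proof.
move=> a0; have [->|b0] := eqVneq b 0; first by rewrite dv0 dv0l a0.
rewrite !dv_w ?mulf_neq0 ?pi_neq0 // wM ?pi_neq0 // w_pi; lia.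
Qed.

Lemma dv_pile n a : dv a (pi ^+ n * a).
Proof. by rewrite dv_mull ?dv_refl ?dv_pin. Qed.

Lemma dv_pi_le m n a b : (m <= n)%N -> dv (pi ^+ n * a) b -> dv (pi ^+ m * a) b.
Proof.
by move=> mn; apply: dv_trans; rewrite dvM ?dv_refl // dv_pi2.
Qed.

Lemma dv_addl a b c : dv a b -> dv a (b + c) = dv a c.
Proof.
move=> ab; apply/idP/idP => h; last exact: dvD.
by rewrite (_ : c = b + c - b) ?dvB //; ring.
Qed.

(* Leading-term congruence: a and b have the same valuation and a/b = 1 mod pi^N. *)
Definition rve N a b := dv (pi ^+ N * a) (a - b).

Lemma rve_le M N a b : (M <= N)%N -> rve N a b -> rve M a b.
Proof. exact: dv_pi_le. Qed.

Lemma rve_w N a b : (0 < N)%N -> rve N a b -> a != 0 ->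
  b != 0 /\ w a = w b.
Proof.
move=> N0 ab a0; have {N0}ab : rve 1 a b by apply: rve_le ab.
rewrite /rve expr1 in ab.
have b0 : b != 0.
  by apply/negP=> /eqP b0; rewrite b0 subr0 sdv // dv_refl in ab.
split=> //; apply/eqP; rewrite eq_le -!dv_w //.
have h1 : dv a (a - b) by apply: dv_trans ab; rewrite dv_mull ?dv_refl // (dv_pin 1).
have -> : dv a b by rewrite -dvN -(dv_addl _ (dv_refl a)).
rewrite andTb; apply: contraT; rewrite -sdv // => h2.
have : dv (pi * a) a.
  rewrite (_ : a = (a - b) + b); last by ring.
  by apply: dvD; rewrite subrK //; apply: dv_trans h2; rewrite dvM ?dv_refl.
by rewrite sdv // dv_refl.
Qed.

Lemma rve0l N b : rve N 0 b -> b = 0.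
Proof. by rewrite /rve mulr0 dv0l sub0r oppr_eq0 => /eqP. Qed.

Lemma rve_refl N a : rve N a a.
Proof. by rewrite /rve subrr dv0. Qed.

Lemma rve_dv N a b : (0 < N)%N -> rve N a b -> dv a b /\ dv b a.
Proof.
move=> N0 ab; have [a0|a0] := eqVneq a 0.
  by move: ab; rewrite a0 => /rve0l ->; rewrite dv_refl.
by have [b0 e] := rve_w N0 ab a0; rewrite !dv_w // e lexx.
Qed.

Lemma rve_sym N a b : (0 < N)%N -> rve N a b -> rve N b a.
Proof.
move=> N0 ab; have [_ h] := rve_dv N0 ab.
by rewrite /rve dvBC; apply: dv_trans ab; rewrite dvM ?dv_refl.
Qed.

Lemma rve_trans N b a c : (0 < N)%N -> rve N a b -> rve N b c -> rve N a c.
Proof.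
move=> N0 ab bc; rewrite /rve (_ : a - c = (a - b) + (b - c)); last by ring.
apply: dvD => //; apply: dv_trans bc.
by rewrite dvM ?dv_refl //; case: (rve_dv N0 ab).
Qed.

Lemma rveM N a b c d : (0 < N)%N -> rve N a b -> rve N c d -> rve N (a * c) (b * d).
Proof.
move=> N0 ab cd.
rewrite /rve (_ : a * c - b * d = (a - b) * c + b * (c - d)); last by ring.
apply: dvD; first by rewrite mulrA dvM ?dv_refl.
by rewrite mulrCA dvM //; case: (rve_dv N0 ab).
Qed.

Lemma rveX N a b n : (0 < N)%N -> rve N a b -> rve N (a ^+ n) (b ^+ n).
Proof.
move=> N0 ab; elim: n => [|n IH]; first exact: rve_refl.
by rewrite !exprS rveM.
Qed.

Lemma rveM2l N c a b : c != 0 -> rve N (c * a) (c * b) = rve N a b.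
Proof. by move=> c0; rewrite /rve -mulrBr mulrCA dvM2l. Qed.

Lemma dv_rve N a a' b b' : (0 < N)%N -> rve N a a' -> rve N b b' ->
  dv a b = dv a' b'.
Proof.
move=> N0 /rve_dv-/(_ N0)[h1 h2] /rve_dv-/(_ N0)[h3 h4].
by apply/idP/idP => h; [apply: dv_trans h2 (dv_trans h h3)
                     | apply: dv_trans h1 (dv_trans h h4)].
Qed.

(** The angular component for the uniformizer [pi], multiplicative and of valuation 0 on nonzero
    elements; [ac 0] is 0 whatever [w 0] is. *)
Definition ac x := x * pi ^ (- w x).

Lemma ac_neq0 x : (ac x == 0) = (x == 0).
Proof. by rewrite mulf_eq0 (negPf (piz0 _)) orbF. Qed.

Lemma w_ac x : x != 0 -> w (ac x) = 0.
Proof. by move=> x0; rewrite wM ?piz0 // w_piz; lia. Qed.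

Lemma acE x : x = ac x * pi ^ (w x).
Proof. by rewrite /ac -mulrA -expfzDr ?pi_neq0 // addNr expr0z mulr1. Qed.

Lemma acM x y : x != 0 -> y != 0 -> ac (x * y) = ac x * ac y.
Proof.
move=> x0 y0; rewrite /ac wM // opprD expfzDr ?pi_neq0 //; ring.
Qed.

Lemma acX x n : x != 0 -> ac (x ^+ n) = ac x ^+ n.
Proof.
move=> x0; elim: n => [|n IH]; first by rewrite /ac !expr0 w1 oppr0 expr0z mulr1.
by rewrite !exprS acM ?expf_neq0 // IH.
Qed.

Lemma ac_unit x : w x = 0 -> ac x = x.
Proof. by move=> e; rewrite /ac e oppr0 expr0z mulr1. Qed.

Lemma ac_piz (i : int) : ac (pi ^ i) = 1.
Proof. by rewrite /ac w_piz -expfzDr ?pi_neq0 // addrN expr0z. Qed.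

Lemma acV x : x != 0 -> ac x^-1 = (ac x)^-1.
Proof.
move=> x0; have a0 : ac x != 0 by rewrite ac_neq0.
apply: (mulIf a0); rewrite mulVf // -acM ?invr_neq0 // mulVf //.
by rewrite ac_unit ?w1.
Qed.

(* s' lies in s * pi^(N Z) * (1 + pi^N O). *)
Definition cls N x y :=
  [&& x != 0, y != 0, (N%:Z %| w x - w y)%Z & dv (pi ^+ N) (ac x - ac y)].

Lemma rve_unit N x y : w x = 0 -> x != 0 -> rve N x y = dv (pi ^+ N) (x - y).
Proof.
move=> e x0; rewrite /rve; apply/idP/idP; apply: dv_trans.
  by rewrite dv_w ?mulf_neq0 ?pin0 // wM ?pin0 // e addr0.
by rewrite dv_w ?mulf_neq0 ?pin0 // wM ?pin0 // e addr0.
Qed.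

Lemma cls_refl N x : x != 0 -> cls N x x.
Proof. by move=> x0; rewrite /cls x0 !subrr dvdz0 dv0. Qed.

Lemma cls_sym N x y : cls N x y = cls N y x.
Proof.
rewrite /cls dvBC andbCA; congr [&& _, _, _ & _].
by rewrite -rpredN opprB.
Qed.

Lemma cls_trans N y x z : cls N x y -> cls N y z -> cls N x z.
Proof.
move=> /and4P[x0 y0 h1 h2] /and4P[_ z0 h3 h4]; rewrite /cls x0 z0 /=.
rewrite (_ : w x - w z = (w x - w y) + (w y - w z)); last by ring.
rewrite rpredD // (_ : ac x - ac z = (ac x - ac y) + (ac y - ac z)); last by ring.
exact: dvD.
Qed.

Lemma cls_le M N x y : (M %| N)%N -> (0 < N)%N -> cls N x y -> cls M x y.
Proof.
move=> MN N0 /and4P[x0 y0 h1 h2]; rewrite /cls x0 y0 /=; apply/andP; split.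
  by apply: dvdz_trans h1; rewrite dvdzE.
by apply: dv_trans h2; rewrite dv_pi2 dvdn_leq.
Qed.

Lemma unit_dv x : x != 0 -> w x = 0 -> dv 1 x /\ dv x 1.
Proof. by move=> x0 e; rewrite !dv_w ?oner_eq0 // w1 e lexx. Qed.

Lemma clsM N x y x' y' : cls N x x' -> cls N y y' -> cls N (x * y) (x' * y').
Proof.
move=> /and4P[x0 x0' h1 h2] /and4P[y0 y0' h3 h4]; rewrite /cls !mulf_neq0 //=.
apply/andP; split.
  rewrite !wM // (_ : w x + w y - _ = (w x - w x') + (w y - w y')); last by ring.
  exact: rpredD.
rewrite !acM // (_ : ac x * ac y - _ = (ac x - ac x') * ac y + (ac y - ac y') * ac x');
  last by ring.
have acO z : z != 0 -> dv 1 (ac z).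
  by move=> z0; have [] := unit_dv _ (w_ac z0); rewrite ?ac_neq0.
by apply: dvD; apply: dv_mulr; rewrite ?acO.
Qed.

Lemma clsV N x x' : cls N x x' -> cls N x^-1 x'^-1.
Proof.
move=> /and4P[x0 x0' h1 h2]; rewrite /cls !invr_eq0 x0 x0' /= !wV // !acV //.
apply/andP; split; first by rewrite -rpredN (_ : - (- w x - - w x') = w x - w x') //; ring.
have a0 : ac x != 0 by rewrite ac_neq0.
have a0' : ac x' != 0 by rewrite ac_neq0.
rewrite (_ : (ac x)^-1 - _ = (ac x' - ac x) * (ac x)^-1 * (ac x')^-1); last first.
  by field; rewrite a0 a0'.
have acO z : z != 0 -> dv 1 (ac z)^-1.
  move=> z0; have b0 : (ac z) != 0 by rewrite ac_neq0.
  by rewrite dv_w ?oner_eq0 ?invr_eq0 // wV // w_ac // w1 oppr0.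
by rewrite dvBC in h2; apply: dv_mulr (acO _ x0'); apply: dv_mulr (acO _ x0).
Qed.

Lemma clsX N x x' n : cls N x x' -> cls N (x ^+ n) (x' ^+ n).
Proof.
move=> h; elim: n => [|n IH]; first by rewrite !expr0 cls_refl ?oner_eq0.
by rewrite !exprS clsM.
Qed.

Lemma rve_cls N x y : (0 < N)%N -> x != 0 ->
  rve N x y <-> w x = w y /\ cls N x y.
Proof.
move=> N0 x0; split=> [h|[e /and4P[_ y0 _ h]]].
  have [y0 e] := rve_w N0 h x0; split=> //.
  rewrite /cls x0 y0 e subrr dvdz0 /= /ac e -mulrBl.
  rewrite -(dvM2r _ _ (piz0 (w y))) -mulrA -expfzDr ?pi_neq0 // addNr expr0z mulr1.
  apply: dv_trans h; rewrite dv_w ?mulf_neq0 ?pin0 ?piz0 //.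
  by rewrite !wM ?pin0 ?piz0 // w_piz e.
rewrite /rve; move: h; rewrite /ac e -mulrBl.
rewrite -(dvM2r _ _ (piz0 (w y))) -mulrA -expfzDr ?pi_neq0 // addNr expr0z mulr1.
apply: dv_trans; rewrite dv_w ?mulf_neq0 ?pin0 ?piz0 //.
by rewrite !wM ?pin0 ?piz0 // w_piz e.
Qed.

Lemma cls_mulpi N x (i : int) : x != 0 -> cls N x (x * pi ^ (N%:Z * i)).
Proof.
move=> x0; rewrite /cls x0 mulf_neq0 ?piz0 //= wM ?piz0 // w_piz.
rewrite acM ?piz0 // ac_piz mulr1 subrr dv0 andbT.
by rewrite opprD addrA subrr add0r rpredN dvdz_mulr.
Qed.

Lemma wDl x y : x != 0 -> dv (pi * x) y -> x + y != 0 /\ w (x + y) = w x.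
Proof.
move=> x0 h.
have r : rve 1 x (x + y) by rewrite /rve expr1 opprD addrA subrr add0r dvN.
by have [h0 ->] := rve_w (isT : (0 < 1)%N) r x0.
Qed.

Lemma int_finite n : exists rs : seq F, forall x, dv 1 x ->
  exists2 r, r \in rs & dv (pi ^+ n) (x - r).
Proof. exact: lf_finite. Qed.

Lemma w_respS : w ((@resp F).+1%:R : F) = 0.
Proof.
have p0 : (@resp F)%:R != 0 :> F.
  have := @resp_gt1 F; case: (@resp F) => // n _; exact: lf_char0.
have h : dv (pi * 1) ((@resp F)%:R : F).
  by rewrite mulr1 dv_w ?pi_neq0 // w_pi -gtz0_ge1; exact: w_resp.
by have [_] := wDl (oner_neq0 F) h; rewrite w1 -[X in _ + X]/(_%:R) addrC natr1.
Qed.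

Lemma char0 n : (0 < n)%N -> n%:R != 0 :> F.
Proof. by case: n => // n _; exact: lf_char0. Qed.

(** Representatives are [pi ^+ j * r] with j < N and r a unit modulo pi^N. The normalization
    [0 <= w r < N] matters later: for t in the class of r, t / r is integral exactly when t is. *)
Lemma finite_cls N : (0 < N)%N -> exists rs : seq F,
  [/\ uniq rs, forall r, r \in rs -> r != 0 /\ 0 <= w r < N%:Z,
    forall r r', r \in rs -> r' \in rs -> cls N r r' -> r = r' &
    forall x, x != 0 -> exists2 r, r \in rs & cls N r x].
Proof.
move=> N0; have [rs hrs] := int_finite N.
pose us := [seq r <- rs | (r != 0) && (w r == 0)].
pose ls := [seq pi ^+ j * r | j <- iota 0 N, r <- us].
have lsP r : r \in ls -> r != 0 /\ 0 <= w r < N%:Z.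
  move=> /allpairsP[[j u] /= [jN]]; rewrite mem_filter => /andP[/andP[u0 /eqP wu] _] ->.
  rewrite mulf_neq0 ?pin0 // wM ?pin0 // wu w_pin; split=> //.
  by move: jN; rewrite mem_iota; lia.
have [|x y z xy xz|r /lsP[]//|x x0|rs' [h1 h2 h3 h4]] :=
  @transversal F (cls N) (fun x => x != 0) ls.
- exact: cls_refl.
- by apply: cls_trans xz; rewrite cls_sym.
- have a0 : ac x != 0 by rewrite ac_neq0.
  have [r r1 r2] := hrs (ac x) (unit_dv a0 (w_ac x0)).1.
  have rv : rve N (ac x) r by rewrite rve_unit // w_ac.
  have [r0 wr] := rve_w N0 rv a0; rewrite w_ac // in wr.
  pose j := `|(w x %% N%:Z)%Z|%N.
  have jE : j%:Z = (w x %% N%:Z)%Z by rewrite /j gez0_abs // modz_ge0 //; lia.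
  have jN : (j < N)%N by rewrite -ltz_nat jE ltz_pmod.
  exists (pi ^+ j * r).
    by apply/allpairsP; exists (j, r); rewrite mem_iota mem_filter r0 -wr eqxx r1.
  rewrite /cls mulf_neq0 ?pin0 // x0 /= wM ?pin0 // -wr addr0 w_pin jE.
  rewrite acM ?pin0 // (ac_piz j) mul1r (ac_unit (esym wr)) dvBC r2 andbT.
  rewrite [X in _ - X](divz_eq (w x) N%:Z) opprD addrCA subrr addr0 rpredN.
  exact: dvdz_mull.
- exists rs'; split=> // [r /h2/lsP//].
Qed.

End Valuation.

(** * Taylor expansions and Hensel's lemma *)

Definition shift (K : fieldType) (p : {poly K}) (c : K) := p \Po ('X + c%:P).

Section Shift.
Variable K : fieldType.
Implicit Types (p q : {poly K}) (c s : K).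

Lemma horner_shift p c s : (shift p c).[s] = p.[s + c].
Proof. by rewrite /shift horner_comp !hornerE. Qed.

Lemma shift_deriv p c : (shift p c)^`() = shift p^`() c.
Proof. by rewrite /shift deriv_comp derivD derivX derivC addr0 mulr1. Qed.

Lemma shift0 p c : (shift p c)`_0 = p.[c].
Proof. by rewrite -horner_coef0 horner_shift add0r. Qed.

Lemma shift1 p c : (shift p c)`_1 = p^`().[c].
Proof. by rewrite -shift0 -shift_deriv coef_deriv mulr1n. Qed.

Lemma size_shift p c : size (shift p c) = size p.
Proof. by rewrite /shift size_comp_poly2 // size_XaddC. Qed.

Lemma poly_split1 q : exists q' : {poly K},
  q = q' * 'X + (q`_0)%:P /\ forall j, q'`_j = q`_j.+1.
Proof.
exists (drop_poly 1 q); split=> [|j]; last by rewrite coef_drop_poly addn1.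
rewrite -{1}[q](poly_take_drop 1) expr1 addrC; congr (_ + _).
by apply/polyP=> i; rewrite coef_take_poly coefC; case: i.
Qed.

End Shift.

Section Hensel.
Variable F : lfield.
Implicit Types (a b c d x y s t u : F) (n m k N M e : nat) (h p q : {poly F}).

Definition ipoly h := forall j, dv 1 h`_j.

Lemma ipolyD p q : ipoly p -> ipoly q -> ipoly (p + q).
Proof. by move=> hp hq j; rewrite coefD; apply: dvD. Qed.

Lemma ipolyM p q : ipoly p -> ipoly q -> ipoly (p * q).
Proof. by move=> hp hq j; rewrite coefM; apply: dv_sum => i _; apply: dv_mulr. Qed.

Lemma ipolyC c : dv 1 c -> ipoly c%:P.
Proof. by move=> hc [|j]; rewrite coefC //= dv0. Qed.

Lemma ipolyX : ipoly 'X.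
Proof. by move=> j; rewrite coefX; exact: dv1n. Qed.

Lemma ipoly_shift h c : ipoly h -> dv 1 c -> ipoly (shift h c).
Proof.
move=> hh hc; rewrite /shift comp_polyE.
elim/big_ind: _ => [j||i _]; [by rewrite coef0 dv0 | exact: ipolyD |].
rewrite -mul_polyC; apply: ipolyM; first exact: ipolyC.
elim: (nat_of_ord i) => [|k IH]; first by rewrite expr0; apply/ipolyC/dv_refl.
by rewrite exprS; apply: ipolyM => //; apply: ipolyD ipolyX (ipolyC _).
Qed.

Lemma ipoly_deriv h : ipoly h -> ipoly h^`().
Proof. by move=> hh j; rewrite coef_deriv -mulr_natr dv_mulr ?dv1n. Qed.

Lemma dv_horner h x : ipoly h -> dv 1 x -> dv 1 h.[x].
Proof.
move=> hh hx; rewrite horner_coef; apply: dv_sum => i _; apply: dv_mulr => //.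
by rewrite -(expr1n _ i) dvX.
Qed.

(** The remainder is a value of the shifted polynomial with its two lowest coefficients dropped; it
    is integral without any division by 2. *)
Lemma ipoly_taylor h x y : ipoly h -> dv 1 x -> dv 1 y ->
  exists2 r, dv 1 r & h.[x] - h.[y] = (x - y) * (h^`().[y] + (x - y) * r).
Proof.
move=> hh hx hy; have hq := ipoly_shift hh hy.
have [q1 [e1 c1]] := poly_split1 (shift h y).
have [q2 [e2 c2]] := poly_split1 q1.
exists q2.[x - y].
  by apply: dv_horner => [j|]; rewrite ?c2 ?c1 // dvB.
rewrite -{1}(subrK y x) -horner_shift e1 e2 c1 shift0 shift1 !hornerE; ring.
Qed.

Lemma ipoly_lip h x y : ipoly h -> dv 1 x -> dv 1 y -> dv (x - y) (h.[x] - h.[y]).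
Proof.
move=> hh hx hy; have [r hr ->] := ipoly_taylor hh hx hy.
apply: dv_mulr; first exact: dv_refl.
apply: dvD; first by apply: dv_horner => //; apply: ipoly_deriv.
by apply: dv_mulr => //; apply: dvB.
Qed.

Lemma dv_all0 x : (forall n, dv (pi ^+ n) x) -> x = 0.
Proof.
move=> hx; apply/eqP; apply: contraT => x0.
by have := hx `|w x|.+1%N; rewrite dv_w ?pin0 // w_pin; lia.
Qed.

Lemma dv_div m e d x : dv d (pi ^+ e) -> dv (pi ^+ (m + e)) x -> dv (pi ^+ m) (x / d).
Proof.
move=> hd hx; have d0 : d != 0.
  by apply: contraTN hd => /eqP->; rewrite dv0l pin0.
rewrite -(dvM2r _ _ d0) divfK //; apply: dv_trans hx.
by rewrite exprD dvM ?dv_refl.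
Qed.

Lemma dv_near d x e : dv d (pi ^+ e) -> dv (pi ^+ e.+1) x -> dv (d + x) (pi ^+ e).
Proof.
move=> hd hx; have d0 : d != 0.
  by apply: contraTN hd => /eqP->; rewrite dv0l pin0.
have h : dv (pi * d) x by apply: dv_trans hx; rewrite exprS dvM ?dv_refl.
have [h0 hw] := wDl d0 h.
by rewrite dv_w ?pin0 // hw -dv_w ?pin0.
Qed.

(** Newton's iteration with the slope frozen at [a]. Each step gains at least one power of pi, and
    this linear rate is all that completeness requires. The margin [M] turns a smaller value of [h]
    into a closer root. *)
Theorem hensel h a e M : ipoly h -> dv 1 a -> dv h^`().[a] (pi ^+ e) ->
  dv (pi ^+ (e + e + M).+1) h.[a] ->
  exists2 r, h.[r] = 0 & dv (pi ^+ (e + M).+1) (r - a).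
Proof.
move=> hh ha hd h0; set d := h^`().[a] in hd.
pose f x := x - h.[x] / d; pose u n := iter n f a.
have inv n : dv (pi ^+ (e + M).+1) (u n - a) /\ dv (pi ^+ (e + e + M + n).+1) h.[u n].
  elim: n => [|n [IH1 IH2]]; first by rewrite /u /= subrr dv0 addn0.
  have hu : dv 1 (u n).
    by rewrite -(subrK a (u n)) dvD //; apply: dv_trans IH1; exact: dv_pin.
  set dl := - (h.[u n] / d).
  have hdl : dv (pi ^+ (e + M + n).+1) dl.
    rewrite dvN; apply: (dv_div hd); apply: dv_trans IH2.
    by rewrite dv_pi2; lia.
  have hdl' : dv (pi ^+ (e + M).+1) dl.
    by apply: dv_trans hdl; rewrite dv_pi2; lia.
  have uS : u n.+1 = u n + dl by [].
  have hu' : dv 1 (u n.+1) by rewrite uS dvD //; apply: dv_trans hdl'; exact: dv_pin.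
  split; first by rewrite uS addrAC dvD.
  have [r hr e1] := ipoly_taylor hh hu' hu.
  rewrite (_ : u n.+1 - u n = dl) in e1; last by rewrite uS; ring.
  have d0 : d != 0 by apply: contraTN hd => /eqP->; rewrite dv0l pin0.
  (* The linear part is the old value times (d - h'(u n)) / d, which is small because u n stays near
     a; the rest is quadratic in the correction. *)
  have -> : h.[u n.+1] = h.[u n] * (d - h^`().[u n]) / d + dl * dl * r.
    rewrite -(subrK h.[u n] h.[u n.+1]) e1 /dl; field; exact: d0.
  apply: dvD; last first.
    apply: dv_mulr => //; apply: (@dv_trans _ (pi ^+ (e + M + n).+1 * pi ^+ (e + M + n).+1)).
      by rewrite -exprD dv_pi2; clear; lia.
    exact: dvM.
  apply: (dv_div hd).
  apply: (@dv_trans _ (pi ^+ (e + e + M + n).+1 * pi ^+ (e + M).+1)).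
    by rewrite -exprD dv_pi2; clear; lia.
  apply: dvM => //; rewrite dvBC; apply: dv_trans IH1 _.
  by apply: ipoly_lip => //; apply: ipoly_deriv.
have [n|r hr] := @lf_complete F u.
  rewrite (_ : u n.+1 - u n = - (h.[u n] / d)); last by rewrite /u /= /f; ring.
  change (dv (pi ^+ n) (- (h.[u n] / d))).
  rewrite dvN; apply: (dv_div hd); apply: dv_trans (inv n).2.
  by rewrite dv_pi2; lia.
have ra : dv (pi ^+ (e + M).+1) (r - a).
  rewrite (_ : r - a = (u (e + M).+1 - a) - (u (e + M).+1 - r)); last by ring.
  by apply: dvB (inv _).1 (hr _).
have r1 : dv 1 r by rewrite -(subrK a r) dvD //; apply: dv_trans ra; exact: dv_pin.
exists r => //; apply: dv_all0 => n.
have hu : dv 1 (u n).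
  by rewrite -(subrK a (u n)) dvD //; apply: dv_trans (inv n).1; exact: dv_pin.
rewrite -(subrK h.[u n] h.[r]); apply: dvD.
  by apply: dv_trans (ipoly_lip hh r1 hu); rewrite dvBC; exact: hr.
by apply: dv_trans (inv n).2; rewrite dv_pi2; lia.
Qed.

Lemma hensel_unique h x y e : ipoly h -> dv 1 x -> dv 1 y ->
  dv h^`().[y] (pi ^+ e) -> dv (pi ^+ e.+1) (x - y) -> h.[x] = h.[y] -> x = y.
Proof.
move=> hh hx hy hd hxy exy; have [r hr] := ipoly_taylor hh hx hy.
rewrite exy subrr => /esym/eqP; rewrite mulf_eq0 subr_eq0 => /orP[/eqP//|/eqP h0].
have := dv_near hd (dv_mulr hxy hr).
by rewrite h0 dv0l (negPf (pin0 _ _)).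
Qed.

(** One Newton step started at c gives the leading term of r - c. In this way that leading term
    becomes semialgebraic before r itself is known to be. *)
Lemma hensel_approx h r c e B : ipoly h -> dv 1 r -> dv 1 c -> h.[r] = 0 ->
  dv h^`().[r] (pi ^+ e) -> dv (pi ^+ (B.+1 + e)) (r - c) ->
  rve B.+1 (r - c) (- (h.[c] / h^`().[c])).
Proof.
move=> hh h1 hc hr hd hrc.
have hdc : dv h^`().[c] (pi ^+ e).
  rewrite -(subrK h^`().[r] h^`().[c]) addrC; apply: dv_near hd _.
  apply: (@dv_trans _ (c - r)); last by apply: ipoly_lip => //; apply: ipoly_deriv.
  by rewrite dvBC; apply: dv_trans hrc; rewrite dv_pi2; lia.
have d0 : h^`().[c] != 0 by apply: contraTN hdc => /eqP->; rewrite dv0l pin0.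
have [s hs] := ipoly_taylor hh h1 hc; rewrite hr sub0r => e1.
have -> : - (h.[c] / h^`().[c]) = (r - c) * (1 + (r - c) * s / h^`().[c]).
  by rewrite -mulNr e1; field.
rewrite /rve (_ : r - c - (r - c) * _ = - ((r - c) * ((r - c) * s / h^`().[c])));
  last by ring.
rewrite dvN [pi ^+ _ * _]mulrC dvM ?dv_refl //.
by apply: (dv_div hdc); apply: dv_mulr.
Qed.

Lemma nat_val n : (0 < n)%N -> exists v : nat, w (n%:R : F) = v%:Z.
Proof.
move=> n0; have := dv1n F n; rewrite dv_w ?oner_neq0 ?char0 // w1 => h.
by exists `|w (n%:R : F)|%N; rewrite gez0_abs.
Qed.

Lemma unit1 N t : dv (pi ^+ N.+1) (t - 1) -> [/\ dv 1 t, t != 0 & w t = 0].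
Proof.
move=> ht; have r : rve N.+1 1 t by rewrite rve_unit ?w1 ?oner_neq0 // dvBC.
have [t0 e] := rve_w (ltn0Sn N) r (oner_neq0 _).
by rewrite dv_w ?oner_neq0 // -e lexx t0 w1.
Qed.

(** Hensel's lemma at 1, where X^n - b has derivative n. Together with [pow1] and [pow1_inj] it
    makes t -> t^n a bijection from 1 + pi^M O onto 1 + pi^(M+v) O, as soon as M exceeds v =
    v(n). *)
Lemma root1 n v M b : (0 < n)%N -> w (n%:R : F) = v%:Z -> (v < M)%N ->
  dv (pi ^+ (M + v)) (b - 1) -> exists2 t, t ^+ n = b & dv (pi ^+ M) (t - 1).
Proof.
move=> n0 wn vM hb.
have hb' : dv 1 b.
  rewrite -(subrK 1 b); apply: dvD (dv_refl _); apply: dv_trans hb; exact: dv_pin.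
have hd : ('X^n - b%:P)^`() = n%:R *: 'X^(n.-1) :> {poly F}.
  by rewrite derivB derivC subr0 derivXn scaler_nat.
(* With this margin the value has to be divisible by exactly [pi ^+ (M + v)], and the root is found
   at distance [pi ^+ M]. *)
have [||||r h1 h2] := @hensel ('X^n - b%:P) 1 v (M - v.+1).
- apply: ipolyD; last by rewrite -polyCN; apply: ipolyC; rewrite dvN.
  elim: (n) => [|k IH]; first by rewrite expr0; apply/ipolyC/dv_refl.
  by rewrite exprS; apply: ipolyM => //; apply: ipolyX.
- exact: dv_refl.
- by rewrite hd !hornerE expr1n mulr1 dv_w ?pin0 ?char0 // w_pin wn.
- rewrite !hornerE expr1n dvBC; apply: dv_trans hb; rewrite dv_pi2; lia.
exists r; first by move: h1; rewrite !hornerE => /eqP; rewrite subr_eq0 => /eqP.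
by move: h2; rewrite (_ : (v + (M - v.+1)).+1 = M) //; lia.
Qed.

Lemma pow1 n v M t : (0 < n)%N -> w (n%:R : F) = v%:Z -> (v < M)%N ->
  dv (pi ^+ M) (t - 1) -> dv (pi ^+ (M + v)) (t ^+ n - 1).
Proof.
move=> n0 wn vM ht.
have t1 : dv 1 t.
  rewrite -(subrK 1 t); apply: dvD (dv_refl _); apply: dv_trans ht; exact: dv_pin.
have iX : ipoly 'X^n.
  elim: (n) => [|k IH]; first by rewrite expr0; apply/ipolyC/dv_refl.
  by rewrite exprS; apply: ipolyM => //; apply: ipolyX.
have [r hr] := ipoly_taylor iX t1 (dv_refl 1).
rewrite derivXn !hornerE hornerMn !hornerE !expr1n => ->.
rewrite exprD; apply: dvM => //; apply: dvD.
  by rewrite dv_w ?pin0 ?char0 // w_pin wn.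
by apply: dv_mulr => //; apply: dv_trans ht; rewrite dv_pi2; lia.
Qed.

Lemma pow1_inj n v M t s : (0 < n)%N -> w (n%:R : F) = v%:Z -> (v < M)%N ->
  dv (pi ^+ M) (t - 1) -> dv (pi ^+ M) (s - 1) -> t ^+ n = s ^+ n -> t = s.
Proof.
move=> n0 wn vM ht hs e.
have M0 : M = M.-1.+1 by lia.
rewrite M0 in ht hs; have [t1 _ _] := unit1 ht; have [s1 s0 ws] := unit1 hs.
rewrite -M0 in ht hs.
have iX : ipoly 'X^n.
  elim: (n) => [|k IH]; first by rewrite expr0; apply/ipolyC/dv_refl.
  by rewrite exprS; apply: ipolyM => //; apply: ipolyX.
apply: (@hensel_unique 'X^n t s v) => //; last by rewrite !hornerXn.
  rewrite derivXn hornerMn hornerXn -mulr_natr.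
  rewrite dv_w ?pin0 ?mulf_neq0 ?expf_neq0 ?char0 // wM ?expf_neq0 ?char0 //.
  by rewrite (wX _ s0) ws wn w_pin mul0r add0r.
rewrite (_ : t - s = (t - 1) - (s - 1)); last by ring.
by apply: dvB; [apply: dv_trans ht | apply: dv_trans hs]; rewrite dv_pi2.
Qed.

(** The group of n-th powers is open: y / x is a power of pi with exponent divisible by N, times a
    unit near 1, and both factors are n-th powers. *)
Lemma powers_cls n : (0 < n)%N -> exists N, [/\ (0 < N)%N, (n %| N)%N &
  forall x y, cls N x y -> powers n x -> powers n y].
Proof.
move=> n0; have [v wn] := nat_val n0.
(* Divisibility by n serves the power of pi; precision v + v + 1 is what [root1] asks for at M = v +
   1. *)
exists (n * (v + v).+1)%N; split; [lia | exact: dvdn_mulr |].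
move=> x y /and4P[x0 y0 h1 h2] [_ [z zE]]; split=> //.
have a0 : ac x != 0 by rewrite ac_neq0.
have [|t tE _] := @root1 n v (v.+1) (ac y / ac x) n0 wn (ltnSn _).
  rewrite (_ : _ - 1 = (ac y - ac x) / ac x); last by field.
  apply: dv_mulr; last by rewrite dv_w ?oner_neq0 ?invr_eq0 // wV // w_ac // w1.
  by rewrite dvBC; apply: dv_trans h2; rewrite dv_pi2; nia.
have /dvdzP[q qE] := h1.
exists (z * t * pi ^ (- q * (v + v).+1%:Z)).
rewrite !exprMn zE tE exprnP.
rewrite [RHS]acE {1}(acE x).
have -> : w y = w x + (- q * (v + v).+1%:Z * n%:Z) by move: qE; lia.
rewrite (expfzDr (w x)) ?pi_neq0 // exprz_exp.
have e (P Q X Y : F) : X != 0 -> X * P * (Y / X) * Q = Y * (P * Q).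
  by move=> X0; field.
exact: e.
Qed.

(** By pigeonhole two of the first [size rs + 1] powers of u agree modulo pi^N, so some positive
    exponent at most [size rs] kills u; the factorial is a multiple of all such exponents. *)
Lemma unit_pow N : (0 < N)%N -> exists2 m, (0 < m)%N &
  forall u, u != 0 -> w u = 0 -> dv (pi ^+ N) (u ^+ m - 1).
Proof.
move=> N0; have [rs hrs] := int_finite F N.
exists (size rs)`!; first exact: fact_gt0.
move=> u u0 wu.
have hu i : dv 1 (u ^+ i) by rewrite dv_w ?oner_neq0 ?expf_neq0 // wX // w1 wu mul0r.
have /choice [f hf] : forall i : nat, exists r, r \in rs /\ dv (pi ^+ N) (u ^+ i - r).
  by move=> i; have [r ? ?] := hrs _ (hu i); exists r.
have /uniqPn : ~~ uniq [seq f i | i <- iota 0 (size rs).+1].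
  apply/negP=> /uniq_leq_size-/(_ rs); rewrite size_map size_iota.
  by rewrite ltnn => h; suff: false by []; apply: h => x /mapP[i _ ->]; case: (hf i).
move=> /(_ 0)[i [j [ij]]]; rewrite size_map size_iota => jn.
rewrite !(nth_map 0%N) ?size_iota ?(ltn_trans ij) // !nth_iota ?(ltn_trans ij) // !add0n.
move=> fij.
have h1 : dv (pi ^+ N) (u ^+ (j - i) - 1).
  have ui0 : u ^+ i != 0 by rewrite expf_neq0.
  rewrite -(dvM2l _ _ ui0) mulrBr mulr1 -exprD subnKC ?(ltnW ij) //.
  rewrite (_ : u ^+ j - _ = (u ^+ j - f j) - (u ^+ i - f i)); last by rewrite fij; ring.
  apply: (@dv_trans _ (pi ^+ N)); last by apply: dvB; case: (hf i); case: (hf j).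
  by rewrite dv_w ?mulf_neq0 ?pin0 // wM ?pin0 // wX // wu mul0r add0r.
have /dvdnP[q ->] : (j - i %| (size rs)`!)%N by apply: dvdn_fact; lia.
rewrite mulnC exprM; set z := u ^+ (j - i) in h1 *.
have z1 : dv 1 z by exact: hu.
by have := subrX1 z q => ->; apply: dv_mulr => //; apply: dv_sum => k _; rewrite -(expr1n _ k) dvX.
Qed.

End Hensel.

(** * Semialgebraic sets and functions *)

Section Environments.
Variable T : Type.
Implicit Types (e : nat -> T).

Definition scons (t : T) e : nat -> T := fun i => if i is j.+1 then e j else t.
Definition tl e : nat -> T := fun i => e i.+1.
Definition ev e : nat -> T := fun i => e i.*2.
Definition od e : nat -> T := fun i => e i.*2.+1.
Definition mix e e' : nat -> T := fun i => if odd i then e' i./2 else e i./2.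

Lemma ev_mix e e' : ev (mix e e') = e.
Proof. by apply: funext => i; rewrite /ev /mix odd_double doubleK. Qed.

Lemma od_mix e e' : od (mix e e') = e'.
Proof. by apply: funext => i; rewrite /od /mix /= odd_double /= uphalf_double. Qed.

Lemma tl_scons t e : tl (scons t e) = e. Proof. by apply: funext. Qed.

Lemma scons_tl e : scons (e 0) (tl e) = e.
Proof. by apply: funext => -[]. Qed.

Lemma scons0 t e : scons t e 0 = t. Proof. by []. Qed.

End Environments.

Section Semialg.
Variable F : lfield.
Notation E := (nat -> F).
Implicit Types (e : E) (S D : E -> Prop) (p q g h : E -> F).

(** Polynomial functions on environments. An environment supplies infinitely many variables, so
    formulas carry no arity, and [scons] and [tl] bind and drop variable 0 as with de Bruijn
    indices. *)
Inductive pf : (E -> F) -> Prop :=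
| pf_const a : pf (fun _ => a)
| pf_var i : pf (fun e => e i)
| pf_add p q : pf p -> pf q -> pf (fun e => p e + q e)
| pf_mul p q : pf p -> pf q -> pf (fun e => p e * q e).

Definition pmap (phi : E -> E) := forall i, pf (fun e => phi e i).

Lemma pf_comp p phi : pf p -> pmap phi -> pf (fun e => p (phi e)).
Proof. by move=> hp hphi; elim: hp => *; [exact: pf_const | exact: hphi | exact: pf_add | exact: pf_mul]. Qed.

Inductive sa : (E -> Prop) -> Prop :=
| sa_powers n p : (0 < n)%N -> pf p -> sa (fun e => powers n (p e))
| sa_or S S' : sa S -> sa S' -> sa (fun e => S e \/ S' e)
| sa_and S S' : sa S -> sa S' -> sa (fun e => S e /\ S' e)
| sa_not S : sa S -> sa (fun e => ~ S e).

Lemma sa_ext S S' : sa S -> (forall e, S e <-> S' e) -> sa S'.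
Proof. by move=> h e; rewrite (_ : S' = S) //; apply: funext => x; apply: propext; rewrite e. Qed.

Lemma sa_comp S phi : sa S -> pmap phi -> sa (fun e => S (phi e)).
Proof.
move=> hS hphi; elim: hS => [n p n0 hp|A B _ ? _ ?|A B _ ? _ ?|A _ ?];
  [|exact: sa_or|exact: sa_and|exact: sa_not].
by apply: sa_powers => //; exact: pf_comp.
Qed.

Lemma powers1 (x : F) : powers 1 x <-> x != 0.
Proof. by split=> [[]//|x0]; split=> //; exists x; rewrite expr1. Qed.

Lemma sa_const (P : Prop) : sa (fun _ => P).
Proof.
have h : sa (fun e : E => powers 1 (1 : F)) by apply: sa_powers => //; exact: pf_const.
have [p|np] := pselect P.
  by apply: sa_ext h _ => e; rewrite powers1 oner_neq0.
by apply: sa_ext (sa_not h) _ => e; rewrite powers1 oner_neq0; split=> [[]|/np].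
Qed.

Lemma sa_imp S S' : sa S -> sa S' -> sa (fun e => S e -> S' e).
Proof.
move=> h h'; apply: sa_ext (sa_or (sa_not h) h') _ => e.
split=> [[]//|]; have [?|?] := pselect (S e); tauto.
Qed.

Lemma sa_bigor (I : eqType) (r : seq I) (P : I -> E -> Prop) :
  (forall i, i \in r -> sa (P i)) -> sa (fun e => exists2 i, i \in r & P i e).
Proof.
elim: r => [|a r IH] h; first by apply: sa_ext (sa_const False) _ => e; split=> // -[].
apply: sa_ext (sa_or (h a _) (IH _)) _ => [|i ir|e]; rewrite ?inE ?eqxx //.
  by apply: h; rewrite inE ir orbT.
split=> [[he|[i ir he]]|[i]].
- by exists a; rewrite ?inE ?eqxx.
- by exists i; rewrite ?inE ?ir ?orbT.
- by rewrite inE => /orP[/eqP-> he|ir he]; [left|right; exists i].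
Qed.

Lemma sa_bigand (I : eqType) (r : seq I) (P : I -> E -> Prop) :
  (forall i, i \in r -> sa (P i)) -> sa (fun e => forall i, i \in r -> P i e).
Proof.
move=> h; apply: sa_ext (sa_not (@sa_bigor _ r (fun i e => ~ P i e) _)) _.
  by move=> i ir; apply/sa_not/h.
move=> e; split=> [he i ir|he [i ir]]; last by apply; exact: he.
by apply: contrapT => hn; apply: he; exists i.
Qed.

Lemma sa_bounded_all (n : nat) (P : nat -> E -> Prop) :
  (forall i, (i < n)%N -> sa (P i)) -> sa (fun e => forall i, (i < n)%N -> P i e).
Proof.
move=> h; apply: sa_ext (@sa_bigand _ (iota 0 n) P _) _ => [i|e].
  by rewrite mem_iota; exact: h.
by split=> he i hi; apply: he; rewrite mem_iota in hi *.
Qed.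

Lemma pmap_id : pmap id. Proof. by move=> i; exact: pf_var. Qed.
Lemma pmap_tl phi : pmap phi -> pmap (fun e => tl (phi e)).
Proof. by move=> h i; exact: h. Qed.
Lemma pmap_ev phi : pmap phi -> pmap (fun e => ev (phi e)).
Proof. by move=> h i; exact: h. Qed.
Lemma pmap_od phi : pmap phi -> pmap (fun e => od (phi e)).
Proof. by move=> h i; exact: h. Qed.
Lemma pmap_scons p phi : pf p -> pmap phi -> pmap (fun e => scons (p e) (phi e)).
Proof. by move=> hp h [|i] //=; exact: h. Qed.
Lemma pmap_mix phi psi : pmap phi -> pmap psi -> pmap (fun e => mix (phi e) (psi e)).
Proof. by move=> h h' i; rewrite /mix; case: odd; [exact: h'|exact: h]. Qed.
Lemma pmap_comp phi psi : pmap phi -> pmap psi -> pmap (fun e => phi (psi e)).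
Proof. by move=> h h' i; apply: (pf_comp (h i)). Qed.
Lemma pf_at phi i : pmap phi -> pf (fun e => phi e i).
Proof. exact. Qed.

End Semialg.

Ltac pmaps := intros; cbv beta; lazymatch goal with
  | |- pmap id => exact (@pmap_id _)
  | |- pmap (fun e => e) => exact (@pmap_id _)
  | |- pmap (fun e => scons (@?p e) (@?f e)) => refine (@pmap_scons _ p f _ _); pmaps
  | |- pmap (fun e => mix (@?p e) (@?f e)) => refine (@pmap_mix _ p f _ _); pmaps
  | |- pmap (fun e => tl (@?f e)) => refine (@pmap_tl _ f _); pmaps
  | |- pmap (fun e => ev (@?f e)) => refine (@pmap_ev _ f _); pmaps
  | |- pmap (fun e => od (@?f e)) => refine (@pmap_od _ f _); pmaps
  | |- pmap (@tl _) => refine (@pmap_tl _ id _); pmaps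
  | |- pmap (@ev _) => refine (@pmap_ev _ id _); pmaps
  | |- pmap (@od _) => refine (@pmap_od _ id _); pmaps
  | h : pmap ?f |- pmap ?f => exact h
  | h : pmap ?f |- pmap (fun e => ?f (@?g e)) => refine (@pmap_comp _ f g h _); pmaps
  | |- pf (fun e => e ?i) => exact (@pf_var _ i)
  | |- pf (fun e => od (@?f e) ?i) => refine (@pf_at _ (fun e => od (f e)) i _); pmaps
  | |- pf (fun e => ev (@?f e) ?i) => refine (@pf_at _ (fun e => ev (f e)) i _); pmaps
  | |- pf (fun e => tl (@?f e) ?i) => refine (@pf_at _ (fun e => tl (f e)) i _); pmaps
  | |- pf (fun e => _) => first [ assumption | exact (pf_const _) | match goal with |- pf (fun e => (@?f e) ?i) => refine (@pf_at _ f i _); pmaps end ]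
  | |- _ => idtac end.

Section SemialgFunctions.
Variable F : lfield.
Notation E := (nat -> F).
Implicit Types (e : E) (S D : E -> Prop) (p q g h : E -> F).

(* Substituting [g] for a variable preserves semialgebraicity, with parameters:
   the odd-indexed variables. *)
Definition sf g := forall S, sa S -> sa (fun e => S (scons (g (ev e)) (od e))).

Lemma sf_subst g S phi psi : sf g -> sa S -> pmap phi -> pmap psi ->
  sa (fun e => S (scons (g (phi e)) (psi e))).
Proof.
move=> hg hS hphi hpsi; apply: sa_ext (sa_comp (hg _ hS) (pmap_mix hphi hpsi)) _.
by move=> e; rewrite ev_mix od_mix.
Qed.

Lemma sf_comp g phi : sf g -> pmap phi -> sf (fun e => g (phi e)).
Proof.
move=> hg hphi S hS.
have h1 : pmap (fun e => phi (ev e)) by apply: (pmap_comp hphi); pmaps.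
have h2 : pmap (@od F) by pmaps.
exact: (sf_subst hg hS h1 h2).
Qed.

Lemma sf_pf p : pf p -> sf p.
Proof.
move=> hp S hS; apply: sa_comp hS _; apply: pmap_scons; last by pmaps.
by apply: pf_comp hp _; pmaps.
Qed.

Lemma sf_const a : sf (fun _ => a). Proof. exact/sf_pf/pf_const. Qed.
Lemma sf_var i : sf (fun e => e i). Proof. exact/sf_pf/pf_var. Qed.

Lemma sf_subst2 g h S phi psi chi : sf g -> sf h -> sa S -> pmap phi -> pmap psi -> pmap chi ->
  sa (fun e => S (scons (g (phi e)) (scons (h (psi e)) (chi e)))).
Proof.
move=> hg hh hS hphi hpsi hchi.
pose S2 e := S (scons (g (phi (tl e))) (scons (e 0) (chi (tl e)))).
have h1 : pmap (fun e => phi (tl e)) by pmaps.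
have h2 : pmap (fun e => scons (e 0) (chi (tl e))) by pmaps.
have hS2 : sa S2 := sf_subst hg hS h1 h2.
exact: (@sf_subst h S2 psi (fun e => e) hh hS2 hpsi (@pmap_id F)).
Qed.

Lemma sf_op2 (q : E -> F) g h : (forall S, sa S -> sa (fun e => S (scons (q e) (tl (tl e))))) ->
  (forall e e', e 0 = e' 0 -> e 1%N = e' 1%N -> q e = q e') ->
  sf g -> sf h -> sf (fun e => q (scons (g e) (scons (h e) e))).
Proof.
move=> hq qE hg hh S hS.
have h1 : pmap (@ev F) by pmaps.
have h2 : pmap (@od F) by pmaps.
apply: sa_ext (sf_subst2 hg hh (hq S hS) h1 h1 h2) _.
by move=> e; rewrite /= !tl_scons; rewrite (qE _ (scons (g (ev e)) (scons (h (ev e)) (ev e)))).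
Qed.

Lemma sfD g h : sf g -> sf h -> sf (fun e => g e + h e).
Proof.
apply: (@sf_op2 (fun e => e 0 + e 1%N)) => [S hS|e e' -> -> //].
apply: sa_comp hS _; apply: pmap_scons; last by pmaps.
by apply: pf_add; exact: pf_var.
Qed.

Lemma sfM g h : sf g -> sf h -> sf (fun e => g e * h e).
Proof.
apply: (@sf_op2 (fun e => e 0 * e 1%N)) => [S hS|e e' -> -> //].
apply: sa_comp hS _; apply: pmap_scons; last by pmaps.
by apply: pf_mul; exact: pf_var.
Qed.

Lemma sfN g : sf g -> sf (fun e => - g e).
Proof.
move=> hg; have := sfM (sf_const (-1)) hg.
by congr sf; apply: funext => e; rewrite mulN1r.
Qed.

Lemma sfB g h : sf g -> sf h -> sf (fun e => g e - h e).
Proof. by move=> hg hh; apply: sfD => //; apply: sfN. Qed.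

Lemma sfX g n : sf g -> sf (fun e => g e ^+ n).
Proof.
move=> hg; elim: n => [|n IH]; first exact: (sf_const 1).
have := sfM hg IH; congr sf; by apply: funext => e; rewrite exprS.
Qed.

Lemma sf_sum (I : Type) (r : seq I) (P : pred I) (f : I -> E -> F) :
  (forall i, sf (f i)) -> sf (fun e => \sum_(i <- r | P i) f i e).
Proof.
move=> h; elim: r => [|a r IH].
  by have := sf_const 0; congr sf; apply: funext => e; rewrite big_nil.
case Pa : (P a).
  by have := sfD (h a) IH; congr sf; apply: funext => e; rewrite big_cons Pa.
by move: IH; congr sf; apply: funext => e; rewrite big_cons Pa.
Qed.

Lemma sf_if D g h : sa D -> sf g -> sf h -> sf (fun e => if pselect (D e) then g e else h e).
Proof.
move=> hD hg hh S hS.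
have hD' : sa (fun e => D (ev e)) by apply: sa_comp hD _; pmaps.
apply: sa_ext (sa_or (sa_and hD' (hg S hS)) (sa_and (sa_not hD') (hh S hS))) _ => e.
by case: pselect => d /=; tauto.
Qed.

Lemma sa_sf S g : sa S -> sf g -> sa (fun e => S (scons (g e) e)).
Proof. by move=> hS hg; exact: (@sf_subst g S (fun e => e) (fun e => e) hg hS (@pmap_id F) (@pmap_id F)). Qed.

Lemma sa_powers_sf n g : (0 < n)%N -> sf g -> sa (fun e => powers n (g e)).
Proof. by move=> n0 hg; apply: (sa_sf (sa_powers n0 (@pf_var F 0)) hg). Qed.

Lemma sa_neq0 g : sf g -> sa (fun e => g e != 0).
Proof. by move=> hg; apply: sa_ext (@sa_powers_sf 1 g isT hg) _ => e; rewrite powers1. Qed.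

Lemma sa_eq0 g : sf g -> sa (fun e => g e = 0).
Proof.
move=> hg; apply: sa_ext (sa_not (sa_neq0 hg)) _ => e.
by split=> [/negP|->]; rewrite ?negbK ?eqxx // => /eqP.
Qed.

Lemma sa_eq g h : sf g -> sf h -> sa (fun e => g e = h e).
Proof.
move=> hg hh; apply: sa_ext (sa_eq0 (sfB hg hh)) _ => e.
by split=> [/eqP|->]; rewrite ?subrr // subr_eq0 => /eqP.
Qed.

Definition fam (G : E -> {poly F}) := forall i, sf (fun e => (G e)`_i).

Lemma fam_D G H : fam G -> fam H -> fam (fun e => G e + H e).
Proof.
move=> hG hH i; have := sfD (hG i) (hH i).
by congr sf; apply: funext => e; rewrite coefD.
Qed.

Lemma fam_M G H : fam G -> fam H -> fam (fun e => G e * H e).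
Proof.
move=> hG hH i.
have := @sf_sum _ (index_enum 'I_i.+1) predT
  (fun (j : 'I_i.+1) e => (G e)`_j * (H e)`_(i - j)) (fun j => sfM (hG _) (hH _)).
by congr sf; apply: funext => e; rewrite coefM.
Qed.

Lemma fam_C g : sf g -> fam (fun e => (g e)%:P).
Proof.
move=> hg [|i]; first by move: hg; congr sf; apply: funext => e; rewrite coefC.
by have := sf_const 0; congr sf; apply: funext => e; rewrite coefC.
Qed.

Lemma fam_const (q : {poly F}) : fam (fun _ => q).
Proof. by move=> i; exact: sf_const. Qed.

Lemma fam_X G n : fam G -> fam (fun e => G e ^+ n).
Proof.
move=> hG; elim: n => [|n IH]; first exact: fam_const.
by have := fam_M hG IH; congr fam; apply: funext => e; rewrite exprS.
Qed.

Lemma fam_sum n (G : nat -> E -> {poly F}) :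
  (forall i, fam (G i)) -> fam (fun e => \sum_(i < n) G i e).
Proof.
move=> hG; elim: n => [|n IH].
  by have := fam_const 0; congr fam; apply: funext => e; rewrite big_ord0.
by have := fam_D IH (hG n); congr fam; apply: funext => e; rewrite big_ord_recr.
Qed.

Lemma fam_comp G phi : fam G -> pmap phi -> fam (fun e => G (phi e)).
Proof. by move=> hG hphi i; apply: (sf_comp (hG i)). Qed.

Lemma fam_deriv G : fam G -> fam (fun e => (G e)^`()).
Proof.
move=> hG i; have := sfM (sf_const i.+1%:R) (hG i.+1).
by congr sf; apply: funext => e; rewrite coef_deriv mulr_natl.
Qed.

Lemma comp_poly_wide (p q : {poly F}) n : (size p <= n)%N ->
  p \Po q = \sum_(i < n) p`_i *: q ^+ i.
Proof.
move=> pn; rewrite comp_polyE (big_ord_widen _ (fun i => p`_i *: q ^+ i) pn) big_mkcond /=.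
by apply: eq_bigr => i _; case: ltnP => // h; rewrite nth_default // scale0r.
Qed.

Lemma fam_shift G d g : fam G -> (forall e, (size (G e) <= d)%N) -> sf g ->
  fam (fun e => shift (G e) (g e)).
Proof.
move=> hG hd hg.
have -> : (fun e => shift (G e) (g e)) =
    (fun e => \sum_(i < d) (((G e)`_i)%:P * ('X + (g e)%:P) ^+ i)).
  apply: funext => e; rewrite /shift (comp_poly_wide _ (hd e)).
  by apply: eq_bigr => i _; rewrite mul_polyC.
apply: (@fam_sum d (fun i e => ((G e)`_i)%:P * ('X + (g e)%:P) ^+ i)) => i.
apply: fam_M; first exact/fam_C/hG.
by apply/fam_X/fam_D; [exact: fam_const | exact: fam_C].
Qed.

Lemma sf_horner G d g : fam G -> (forall e, (size (G e) <= d)%N) -> sf g ->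
  sf (fun e => (G e).[g e]).
Proof.
move=> hG hd hg; have := fam_shift hG hd hg 0%N.
by congr sf; apply: funext => e; rewrite shift0.
Qed.

Lemma pf_fam p : pf p -> exists d G,
  [/\ fam G, forall e, (size (G e) <= d)%N & forall e t, p (scons t e) = (G e).[t]].
Proof.
elim=> [a|i|p1 q1 _ [d1 [G1 [f1 s1 h1]]] _ [d2 [G2 [f2 s2 h2]]]
  |p1 q1 _ [d1 [G1 [f1 s1 h1]]] _ [d2 [G2 [f2 s2 h2]]]].
- exists 1%N, (fun _ => a%:P); split=> [|e|e t]; first exact: fam_const.
    exact: size_polyC_leq1.
  by rewrite hornerC.
- case: i => [|i].
    exists 2%N, (fun _ => 'X); split=> [|e|e t]; first exact: fam_const.
      by rewrite size_polyX.
    by rewrite hornerX.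
  exists 1%N, (fun e => (e i)%:P); split=> [|e|e t]; first exact/fam_C/sf_var.
    exact: size_polyC_leq1.
  by rewrite hornerC.
- exists (maxn d1 d2), (fun e => G1 e + G2 e); split=> [|e|e t]; first exact: fam_D.
    by rewrite (leq_trans (size_polyD _ _)) // geq_max !leq_max s1 s2 orbT.
  by rewrite hornerD h1 h2.
- exists (d1 + d2)%N, (fun e => G1 e * G2 e); split=> [|e|e t]; first exact: fam_M.
    rewrite (leq_trans (size_polyMleq _ _)) //; have := s1 e; have := s2 e; lia.
  by rewrite hornerM h1 h2.
Qed.

(* Reduces testing P_n on p(1/t) to the reciprocal polynomial of p. *)
Lemma powersMX n (x y : F) : y != 0 -> powers n (x * y ^+ n) <-> powers n x.
Proof.
move=> y0; split=> -[x0 [z zE]].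
  split; first by move: x0; rewrite mulf_eq0 negb_or => /andP[].
  exists (z / y); rewrite expr_div_n zE mulfK // expf_neq0 //.
split; first by rewrite mulf_neq0 // expf_neq0.
by exists (z * y); rewrite exprMn zE.
Qed.

Lemma horner_rev (p : {poly F}) d t : t != 0 -> (size p <= d)%N ->
  p.[t^-1] * t ^+ d = \sum_(i < d) p`_i * t ^+ (d - i).
Proof.
move=> t0 pd; rewrite (horner_coef_wide _ pd) mulr_suml; apply: eq_bigr => i _.
rewrite -mulrA; congr (_ * _); rewrite exprVn.
have hi : (i <= d)%N by rewrite ltnW.
by rewrite -{2}(subnKC hi) exprD mulKf // expf_neq0.
Qed.

(** Only the substitution of 1/t for one variable has to be treated. There p(1/t) is multiplied by
    (t^d)^n, an n-th power, which clears denominators without affecting membership in P_n; t = 0 is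
    separate, its inverse being 0 by convention. *)
Lemma sfV g : sf g -> sf (fun e => (g e)^-1).
Proof.
move=> hg.
suff h0 : forall S, sa S -> sa (fun e => S (scons (e 0)^-1 (tl e))).
  move=> S hS; have h1 : pmap (@ev F) by pmaps.
  have h2 : pmap (@od F) by pmaps.
  by apply: sa_ext (sf_subst hg (h0 S hS) h1 h2) _.
move=> S; elim=> [n p n0 hp|||]; [|by move=> *; exact: sa_or|by move=> *; exact: sa_and
  |by move=> *; exact: sa_not].
have [d [G [fG sG hG]]] := pf_fam hp.
have fG' : fam (fun e => G (tl e)) by apply: fam_comp => //; pmaps.
have s1 : sf (fun e : E => \sum_(i < d) (G (tl e))`_i * e 0 ^+ (d - i)).
  apply: (@sf_sum _ _ predT (fun (i : 'I_d) e => (G (tl e))`_i * e 0 ^+ (d - i))) => i.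
  by apply: sfM => //; apply/sfX/sf_var.
(* The second factor completes t^d to (t^d)^n. *)
have s2 : sf (fun e : E => (\sum_(i < d) (G (tl e))`_i * e 0 ^+ (d - i)) * e 0 ^+ (d * n - d)).
  by apply: sfM => //; apply/sfX/sf_var.
have s3 : sf (fun e : E => (G (tl e)).[0]).
  by apply: (sf_horner (d := d)) => //; exact: sf_const.
apply: sa_ext (sa_or (sa_and (sa_eq0 (sf_var 0)) (sa_powers_sf n0 s3))
   (sa_and (sa_neq0 (sf_var 0)) (sa_powers_sf n0 s2))) _ => e.
rewrite hG; have [e0|e0] := eqVneq (e 0) 0.
  by rewrite e0 invr0; split=> [[[]//|[]//]|h]; left.
rewrite -horner_rev // -mulrA -exprD subnKC ?leq_pmulr // exprM powersMX ?expf_neq0 //.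
by split=> [[[/eqP]|[]//]|h]; [rewrite (negPf e0)|right].
Qed.

Lemma sf_div g h : sf g -> sf h -> sf (fun e => g e / h e).
Proof. by move=> hg hh; apply: sfM => //; apply: sfV. Qed.

End SemialgFunctions.

(** * Definability of classes and of the valuation; monomial sets *)

Section Mono.
Variable F : lfield.
Notation E := (nat -> F).
Implicit Types (e : E) (D : E -> Prop) (g h z : E -> F) (a b r s t x y : F).
Implicit Types (S : E -> F -> Prop) (N M k i j n m : nat).

(** The group of classes of level N has finite exponent: the factor N takes care of the valuation,
    and [unit_pow] of the angular component. *)
Lemma cls_mul_pow N r t y : (0 < N)%N -> exists2 m, (0 < m)%N &
  forall r t y : F, y != 0 -> cls N r t -> cls N r (t * y ^+ m).
Proof.
move=> N0; have [m m0 hm] := unit_pow F N0.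
exists (N * m)%N; first by rewrite muln_gt0 N0.
move=> {}r {}t {}y y0 /and4P[r0 t0 h1 h2].
have yn0 : y ^+ (N * m) != 0 by rewrite expf_neq0.
have a0 : ac y != 0 by rewrite ac_neq0.
rewrite /cls r0 mulf_neq0 //=; apply/andP; split.
  rewrite wM // wX // opprD addrA; apply: rpredB => //.
  by rewrite PoszM mulrCA dvdz_mulr.
rewrite acM // acX // mulnC exprM.
have h3 : dv (pi ^+ N) ((ac y ^+ m) ^+ N - 1).
  by rewrite exprAC; apply: hm; rewrite ?expf_neq0 // wX // w_ac.
rewrite (_ : ac r - _ = (ac r - ac t) - ac t * ((ac y ^+ m) ^+ N - 1)); last by ring.
apply: dvB => //; apply: dv_mull => //.
by have [] := unit_dv _ (w_ac t0); rewrite ?ac_neq0.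
Qed.

(** For m as in [cls_mul_pow], the class of r is a union of cosets of P_m. Finitely many suffice
    because P_m is itself a union of classes of some level N2, and each coset is a basic condition
    on a quotient. *)
Lemma sa_cls N r g : (0 < N)%N -> r != 0 -> sf g -> sa (fun e => cls N r (g e)).
Proof.
move=> N0 r0 hg; have [m m0 hm] := cls_mul_pow 0 0 0 N0.
have [N2 [N20 _ hN2]] := powers_cls F m0.
have [rs [_ rs0 _ hrs]] := finite_cls F N20.
have h := @sa_bigor F _ [seq x <- rs | cls N r x] (fun x e => powers m (g e / x)).
apply: sa_ext (h _) _ => [x _|e].
  by apply: sa_powers_sf => //; apply: sf_div => //; exact: sf_const.
split=> [[x]|hc].
  rewrite mem_filter => /andP[hx xr] [x0 [y yE]].
  have y0 : y != 0.
    by apply: contraNneq x0 => y0; rewrite -yE y0 expr0n; case: (m) m0.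
  have x00 : x != 0 by case: (rs0 _ xr).
  rewrite (_ : g e = x * y ^+ m); first exact: hm.
  by rewrite yE; field.
have g0 : g e != 0 by case/and4P: hc.
have [x xr hx] := hrs _ g0; have [x0 _] := rs0 _ xr.
have p1 : powers m (g e / x).
  apply: (hN2 1); last by split; [exact: oner_neq0 | exists 1; rewrite expr1n].
  by rewrite -(divff x0); apply: clsM => //; apply: cls_refl; rewrite invr_eq0.
exists x => //; rewrite mem_filter xr andbT.
have [h0 [y yE]] := p1.
have y0 : y != 0 by apply: contraNneq h0 => y0; rewrite -yE y0 expr0n; case: (m) m0.
rewrite (_ : x = g e * y^-1 ^+ m); first by apply: hm; rewrite ?invr_eq0.
by rewrite exprVn yE; field; rewrite x0 g0.
Qed.

Lemma sa_clsW N (W : F -> Prop) g : (0 < N)%N ->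
  (forall x y, cls N x y -> W x -> W y) -> sf g -> sa (fun e => W (g e)).
Proof.
move=> N0 hW hg; have [rs [_ rs0 _ hrs]] := finite_cls F N0.
have h := @sa_bigor F _ [seq x <- rs | `[< W x >] ] (fun x e => cls N x (g e)).
apply: sa_ext (sa_or (h _) (sa_and (sa_eq0 hg) (sa_const F (W 0)))) _ => [x|e].
  by rewrite mem_filter => /andP[_ /rs0[x0 _]]; exact: sa_cls.
split=> [[[x]|[-> //]]|We].
  by rewrite mem_filter => /andP[/asboolP Wx _] /hW; apply.
have [g0|g0] := eqVneq (g e) 0; first by right; rewrite g0 in We.
have [x xr hx] := hrs _ g0; left; exists x => //; rewrite mem_filter xr andbT.
by apply/asboolP/(hW (g e)); rewrite // cls_sym.
Qed.

(** Put n = q + 1, a unit. If x is integral, 1 + pi x^n is an n-th power by Hensel's lemma;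
    otherwise its valuation is 1 + n v(x), which n does not divide. *)
Lemma dv1_powers x : dv 1 x <-> powers (@resp F).+1 (1 + pi * x ^+ (@resp F).+1).
Proof.
have wn : w ((@resp F).+1%:R : F) = 0%N by exact: w_respS.
split=> [x1|[h0 [y yE]]].
  have h1 : dv (pi ^+ (1 + 0)) (1 + pi * x ^+ (@resp F).+1 - 1).
    rewrite addrC addKr expr1 dv_mulr ?dv_refl //.
    by rewrite -(expr1n _ (@resp F).+1) dvX.
  have [t tE ht] := root1 (ltn0Sn _) wn (ltnSn 0) h1.
  split; last by exists t.
  have [_ t0 _] := unit1 ht; by rewrite -tE expf_neq0.
have [->|x0] := eqVneq x 0; first exact: dv0.
apply: contraT; rewrite dv_w ?oner_neq0 // w1 -ltNge => wx.
have xn0 : x ^+ (@resp F).+1 != 0 by rewrite expf_neq0.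
have q0 : pi * x ^+ (@resp F).+1 != 0 by rewrite mulf_neq0 ?pi_neq0.
have wq : w (pi * x ^+ (@resp F).+1) = 1 + w x * (@resp F).+1%:Z.
  by rewrite wM ?pi_neq0 // w_pi wX.
have r2 := @resp_gt1 F.
have h2 : dv (pi * (pi * x ^+ (@resp F).+1)) 1.
  rewrite dv_w ?oner_neq0 ?mulf_neq0 ?pi_neq0 // wM ?pi_neq0 // w_pi wq w1.
  nia.
have [_] := wDl q0 h2; rewrite addrC -yE wq.
have y0 : y != 0 by apply: contraNneq h0 => y0; rewrite -yE y0 expr0n.
rewrite wX // => e1.
have e2 : 1 = w y * (@resp F).+1%:Z - w x * (@resp F).+1%:Z :> int by rewrite e1; ring.
have : ((@resp F).+1%:Z %| 1%:Z)%Z by rewrite e2; apply: rpredB; apply: dvdz_mull.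
by rewrite dvdz1 /=; move: r2; case: (@resp F).
Qed.

Lemma sa_dv g h : sf g -> sf h -> sa (fun e => dv (g e) (h e)).
Proof.
move=> hg hh.
have h1 : sf (fun e => 1 + pi * (h e / g e) ^+ (@resp F).+1).
  by apply: (sfD (sf_const _)); apply: (sfM (sf_const _)); apply/sfX/sf_div.
apply: sa_ext (sa_or (sa_eq0 hh) (sa_and (sa_neq0 hg) (sa_powers_sf (ltn0Sn _) h1))) _ => e.
split=> [[->|[g0 /dv1_powers hd]]|hd]; first exact: dv0.
  by rewrite -(divfK g0 (h e)) -[X in dv X _]mul1r dvM ?dv_refl.
have [?|h0] := eqVneq (h e) 0; first by left.
right; have g0 : g e != 0 by apply: contraTneq hd => ->; rewrite dv0l.
by split=> //; apply/dv1_powers; rewrite -(dvM2r _ _ g0) mul1r divfK.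
Qed.

(* [S e s] depends on [s] only through its valuation, compared with semialgebraic
   thresholds, and its class. *)
Inductive mono N : (E -> F -> Prop) -> Prop :=
| mono_D D : sa D -> mono N (fun e _ => D e)
| mono_B z k : sf z -> (0 < k)%N -> mono N (fun e s => dv (z e) (s ^+ k))
| mono_C M r : (M %| N)%N -> r != 0 -> mono N (fun _ s => cls M r s)
| mono_or S S' : mono N S -> mono N S' -> mono N (fun e s => S e s \/ S' e s)
| mono_and S S' : mono N S -> mono N S' -> mono N (fun e s => S e s /\ S' e s)
| mono_not S : mono N S -> mono N (fun e s => ~ S e s).

Lemma mono_ext N S S' : mono N S -> (forall e s, S e s <-> S' e s) -> mono N S'.
Proof.
move=> h eq; rewrite (_ : S' = S) //; apply: funext => e; apply: funext => s.
by apply: propext; rewrite eq.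
Qed.

Lemma mono_lift N N' S : (N %| N')%N -> mono N S -> mono N' S.
Proof.
move=> NN'; elim=> [D|z k|M r MN|A B _ ? _ ?|A B _ ? _ ?|A _ ?];
 [exact: mono_D|exact: mono_B|apply: mono_C|exact: mono_or|exact: mono_and|exact: mono_not].
exact: dvdn_trans NN'.
Qed.

Lemma mono_bigor (I : eqType) (rs : seq I) (P : I -> E -> F -> Prop) N :
  (forall i : I, i \in rs -> mono N (P i)) ->
  mono N (fun e s => exists2 i : I, i \in rs & P i e s).
Proof.
elim: rs => [|a rs IH] h.
  by apply: mono_ext (mono_D _ (sa_const F False)) _ => e s; split=> // -[].
apply: mono_ext (mono_or (h a _) (IH _)) _ => [|i ir|e s]; rewrite ?inE ?eqxx //.
  by apply: h; rewrite inE ir orbT.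
split=> [[he|[i ir he]]|[i]].
- by exists a; rewrite ?inE ?eqxx.
- by exists i; rewrite ?inE ?ir ?orbT.
- by rewrite inE => /orP[/eqP-> he|ir he]; [left|right; exists i].
Qed.

Lemma mono_bigand (I : eqType) (rs : seq I) (P : I -> E -> F -> Prop) N :
  (forall i : I, i \in rs -> mono N (P i)) ->
  mono N (fun e s => forall i : I, i \in rs -> P i e s).
Proof.
move=> h; apply: mono_ext (mono_not (@mono_bigor I rs (fun (i : I) e s => ~ P i e s) N _)) _.
  by move=> i ir; apply/mono_not/h.
move=> e s; split=> [he i ir|he [i ir]]; last by apply; exact: he.
by apply: contrapT => hn; apply: he; exists i.
Qed.

Lemma mono_s0 N : mono N (fun _ s => s = 0).
Proof.
apply: mono_ext (@mono_B N (fun _ => 0) 1 (sf_const 0) isT) _ => e s.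
by rewrite expr1 dv0l; split=> /eqP.
Qed.

Lemma mono_sneq0 N : mono N (fun _ s => s != 0).
Proof.
apply: mono_ext (mono_not (mono_s0 N)) _ => e s.
by split=> /eqP.
Qed.

Lemma mono_B' N z k : sf z -> mono N (fun e s => dv (s ^+ k) (z e)).
Proof.
move=> hz; have [->|k0] := posnP k.
  apply: mono_ext (mono_D _ (sa_dv (sf_const 1) hz)) _ => e s.
  by rewrite expr0.
have h1 : mono N (fun e s => dv (pi * z e) (s ^+ k)).
  by apply: (@mono_B N (fun e => pi * z e)) => //; apply: (sfM (sf_const _)).
apply: mono_ext (mono_or (mono_D _ (sa_eq0 hz)) (mono_and (mono_D _ (sa_neq0 hz)) (mono_not h1))) _ => e s.
split=> [[->|[z0]]|hd]; first exact: dv0.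
  by rewrite sdv // => /negP; rewrite negbK.
have [?|z0] := eqVneq (z e) 0; first by left.
by right; split=> //; rewrite sdv // hd.
Qed.

Lemma mono_dv N g h i j : sf g -> sf h ->
  mono N (fun e s => dv (g e * s ^+ i) (h e * s ^+ j)).
Proof.
move=> hg hh.
have h0 : mono N (fun e s => s = 0 /\ dv (g e * 0 ^+ i) (h e * 0 ^+ j)).
  apply: mono_and (mono_s0 N) (mono_D _ (sa_dv _ _)).
    exact: (sfM hg (sf_const _)).
  exact: (sfM hh (sf_const _)).
have h2 : mono N (fun e s => s != 0 /\ (h e = 0 \/ (g e != 0 /\ if (i <= j)%N then
    dv (g e / h e) (s ^+ (j - i)) else dv (s ^+ (i - j)) (h e / g e)))).
  apply: mono_and (mono_sneq0 N) _; apply: mono_or (mono_D _ (sa_eq0 hh)) _.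
  apply: mono_and (mono_D _ (sa_neq0 hg)) _; case: leqP => ij.
    have [<-|ij'] := eqVneq i j.
      rewrite subnn; apply: mono_ext (mono_D _ (sa_dv (sf_div hg hh) (sf_const 1))) _.
      by move=> e s; rewrite expr0.
    apply: (@mono_B N (fun e => g e / h e)); first exact: sf_div.
    by move: ij ij'; clear; lia.
  exact: (mono_B' _ _ (sf_div hh hg)).
apply: mono_ext (mono_or h0 h2) _ => e s.
have [->|s0] := eqVneq s 0.
  by split=> [[[]|[]]//|]; left.
have [h00|h00] := eqVneq (h e) 0.
  have -> : dv (g e * s ^+ i) (h e * s ^+ j) by rewrite h00 mul0r dv0.
  by split=> // _; right; split=> //; left.
have [g00|g00] := eqVneq (g e) 0.
  have -> : dv (g e * s ^+ i) (h e * s ^+ j) = false.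
    by rewrite g00 mul0r dv0l mulf_eq0 (negPf h00) expf_eq0 (negPf s0) andbF.
  split=> // -[[hs _]|[_ [hh0|[g1 _]]]]; first by rewrite hs eqxx in s0.
    by rewrite hh0 eqxx in h00.
  by move: g1; rewrite ?eqxx.
have key : dv (g e * s ^+ i) (h e * s ^+ j) <->
    (if (i <= j)%N then dv (g e / h e) (s ^+ (j - i)) else dv (s ^+ (i - j)) (h e / g e)).
  case: leqP => ij.
    have si0 : h e * s ^+ i != 0 by rewrite mulf_neq0 // expf_neq0.
    rewrite -{1}(subnKC ij) exprD mulrA (_ : g e * s ^+ i = h e * s ^+ i * (g e / h e)).
      by rewrite dvM2l.
    by field.
  have sj0 : g e * s ^+ j != 0 by rewrite mulf_neq0 // expf_neq0.
  rewrite -{1}(subnKC (ltnW ij)) exprD mulrA.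
  rewrite (_ : h e * s ^+ j = g e * s ^+ j * (h e / g e)); first by rewrite dvM2l.
  by field.
rewrite key; split=> [[[hs _]|[_ [hh0|[]//]]]|hk].
- by rewrite hs eqxx in s0.
- by rewrite hh0 eqxx in h00.
- by right; split=> //; right.
Qed.

Lemma mono_cls N M g : (M %| N)%N -> (0 < M)%N -> sf g ->
  mono N (fun e s => cls M (g e) s).
Proof.
move=> MN M0 hg; have [rs [_ rs0 _ hrs]] := finite_cls F M0.
have h := @mono_bigor _ rs (fun r e s => cls M r (g e) /\ cls M r s) N.
apply: mono_ext (h _) _ => [r /rs0[r0 _]|e s].
  by apply: mono_and; [exact/mono_D/sa_cls | exact: mono_C].
split=> [[r _ []]|hc]; first by rewrite cls_sym; exact: cls_trans.
have g0 : g e != 0 by case/and4P: hc.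
by have [r rr hr] := hrs _ g0; exists r => //; split=> //; apply: cls_trans hc.
Qed.

Lemma mono_rve N M g : (M %| N)%N -> (0 < M)%N -> sf g ->
  mono N (fun e s => rve M (g e) s).
Proof.
move=> MN M0 hg.
have m1 : mono N (fun e s => dv (g e * s ^+ 0) (1 * s ^+ 1)).
  by apply: mono_dv => //; exact: sf_const.
have m2 : mono N (fun e s => dv (1 * s ^+ 1) (g e * s ^+ 0)).
  by apply: mono_dv => //; exact: sf_const.
apply: mono_ext (mono_or (mono_and (mono_D _ (sa_eq0 hg)) (mono_s0 N))
   (mono_and (mono_cls MN M0 hg) (mono_and m1 m2))) _ => e s.
rewrite !expr0 !expr1 !mulr1 !mul1r; have [g0|g0] := eqVneq (g e) 0.
  rewrite g0; split=> [[[_ ->]|[/and4P[hz]]]|/rve0l]; [exact: rve_refl | | by left].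
  by rewrite eqxx in hz.
rewrite rve_cls //; split=> [[[hz]|[hc [h1 h2]]]|[wE hc]]; first by rewrite hz eqxx in g0.
  split=> //; have s0 : s != 0 by case/and4P: hc.
  by move: h1 h2; rewrite !dv_w // => h1 h2; apply/eqP; rewrite eq_le h1.
by right; split=> //; have s0 : s != 0 by [case/and4P: hc]; rewrite !dv_w // wE lexx.
Qed.

Lemma mono_sat N S e s s' : (0 < N)%N -> mono N S -> rve N s s' -> S e s <-> S e s'.
Proof.
move=> N0 hS hs; have hs' := rve_sym N0 hs.
elim: hS => [D|z k _ k0|M r MN|A B _ hA _ hB|A B _ hA _ hB|A _ hA] //; try tauto.
  by rewrite (dv_rve N0 (rve_refl _ _) (rveX k N0 hs)).
move=> r0; have [s0|s0] := eqVneq s 0.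
  by move: hs; rewrite s0 => /rve0l ->.
have /(rve_cls _ N0 s0)[_ hc] := hs.
have hc' : cls M s s' by apply: cls_le hc.
by split=> h; apply: cls_trans h _; rewrite // cls_sym.
Qed.

Lemma mono_comp N S phi : mono N S -> pmap phi -> mono N (fun e s => S (phi e) s).
Proof.
move=> hS hphi; elim: hS => [D|z k hz k0|M r MN|A B _ ? _ ?|A B _ ? _ ?|A _ ?];
 [|apply: (@mono_B N (fun e => z (phi e)))=> //|exact: mono_C|exact: mono_or
  |exact: mono_and|exact: mono_not].
  by move=> hD; apply: (@mono_D N (fun e => D (phi e))); exact: sa_comp.
exact: sf_comp.
Qed.

Lemma sa_mono N S g : (0 < N)%N -> mono N S -> sf g -> sa (fun e => S e (g e)).
Proof.
move=> N0 hS hg; elim: hS => [D|z k hz k0|M r MN r0|A B _ ? _ ?|A B _ ? _ ?|A _ ?];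
 [|apply: sa_dv => //|apply: sa_cls => //|exact: sa_or|exact: sa_and|exact: sa_not] => //.
  exact: sfX.
exact: dvdn_gt0 MN.
Qed.

(** What is decided by the truth values of finitely many monomial conditions is a Boolean
    combination of them. A set can thus be proved monomial by an invariance argument, without
    writing its formula. *)
Lemma mono_agree N (I : eqType) (rs : seq I) (P : I -> E -> F -> Prop) S :
  (forall i : I, i \in rs -> mono N (P i)) ->
  (forall e s e' s', (forall i : I, i \in rs -> P i e s <-> P i e' s') -> S e s -> S e' s') ->
  mono N S.
Proof.
elim: rs S => [|a rs IH] S hP hS.
  have [[e [s es]]|no] := pselect (exists e s, S e s).
    apply: mono_ext (mono_D _ (sa_const F True)) _ => e' s'.
    by split=> // _; apply: hS es.
  by apply: mono_ext (mono_D _ (sa_const F False)) _ => e s; split=> // es; apply: no; exists e, s.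
have hP' (i : I) : i \in rs -> mono N (P i) by move=> ir; apply: hP; rewrite inE ir orbT.
have ha : mono N (P a) by apply: hP; rewrite inE eqxx.
(* [Q b] holds when some point with the same truth values for the tail, and with truth value [b] for
   the head, lies in [S]. *)
pose Q (b : bool) e s := exists e' s', [/\ forall i : I, i \in rs -> P i e' s' <-> P i e s,
  (P a e' s' <-> b) & S e' s'].
have hQ (b : bool) : mono N (Q b).
  apply: IH => // e s e' s' hes [e1 [s1 [h1 h2 h3]]].
  by exists e1, s1; split=> // i ir; rewrite h1 // hes.
apply: mono_ext (mono_or (mono_and ha (hQ true)) (mono_and (mono_not ha) (hQ false))) _ => e s.
split=> [[]|es].
- move=> [pa [e' [s' [h1 h2 h3]]]]; apply: hS h3 => i; rewrite inE.
  by move=> /orP[/eqP->|/h1//]; rewrite h2.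
- move=> [pa [e' [s' [h1 h2 h3]]]]; apply: hS h3 => i; rewrite inE.
  by move=> /orP[/eqP->|/h1//]; rewrite h2.
- by have [pa|pa] := pselect (P a e s); [left|right]; split=> //; exists e, s; split.
Qed.

End Mono.

(** * Quantifier elimination *)

Section Sums.
Variable F : lfield.
Notation E := (nat -> F).
Implicit Types (a b r s t x y : F).
Implicit Types (N M L k i j n d eps : nat).

Definition ssum d (m : nat -> F) := \sum_(j < d) m j.
Definition good eps d (m : nat -> F) :=
  forall j, (j < d)%N -> dv (ssum d m) (pi ^+ eps * m j).

Lemma min_term d (m : nat -> F) : (0 < d)%N ->
  exists2 j0, (j0 < d)%N & forall j, (j < d)%N -> dv (m j0) (m j).
Proof.
elim: d => // -[|d] IH _.
  by exists 0%N => // -[|//] _; exact: dv_refl.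
have [//|j0 j0d hj0] := IH.
have /orP[h|h] := dv_total (m j0) (m d.+1).
  exists j0 => [|j]; first by rewrite ltnW.
  by rewrite ltnS leq_eqVlt => /orP[/eqP->|/hj0].
exists d.+1 => // j; rewrite ltnS leq_eqVlt => /orP[/eqP->|/hj0 h']; first exact: dv_refl.
exact: dv_trans h h'.
Qed.

Lemma good_min eps d m j0 : (j0 < d)%N -> (forall j, (j < d)%N -> dv (m j0) (m j)) ->
  good eps d m <-> dv (ssum d m) (pi ^+ eps * m j0).
Proof.
move=> jd hj; split=> [h|h j jd']; first exact: h.
by apply: dv_trans h _; rewrite dvM ?dv_refl // hj.
Qed.

(** The finite information about the terms that decides the leading term of their sum when
    cancellation is bounded: their classes, and the gaps between their valuations, where gaps of [L]
    or more are not told apart. *)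
Record agree N L d (m m' : nat -> F) : Prop := Agree {
  agree_cls : forall j, (j < d)%N -> (m j = 0 /\ m' j = 0) \/ cls N (m j) (m' j);
  agree_dv : forall i j l, (i < d)%N -> (j < d)%N -> (l <= L)%N ->
    dv (pi ^+ l * m i) (m j) = dv (pi ^+ l * m' i) (m' j) }.

(** If the gap is at least L, both ratios vanish modulo pi^L. If it is smaller, it is the same on
    both sides, and equality of classes becomes equality of leading terms. *)
Lemma agree_ratio N L d m m' i j : agree N L d m m' -> (0 < N)%N -> (L <= N)%N ->
  (i < d)%N -> (j < d)%N ->
  m i != 0 -> dv (m i) (m j) -> dv (pi ^+ L) (m j / m i - m' j / m' i).
Proof.
move=> [h1 h2] N0 LN id jd mi0 hij.
have [[]|hci] := h1 i id; first by move=> h; rewrite h eqxx in mi0.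
have mi0' : m' i != 0 by case/and4P: hci.
have [[-> ->]|hcj] := h1 j jd; first by rewrite !mul0r subrr dv0.
have [mj0 mj0'] : m j != 0 /\ m' j != 0 by case/and4P: hcj.
have [hL|hL] := boolP (dv (pi ^+ L * m i) (m j)).
  have hL' : dv (pi ^+ L * m' i) (m' j) by rewrite -h2.
  apply: dvB.
    by rewrite -(dvM2r _ _ mi0) divfK.
  by rewrite -(dvM2r _ _ mi0') divfK.
have wE (f g : F) : f != 0 -> g != 0 -> ~~ dv (pi ^+ L * f) g -> dv f g ->
    exists l, [/\ (l < L)%N, w g = w f + l%:Z, dv (pi ^+ l * f) g & ~~ dv (pi ^+ l.+1 * f) g].
  move=> f0 g0; rewrite !dv_w ?mulf_neq0 ?pin0 // wM ?pin0 // w_pin => hn hf.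
  exists `|w g - w f|%N; rewrite !dv_w ?mulf_neq0 ?pin0 // !wM ?pin0 // !w_pin.
  by move: (w f) (w g) hn hf; clear => u v; split; lia.
have [l [lL wj hl hl1]] := wE _ _ mi0 mj0 hL hij.
have hl' : dv (pi ^+ l * m' i) (m' j) by rewrite -h2 // ltnW.
have hl1' : ~~ dv (pi ^+ l.+1 * m' i) (m' j) by rewrite -h2.
have wj' : w (m' j) = w (m' i) + l%:Z.
  move: hl' hl1'; rewrite !dv_w ?mulf_neq0 ?pin0 // !wM ?pin0 // !w_pin; clear; lia.
have q0 : m j / m i != 0 by rewrite mulf_neq0 ?invr_eq0.
have q0' : m' j / m' i != 0 by rewrite mulf_neq0 ?invr_eq0.
have wq : w (m j / m i) = l by rewrite wM ?invr_eq0 // wV // wj; ring.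
have wq' : w (m' j / m' i) = l by rewrite wM ?invr_eq0 // wV // wj'; ring.
have hc : cls N (m j / m i) (m' j / m' i) by apply: clsM => //; apply: clsV.
have : rve N (m j / m i) (m' j / m' i) by apply/rve_cls; rewrite // wq wq'.
apply: dv_trans; rewrite dv_w ?mulf_neq0 ?pin0 ?invr_eq0 //.
by rewrite wM ?pin0 // wq !w_pin; move: LN; clear; lia.
Qed.

Lemma agree_ssum N L d m m' j0 : agree N L d m m' -> (0 < N)%N -> (L <= N)%N ->
  (j0 < d)%N -> (forall j, (j < d)%N -> dv (m j0) (m j)) -> m j0 != 0 ->
  dv (pi ^+ L) (ssum d m / m j0 - ssum d m' / m' j0).
Proof.
move=> ha N0 LN jd hj m0; rewrite /ssum !mulr_suml -sumrB.
by apply: dv_sum => i _; apply: (agree_ratio ha) => //; exact: hj.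
Qed.

Lemma agree_min N L d m m' j0 : agree N L d m m' ->
  (j0 < d)%N -> (forall j, (j < d)%N -> dv (m j0) (m j)) ->
  forall j, (j < d)%N -> dv (m' j0) (m' j).
Proof.
move=> [_ h] jd hj j jd'; have := h j0 j 0%N jd jd' (leq0n _).
by rewrite expr0 !mul1r => <-; exact: hj.
Qed.

Lemma agree_good N L d m m' eps : agree N L d m m' -> (0 < N)%N -> (L <= N)%N ->
  (eps < L)%N -> good eps d m -> good eps d m'.
Proof.
move=> ha N0 LN eL hg; have [d0|d0] := posnP d; first by move=> j; rewrite d0.
have [j0 jd hj] := min_term m d0; have hj' := agree_min ha jd hj.
apply/(good_min _ jd hj'); move/(good_min _ jd hj) in hg.
have [[h h']|hc] := agree_cls ha jd; first by rewrite h' mulr0 dv0.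
have [m0 m0'] : m j0 != 0 /\ m' j0 != 0 by case/and4P: hc.
have hq := agree_ssum ha N0 LN jd hj m0.
rewrite -(divfK m0' (ssum d m')) dvM2r //.
rewrite -(divfK m0 (ssum d m)) dvM2r // in hg.
rewrite -(subKr (ssum d m / m j0) (ssum d m' / m' j0)); apply: dv_near hg _.
by rewrite dvN; apply: dv_trans hq; rewrite dv_pi2.
Qed.

Lemma agree_ssum_cls N L d m m' eps N0 : agree N L d m m' -> (0 < N)%N -> (L <= N)%N ->
  (0 < N0)%N -> (N0 %| N)%N -> (N0 + eps <= L)%N -> good eps d m ->
  (ssum d m = 0 /\ ssum d m' = 0) \/ cls N0 (ssum d m) (ssum d m').
Proof.
move=> ha N00 LN N0g N0N eL hg; have [d0|d0] := posnP d.
  by left; rewrite /ssum d0 !big_ord0.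
have [j0 jd hj] := min_term m d0; have hj' := agree_min ha jd hj.
move/(good_min _ jd hj) in hg.
have [[h h']|hc] := agree_cls ha jd.
  by left; rewrite /ssum !big1 // => i _; apply/eqP; rewrite -dv0l;
    [rewrite -h'; exact: hj' | rewrite -h; exact: hj].
have [m0 m0'] : m j0 != 0 /\ m' j0 != 0 by case/and4P: hc.
have hq := agree_ssum ha N00 LN jd hj m0.
rewrite -(divfK m0 (ssum d m)) dvM2r // in hg.
right; rewrite -(divfK m0' (ssum d m')) -(divfK m0 (ssum d m)).
apply: clsM; last by apply: cls_le hc.
have q0 : ssum d m / m j0 != 0.
  by apply: contraTneq hg => ->; rewrite dv0l pin0.
have : rve N0 (ssum d m / m j0) (ssum d m' / m' j0).
  apply: dv_trans hq; apply: (@dv_trans _ (pi ^+ N0 * pi ^+ eps)).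
    by rewrite dvM ?dv_refl.
  by rewrite -exprD dv_pi2.
by case/rve_cls.
Qed.

End Sums.

Section MonoPoly.
Variable F : lfield.
Notation E := (nat -> F).
Implicit Types (e : E) (D : E -> Prop) (g h z : E -> F) (a b r s t x y : F).
Implicit Types (S : E -> F -> Prop) (N M k i j n d eps : nat) (G : E -> {poly F}).

(* v(p(s)) exceeds the least valuation of a term p_j s^j by at most eps. *)
Definition pgood eps (p : {poly F}) s := forall j, dv p.[s] (pi ^+ eps * (p`_j * s ^+ j)).

Lemma ssum_horner (p : {poly F}) d s : (size p <= d)%N ->
  ssum d (fun j => p`_j * s ^+ j) = p.[s].
Proof. by move=> pd; rewrite (horner_coef_wide _ pd). Qed.

Lemma pgoodE eps (p : {poly F}) d s : (size p <= d)%N ->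
  pgood eps p s <-> good eps d (fun j => p`_j * s ^+ j).
Proof.
move=> pd; rewrite /good ssum_horner //; split=> h j; first by move=> _; exact: h.
have [jd|dj] := ltnP j d; first exact: h.
by rewrite nth_default ?mul0r ?mulr0 ?dv0 // (leq_trans pd).
Qed.

Lemma mono_clsX N r g j : (0 < N)%N -> r != 0 -> sf g ->
  mono N (fun e s => cls N r (g e * s ^+ j)).
Proof.
move=> N0 r0 hg; have [rs [_ rs0 _ hrs]] := finite_cls F N0.
have h := @mono_bigor F _ rs (fun x e s => cls N r (g e * x ^+ j) /\ cls N x s) N.
have h0 : mono N (fun e s => s = 0 /\ cls N r (g e * 0 ^+ j)).
  by apply: mono_and (mono_s0 _ _) _; apply/mono_D/sa_cls/sfM => //; exact: sf_const.
apply: mono_ext (mono_or h0 (h _)) _ => [x /rs0[x0 _]|e s].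
  by apply: mono_and; [apply/mono_D/sa_cls/sfM => //; exact: sf_const | exact: mono_C].
have [->|s0] := eqVneq s 0.
  split=> [[[]//|[x _ [_]]]|h']; last by left.
  by case/and4P; rewrite eqxx.
split=> [[[hs]|[x _ [h1 h2]]]|hc]; first by rewrite hs eqxx in s0.
  have g0 : g e != 0 by case/and4P: h1 => _; rewrite mulf_eq0 negb_or => /andP[].
  by apply: cls_trans h1 _; apply: clsM (cls_refl _ g0) (clsX _ h2).
have g0 : g e != 0 by case/and4P: hc => _; rewrite mulf_eq0 negb_or => /andP[].
have [x xr hx] := hrs _ s0; right; exists x => //; split=> //.
by apply: cls_trans hc _; apply: clsM (cls_refl _ g0) (clsX _ _); rewrite cls_sym.
Qed.

Lemma mono_fam_agree G d N L S : fam G -> (0 < N)%N ->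
  (forall e s e' s', agree N L d (fun j => (G e)`_j * s ^+ j)
     (fun j => (G e')`_j * s' ^+ j) -> S e s -> S e' s') -> mono N S.
Proof.
move=> fG N0 hS; have [rs [_ rs0 _ hrs]] := finite_cls F N0.
pose P (c : nat * nat * nat + nat * F) e s := match c with
  | inl (i, j, l) => dv (pi ^+ l * (G e)`_i * s ^+ i) ((G e)`_j * s ^+ j) : Prop
  | inr (j, r) => cls N r ((G e)`_j * s ^+ j) : Prop end.
pose cs : seq (nat * nat * nat + nat * F) :=
  [seq inl c | c <- [seq (ij, l) | ij <- [seq (i, j) | i <- iota 0 d, j <- iota 0 d], l <- iota 0 L.+1]]
  ++ [seq inr c | c <- [seq (j, r) | j <- iota 0 d, r <- rs]].
have csl i j l : (i < d)%N -> (j < d)%N -> (l <= L)%N -> inl (i, j, l) \in cs.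
  move=> id jd lL; rewrite mem_cat; apply/orP; left; apply: map_f.
  by apply: allpairs_f; [apply: allpairs_f|]; rewrite mem_iota.
have csr j r : (j < d)%N -> r \in rs -> inr (j, r) \in cs.
  move=> jd rr; rewrite mem_cat; apply/orP; right; apply: map_f.
  by apply: allpairs_f; rewrite ?mem_iota.
apply: (@mono_agree _ _ _ cs P) => [c|e s e' s' h].
  rewrite mem_cat => /orP[] /mapP[].
    move=> [[i j] l] _ ->; apply: (@mono_dv _ N (fun e => pi ^+ l * (G e)`_i)) => //.
    by apply: sfM => //; exact: sf_const.
  by move=> [j r] /allpairsP[[j' r'] /= [_ /rs0[r0 _] [-> ->]]] ->; apply: mono_clsX.
apply: hS; split=> [j jd|i j l id jd lL].
  have hj r : r \in rs -> cls N r ((G e)`_j * s ^+ j) <-> cls N r ((G e')`_j * s' ^+ j).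
    by move=> rr; apply: (h (inr (j, r))); exact: csr.
  have [h0|h0] := eqVneq ((G e)`_j * s ^+ j) 0; have [h0'|h0'] := eqVneq ((G e')`_j * s' ^+ j) 0.
  - by left.
  - by have [r /hj hr /hr /and4P[_]] := hrs _ h0'; rewrite h0 eqxx.
  - by have [r /hj hr /hr /and4P[_]] := hrs _ h0; rewrite h0' eqxx.
  - have [r rr hr] := hrs _ h0; right; apply: (@cls_trans _ _ r); first by rewrite cls_sym.
    exact/hj.
have := h _ (csl i j l id jd lL); rewrite /P -!mulrA => h'.
by apply/idP/idP; apply h'.
Qed.

Lemma mono_pgood G d N eps : fam G -> (forall e, (size (G e) <= d)%N) -> (eps < N)%N ->
  mono N (fun e s => pgood eps (G e) s).
Proof.
move=> fG hd eN; have N0 : (0 < N)%N by apply: leq_ltn_trans eN.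
apply: (@mono_fam_agree G d N N) => // e s e' s' ha.
by move=> /(pgoodE _ _ (hd e)) h; apply/(pgoodE _ _ (hd e')); apply: agree_good ha _ _ eN h.
Qed.

(** When cancellation loses at most [eps] digits, [N0 + eps] digits of the terms fix [N0] leading
    digits of the sum, hence its class. This is how polynomial conditions become monomial. *)
Lemma mono_pgood_cls G d N eps N0 (W : F -> Prop) : fam G -> (forall e, (size (G e) <= d)%N) ->
  (0 < N0)%N -> (forall x y, cls N0 x y -> W x -> W y) ->
  (0 < N)%N -> (N0 %| N)%N -> (N0 + eps <= N)%N ->
  mono N (fun e s => pgood eps (G e) s /\ W (G e).[s]).
Proof.
move=> fG hd N00 hW NN N0N eN.
apply: (@mono_fam_agree G d N N) => // e s e' s' ha [].
move=> /(pgoodE _ _ (hd e)) h hw; split.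
  apply/(pgoodE _ _ (hd e')); apply: agree_good ha _ _ _ h => //.
  by apply: leq_trans eN; rewrite -add1n leq_add2r.
have := agree_ssum_cls ha NN (leqnn _) N00 N0N eN h; rewrite !ssum_horner //.
by move=> [[h1 h2]|/hW]; [rewrite h2 -h1|apply].
Qed.

(** If neither argument dominates, v(x / y) lies strictly between -N0 and N0, and finitely many
    leading terms are then possible for x / y at precision B. *)
Lemma split_near N0 B : (0 < B)%N -> exists om : seq F, forall x y : F,
  [\/ dv (pi ^+ N0 * x) y, dv (pi ^+ N0 * y) x | exists2 o, o \in om & rve B (o * y) x].
Proof.
move=> B0; have [rs [_ rs0 _ hrs]] := finite_cls F B0.
(* Class representatives times pi^(B i) for -N0 - 1 <= i <= N0 + 1, which covers the whole range of
   valuations. *)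
pose om := [seq r * pi ^ (B%:Z * (k%:Z - N0.+1%:Z)) | r <- rs, k <- iota 0 (N0 + N0).+3].
exists om => x y.
have [h1|h1] := boolP (dv (pi ^+ N0 * x) y); first by constructor 1.
have [h2|h2] := boolP (dv (pi ^+ N0 * y) x); first by constructor 2.
have y0 : y != 0 by apply: contraNneq h1 => ->; rewrite dv0.
have x0 : x != 0 by apply: contraNneq h2 => ->; rewrite dv0.
have q0 : x / y != 0 by rewrite mulf_neq0 ?invr_eq0.
have [r rr hr] := hrs _ q0; have [r0 rB] := rs0 _ rr.
have /dvdzP[i iE] : (B%:Z %| w r - w (x / y))%Z by case/and4P: hr.
have wq : w (x / y) = w x - w y by rewrite wM ?invr_eq0 // wV.
move: h1 h2; rewrite !dv_w ?mulf_neq0 ?pin0 // !wM ?pin0 // w_pin => h1 h2.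
have /andP[iN1 iN2] : - N0%:Z <= i <= N0%:Z.
  by move: h1 h2 rB iE B0; rewrite wq; move: (w x) (w y) (w r); clear => u v t; nia.
constructor 3; exists (r * pi ^ (B%:Z * - i)).
  rewrite (_ : - i = `|N0.+1%:Z - i|%N%:Z - N0.+1%:Z); last by move: iN2; clear; lia.
  set k := `|_|%N; have kN : (k < (N0 + N0).+3)%N by rewrite /k; move: iN1 iN2; clear; lia.
  by apply/allpairsP; exists (r, k); rewrite mem_iota /=; split.
have o0 : r * pi ^ (B%:Z * - i) != 0 by rewrite mulf_neq0 ?piz0.
set o := r * _ in o0 *.
suff h : rve B o (x / y) by move: (rveM B0 h (rve_refl B y)); rewrite divfK.
apply/(rve_cls _ B0 o0); split; first by rewrite /o wM ?piz0 // w_piz; move: iE; clear; lia.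
by apply: cls_trans hr; rewrite cls_sym; apply: cls_mulpi.
Qed.

Lemma split_rve N0 N1 B (o x y : F) : rve B (o * y) x -> dv (x + y) (pi ^+ N1 * x) ->
  (0 < N0)%N -> (N0 + N1 <= B)%N -> rve N0 (x + y) ((1 + o) * y).
Proof.
move=> h1 h2 N00 hB; have B0 : (0 < B)%N by lia.
have h1' := rve_sym B0 h1.
rewrite /rve (_ : x + y - (1 + o) * y = x - o * y); last by ring.
apply: dv_trans h1'; apply: (@dv_trans _ (pi ^+ N0 * (pi ^+ N1 * x))).
  by rewrite dvM ?dv_refl.
by rewrite mulrA -exprD dvM ?dv_refl // dv_pi2.
Qed.

(* When no cancellation occurs in [s + dl e], its leading term is a monomial
   function of [s]. *)
Lemma mono_plus N0 S dl : (0 < N0)%N -> mono N0 S -> sf dl ->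
  exists N S', [/\ (0 < N)%N, mono N S' &
    forall e s, dv (s + dl e) s -> S e (s + dl e) <-> S' e s].
Proof.
move=> N00 hS hdl; have [om hom] := split_near N0 N00.
pose S' e s := (dv (pi ^+ N0 * s) (dl e) /\ S e s) \/
  ((dv (pi ^+ N0 * dl e) s /\ S e (dl e)) \/
   exists2 o, o \in om & rve N0 (o * dl e) s /\ S e ((1 + o) * dl e)).
exists N0, S'; split=> // [|e s hs].
  apply: mono_or; last apply: mono_or; last first.
  - apply: (@mono_bigor F _ om (fun o e s => rve N0 (o * dl e) s /\ S e ((1 + o) * dl e))) => o _.
    apply: mono_and; first by apply: mono_rve => //; apply: sfM => //; exact: sf_const.
    apply: mono_D; apply: (sa_mono N00 hS); apply: sfM => //; exact: sf_const.
  - apply: mono_and; last by apply: mono_D; exact: sa_mono hS hdl.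
    apply: mono_ext (@mono_dv F N0 (fun e => pi ^+ N0 * dl e) (fun _ => 1) 0 1 _ (sf_const _)) _.
      by apply: sfM => //; exact: sf_const.
    by move=> e s; rewrite expr0 expr1 mulr1 mul1r.
  - apply: mono_and hS.
    apply: mono_ext (@mono_dv F N0 (fun e => pi ^+ N0) dl 1 0 (sf_const _) hdl) _.
    by move=> e s; rewrite expr0 expr1 mulr1.
have h1 : dv (pi ^+ N0 * s) (dl e) -> S e (s + dl e) <-> S e s.
  move=> h; have r : rve N0 s (s + dl e) by rewrite /rve opprD addrA subrr add0r dvN.
  by split=> /(mono_sat e N00 hS r).
have h2 : dv (pi ^+ N0 * dl e) s -> S e (s + dl e) <-> S e (dl e).
  move=> h; have r : rve N0 (dl e) (s + dl e) by rewrite /rve opprD addrCA subrr addr0 dvN.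
  by split=> /(mono_sat e N00 hS r).
have h3 o : rve N0 (o * dl e) s -> S e (s + dl e) <-> S e ((1 + o) * dl e).
  move=> h; have r : rve N0 (s + dl e) ((1 + o) * dl e).
    by apply: (@split_rve N0 0 N0 o) => //; rewrite ?addn0 // expr0 mul1r.
  by split=> /(mono_sat e N00 hS r).
split=> [hse|[[/h1 h /h]|[[/h2 h /h]|[o _ [/h3 h /h]]]]] //.
have [h|h|[o oo h]] := hom s (dl e); [left|right; left|right; right].
- by split=> //; apply/(h1 h).
- by split=> //; apply/(h2 h).
- by exists o => //; split=> //; apply/(h3 _ h).
Qed.

End MonoPoly.

(** * Projection of a monomial set *)

Section Projection.
Variable F : lfield.
Notation E := (nat -> F).
Implicit Types (e : E) (D : E -> Prop) (g h z : E -> F) (a b r s t x y : F).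
Implicit Types (S : E -> F -> Prop) (N M k i j n d eps : nat).

Lemma dv_weq a b b' : b != 0 -> b' != 0 -> w b = w b' -> dv a b = dv a b'.
Proof. by move=> b0 b0' e; rewrite !dvE (negPf b0) (negPf b0') e. Qed.

(** Solving k v(s) = v(z) with v(s) = v(r) modulo N is a congruence on v(z) modulo kN, so it depends
    only on a class of z. *)
Lemma sa_exists_w_cls N r z k : (0 < N)%N -> r != 0 -> (0 < k)%N -> sf z ->
  sa (fun e => z e != 0 /\ exists s, cls N r s /\ w (s ^+ k) = w (z e)).
Proof.
move=> N0 r0 k0 hz; have kN0 : (0 < k * N)%N by rewrite muln_gt0 k0.
apply: (@sa_clsW F (k * N) (fun x => x != 0 /\ exists s, cls N r s /\ w (s ^+ k) = w x)) => //.
move=> x y /and4P[x0 y0 /dvdzP[i iE] _] [_ [s [hs hw]]]; split=> //.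
have s0 : s != 0 by case/and4P: hs.
exists (s * pi ^ (N%:Z * - i)); split; first by apply: cls_trans hs (cls_mulpi _ _ s0).
rewrite wX // in hw; rewrite wX ?mulf_neq0 ?piz0 // wM ?piz0 // w_piz.
by move: hw iE; rewrite PoszM; clear; nia.
Qed.

(** Points of one class with the same valuation have the same leading term, hence are equivalent for
    [S]. Over a nonempty set of such points the quantifier commutes with conjunction and negation,
    and induction on [mono] applies. *)
Lemma sa_exists_w N S z k : (0 < N)%N -> (0 < k)%N -> sf z -> mono N S ->
  sa (fun e => z e != 0 /\ exists s, [/\ s != 0, w (s ^+ k) = w (z e) & S e s]).
Proof.
move=> N0 k0 hz hS; have [rs [_ rs0 _ hrs]] := finite_cls F N0.
pose T r e s := cls N r s /\ w (s ^+ k) = w (z e).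
have Tr r e s s' : T r e s -> T r e s' -> rve N s s'.
  move=> [h1 h2] [h3 h4]; have [s0 s0'] : s != 0 /\ s' != 0.
    by split; [case/and4P: h1|case/and4P: h3].
  apply/(rve_cls _ N0 s0); split; last by apply: cls_trans h3; rewrite cls_sym.
  by move: h2 h4; rewrite !wX //; move: k0; clear; nia.
have main r : r \in rs -> sa (fun e => z e != 0 /\ exists s, T r e s /\ S e s).
  move=> /rs0[r0 _]; have hT := sa_exists_w_cls N0 r0 k0 hz.
  elim: hS => [D hD|z2 k2 hz2 k20|M r2 MN r20|A B hA IA hB IB|A B hA IA hB IB|A hA IA].
  - apply: sa_ext (sa_and hT hD) _ => e.
    by split=> [[[h0 [s hs]] d]|[h0 [s [hs d]]]]; repeat split=> //; exists s.
  - apply: sa_ext (sa_and hT (sa_dv (sfX k hz2) (sfX k2 hz))) _ => e.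
    have key s : z e != 0 -> T r e s -> dv (z2 e) (s ^+ k2) = dv (z2 e ^+ k) (z e ^+ k2).
      move=> h0 [hs hw]; have s0 : s != 0 by case/and4P: hs.
      (* Raising to the power k allows s^k to be replaced by z, which has the same valuation. *)
      rewrite -(dvXE _ _ k0) -exprM mulnC exprM.
      by apply: dv_weq; rewrite ?expf_neq0 // [LHS]wX ?expf_neq0 // hw wX.
    by split=> [[[h0 [s hs]] d]|[h0 [s [hs d]]]]; repeat split=> //;
      [exists s; split=> //; rewrite key | exists s | rewrite -(key s)].
  - apply: sa_ext (sa_and hT (sa_const F (cls M r2 r))) _ => e.
    have key s : T r e s -> cls M r2 s <-> cls M r2 r.
      move=> [hs _]; have hs' : cls M r s by apply: cls_le hs.
      by split=> h; apply: cls_trans h _; rewrite // cls_sym.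
    by split=> [[[h0 [s hs]] d]|[h0 [s [hs d]]]]; repeat split=> //;
      [exists s; split=> //; apply/(key s hs) | exists s | apply/(key s hs)].
  - apply: sa_ext (sa_or IA IB) _ => e; split.
      by move=> [[h0 [s [h1 h2]]]|[h0 [s [h1 h2]]]]; split=> //; exists s; split=> //; [left|right].
    by move=> [h0 [s [h1 [h2|h2]]]]; [left|right]; split=> //; exists s.
  - apply: sa_ext (sa_and IA IB) _ => e; split.
      move=> [[h0 [s [h1 h2]]] [_ [s' [h3 h4]]]]; split=> //; exists s; repeat split=> //; try exact: (proj1 h1); try exact: (proj2 h1).
      by apply/(mono_sat e N0 hB (Tr _ _ _ _ h1 h3)).
    by move=> [h0 [s [h1 [h2 h3]]]]; split; split=> //; exists s.
  - apply: sa_ext (sa_and hT (sa_not IA)) _ => e; split.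
      move=> [[h0 [s hs]] hn]; split=> //; exists s; split=> // hA'; apply: hn.
      by split=> //; exists s.
    move=> [h0 [s [hs hn]]]; split; first by split=> //; exists s.
    move=> [_ [s' [hs' hA']]]; apply: hn.
    by apply/(mono_sat e N0 hA (Tr _ _ _ _ hs hs')).
apply: sa_ext (sa_bigor main) _ => e; split=> [[r rr [h0 [s [[hs hw] he]]]]|[h0 [s [s0 hw he]]]].
  by split=> //; exists s; split=> //; case/and4P: hs.
by have [r rr hr] := hrs s s0; exists r => //; split=> //; exists s.
Qed.

Definition sfs (cs : seq ((E -> F) * nat)) := forall c, c \in cs -> sf c.1 /\ (0 < c.2)%N.

Lemma mono_thresholds N S : (0 < N)%N -> mono N S -> exists2 cs, sfs cs &
  forall e s s', cls N s s' ->
    (forall c, c \in cs -> dv (c.1 e) (s ^+ c.2) = dv (c.1 e) (s' ^+ c.2)) ->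
    S e s <-> S e s'.
Proof.
move=> N0; elim=> [D hD|z k hz k0|M r MN r0|A B _ [c1 h1 e1] _ [c2 h2 e2]
   |A B _ [c1 h1 e1] _ [c2 h2 e2]|A _ [c1 h1 e1]].
- by exists [::].
- exists [:: (z, k)] => [c|e s s' _ h]; first by rewrite inE => /eqP ->.
  by rewrite (h (z, k)) // inE.
- exists [::] => // e s s' hs _; have hs' : cls M s s' by apply: cls_le hs.
  by split=> h; apply: cls_trans h _; rewrite // cls_sym.
- exists (c1 ++ c2) => [c|e s s' hs h]; first by rewrite mem_cat => /orP[/h1|/h2].
  by rewrite (e1 e s s' hs) ?(e2 e s s' hs) // => c hc; apply: h; rewrite mem_cat hc ?orbT.
- exists (c1 ++ c2) => [c|e s s' hs h]; first by rewrite mem_cat => /orP[/h1|/h2].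
  by rewrite (e1 e s s' hs) ?(e2 e s s' hs) // => c hc; apply: h; rewrite mem_cat hc ?orbT.
- by exists c1 => // e s s' hs h; rewrite (e1 e s s' hs).
Qed.

(** If membership changes between s and s pi^(+-N), a threshold z with exponent k separates them, so
    k v(s) is within kN of v(z). Multiplying z by the powers of pi in that range makes the two
    valuations equal for one of them. *)
Lemma mono_boundary N S : (0 < N)%N -> mono N S -> exists2 cs, sfs cs &
  forall e s (i : int), s != 0 -> `|i| = 1 -> S e s -> ~ S e (s * pi ^ (N%:Z * i)) ->
  exists2 c, c \in cs & c.1 e != 0 /\ w (s ^+ c.2) = w (c.1 e).
Proof.
move=> N0 hS; have [cs hcs hth] := mono_thresholds N0 hS.
pose sh (c : (E -> F) * nat) j : (E -> F) * nat :=
  ((fun e => c.1 e * pi ^ (j%:Z - (c.2 * N)%N%:Z)), c.2).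
exists [seq sh c j | c <- cs, j <- iota 0 (2 * (c.2 * N)).+1] => [c|].
  move=> /allpairsPdep[c' [j /= [/hcs[h1 h2] _ ->]]]; split=> //=.
  by apply: sfM => //; exact: sf_const.
move=> e s i s0 i1 h1 h2; have s0' : s * pi ^ (N%:Z * i) != 0 by rewrite mulf_neq0 ?piz0.
have [c cc hc] : exists2 c, c \in cs & dv (c.1 e) (s ^+ c.2) <> dv (c.1 e) ((s * pi ^ (N%:Z * i)) ^+ c.2).
  apply: contrapT => hn; apply: h2; apply/(hth e s _ (cls_mulpi N i s0)) => // c cc.
  by apply: contrapT => h; apply: hn; exists c.
have [_ k0] := hcs _ cc.
have c0 : c.1 e != 0.
  apply/negP=> /eqP c0; apply: hc; rewrite c0 !dv0l !expf_eq0.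
  by rewrite (negPf s0) (negPf s0') andbF.
have hw : `|w (s ^+ c.2) - w (c.1 e)| <= (c.2 * N)%N%:Z.
  move: hc; rewrite !dv_w ?expf_neq0 // !wX // wM ?piz0 // w_piz.
  move: (w s) (w (c.1 e)) i1 N0 k0; clear => u v; rewrite PoszM.
  by move=> i1 N0 k0 hc; nia.
pose j := absz (w (s ^+ c.2) - w (c.1 e) + (c.2 * N)%N%:Z).
exists (sh c j).
  apply/allpairsPdep; exists c, j; rewrite cc mem_iota; split=> //=.
  by rewrite /j; move: hw; move: (w (s ^+ c.2)) (w (c.1 e)) (c.2 * N)%N; clear; lia.
rewrite /= mulf_neq0 ?piz0 //; split=> //; rewrite wM ?piz0 // w_piz /j.
by move: hw; move: (w (s ^+ c.2)) (w (c.1 e)) (c.2 * N)%N; clear; lia.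
Qed.

(** From a point of [S], move by pi^(+-N) towards valuation 0. Either a point with |v| <= N is
    reached, or the walk stops at a boundary point. So only finitely many semialgebraic valuations
    need testing. *)
Lemma sa_exists_mono N S : (0 < N)%N -> mono N S -> sa (fun e => exists s, S e s).
Proof.
move=> N0 hS; have [cs hcs hb] := mono_boundary N0 hS.
pose cs' : seq ((E -> F) * nat) := cs ++ [seq ((fun _ => pi ^ (j%:Z - N%:Z)), 1%N) | j <- iota 0 (N + N).+1].
have hcs' : sfs cs'.
  move=> c; rewrite mem_cat => /orP[/hcs//|/mapP[j _ ->]]; split=> //; exact: sf_const.
have hcand c : c \in cs' ->
    sa (fun e => c.1 e != 0 /\ exists s, [/\ s != 0, w (s ^+ c.2) = w (c.1 e) & S e s]).
  by move=> /hcs'[h1 h2]; apply: (sa_exists_w N0 h2 h1 hS).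
apply: sa_ext (sa_or (sa_mono N0 hS (sf_const 0)) (sa_bigor hcand)) _ => e.
split=> [[h|[c _ [_ [s [_ _ h]]]]]|[s hs]]; [by exists 0|by exists s|].
have [s0|s0] := eqVneq s 0; first by left; rewrite -s0.
right; move: {-1}(`|w s|%N) (leqnn `|w s|%N) => m.
elim: m s s0 hs => [|m IH] s s0 hs hm.
all: have [hN|hN] := leP `|w s| N%:Z.
- pose j := absz (w s + N%:Z); exists ((fun _ => pi ^ (j%:Z - N%:Z)), 1%N).
    rewrite mem_cat; apply/orP; right; apply/mapP; exists j => //; rewrite mem_iota.
    by rewrite /j; move: hN; clear; lia.
  rewrite /= piz0; split=> //; exists s; split=> //; rewrite expr1 w_piz /j.
  by move: hN; clear; lia.
- by move: hm hN; clear; lia.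
- pose j := absz (w s + N%:Z); exists ((fun _ => pi ^ (j%:Z - N%:Z)), 1%N).
    rewrite mem_cat; apply/orP; right; apply/mapP; exists j => //; rewrite mem_iota.
    by rewrite /j; move: hN; clear; lia.
  rewrite /= piz0; split=> //; exists s; split=> //; rewrite expr1 w_piz /j.
  by move: hN; clear; lia.
pose i : int := if w s <= 0 then 1 else -1.
have i1 : `|i| = 1 by rewrite /i; case: ifP.
have [h|h] := pselect (S e (s * pi ^ (N%:Z * i))).
  apply: (IH _ _ h); first by rewrite mulf_neq0 ?piz0.
  by rewrite wM ?piz0 // w_piz; move: hm hN N0; rewrite /i; clear; case: ifP; nia.
have [c cc [c0 hw]] := hb e s i s0 i1 hs h.
by exists c; [rewrite mem_cat cc | split=> //; exists s].
Qed.

End Projection.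

(** * Hensel's lemma at an arbitrary nonzero point, by rescaling *)

Section Scaling.
Variable F : lfield.
Implicit Types (a b r s t x y m : F) (H h p : {poly F}).
Implicit Types (N M k i j l n d e eps : nat).

Definition scl H a m := m^-1 *: (H \Po (a *: 'X)).

Lemma coef_scl H a m l : (scl H a m)`_l = H`_l * a ^+ l / m.
Proof.
rewrite /scl coefZ comp_polyE coef_sum mulrC; congr (_ * _).
have [lH|Hl] := ltnP l (size H); last first.
  rewrite nth_default // mul0r big1 // => i _.
  rewrite coefZ exprZn coefZ coefXn; case: eqP => [e|_]; last by rewrite !mulr0.
  by have := ltn_ord i; rewrite -e ltnNge Hl.
rewrite (bigD1 (Ordinal lH)) //= big1 ?addr0 => [|i ni].
  by rewrite coefZ exprZn coefZ coefXn eqxx mulr1.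
rewrite coefZ exprZn coefZ coefXn; have [li|_] := eqVneq l i; last by rewrite !mulr0.
by case/eqP: ni; exact/val_inj.
Qed.

Lemma horner_scl H a m x : (scl H a m).[x] = H.[a * x] / m.
Proof. by rewrite /scl hornerZ horner_comp hornerZ hornerX mulrC. Qed.

Lemma deriv_scl H a m x : (scl H a m)^`().[x] = a * H^`().[a * x] / m.
Proof.
rewrite /scl derivZ deriv_comp derivZ derivX alg_polyC hornerZ hornerM horner_comp hornerZ hornerX hornerC; ring.
Qed.

Lemma shift_shift p x y : shift p (x + y) = shift (shift p x) y.
Proof.
rewrite /shift -comp_polyA comp_polyD comp_polyX comp_polyC -addrA -polyCD.
by rewrite [y + x]addrC.
Qed.

(* Scaling by a least term of H at s makes all coefficients integral. *)
Lemma scl_min H s : H != 0 -> s != 0 -> exists m,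
  [/\ m != 0, ipoly (scl H s m), (forall l, dv m (H`_l * s ^+ l)) &
      exists2 j, (j < size H)%N & m = H`_j * s ^+ j].
Proof.
move=> H0 s0; have sH : (0 < size H)%N by rewrite size_poly_gt0.
have [j jH hj] := min_term (fun j => H`_j * s ^+ j) sH.
have hj' l : dv (H`_j * s ^+ j) (H`_l * s ^+ l).
  have [/hj//|Hl] := ltnP l (size H); by rewrite (nth_default _ Hl) mul0r dv0.
have m0 : H`_j * s ^+ j != 0.
  apply: contraTneq (hj' (size H).-1) => ->.
  by rewrite dv0l mulf_neq0 ?expf_neq0 // -lead_coefE lead_coef_eq0.
exists (H`_j * s ^+ j); split=> //; last by exists j.
by move=> l; rewrite coef_scl -(dvM2r _ _ m0) mul1r divfK.
Qed.

(** After rescaling by a least term of [H] at s, this is the bound on the derivative at 1 that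
    Hensel's lemma requires. *)
Definition dgood eps H s := forall l, dv (s * H^`().[s]) (pi ^+ eps * (H`_l * s ^+ l)).

Lemma dgood_scl eps H s m : m != 0 -> (exists2 j, (j < size H)%N & m = H`_j * s ^+ j) ->
  dgood eps H s -> dv (scl H s m)^`().[1] (pi ^+ eps).
Proof.
move=> m0 [j _ mE] hd; rewrite deriv_scl mulr1 -(dvM2r _ _ m0) divfK // mE.
exact: hd.
Qed.

Lemma ratio_near N s x : s != 0 -> rve N s x = dv (pi ^+ N) (1 - x / s).
Proof.
by move=> s0; rewrite /rve -[RHS](dvM2r _ _ s0) mulrBl divfK // mul1r.
Qed.

(** Cancellation beyond [eps + eps + M] digits in H(s) is precisely Hensel's smallness condition at
    1 for the rescaled polynomial. *)
Lemma root_exists eps M H s : H != 0 -> s != 0 -> dgood eps H s ->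
  ~ pgood (eps + eps + M) H s -> exists2 r, H.[r] = 0 & rve (eps + M).+1 s r.
Proof.
move=> H0 s0 hd hn; have [m [m0 hi hm hj]] := scl_min H0 s0.
have h1 := dgood_scl m0 hj hd.
have h2 : dv (pi ^+ (eps + eps + M).+1) (scl H s m).[1].
  rewrite exprS sdv ?pin0 //; apply/negP=> h; apply: hn => l.
  apply: (@dv_trans _ (pi ^+ (eps + eps + M) * m)); last by rewrite dvM ?dv_refl.
  by rewrite horner_scl mulr1 -(dvM2r _ _ m0) divfK in h.
have [r hr hr1] := hensel hi (dv_refl 1) h1 h2.
exists (s * r).
  by move: hr; rewrite horner_scl => /eqP; rewrite mulf_eq0 invr_eq0 (negPf m0) orbF => /eqP.
by rewrite ratio_near // mulrAC divff // mul1r dvBC.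
Qed.

Lemma dgood_near eps H s r : H != 0 -> s != 0 -> dgood eps H s -> rve eps.+1 s r ->
  dgood eps H r.
Proof.
move=> H0 s0 hd hr; have [m [m0 hi hm hj]] := scl_min H0 s0.
have h1 := dgood_scl m0 hj hd.
have [r0 wr] := rve_w (ltn0Sn _) hr s0.
have r1 : dv 1 (r / s) by rewrite -(dvM2r _ _ s0) divfK // mul1r dv_w // wr lexx.
have h2 : dv (scl H s m)^`().[r / s] (pi ^+ eps).
  rewrite -(subrK (scl H s m)^`().[1] (scl H s m)^`().[r / s]) addrC.
  apply: dv_near h1 _; apply: (@dv_trans _ (r / s - 1)).
    by rewrite dvBC -ratio_near.
  by apply: ipoly_lip => //; [exact: ipoly_deriv | exact: dv_refl].
move=> l; rewrite deriv_scl -(dvM2r _ _ m0) divfK // (mulrC s (r / s)) divfK // in h2.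
apply: (@dv_trans _ (s * H^`().[r])); first by rewrite dvM ?dv_refl // dv_w // wr lexx.
apply: dv_trans h2 _; rewrite dvM ?dv_refl //.
apply: dv_trans (hm l) _; rewrite dvM ?dv_refl // dvX // dv_w // wr lexx //.
Qed.

Lemma root_unique eps H r r' : H != 0 -> r != 0 -> dgood eps H r -> rve eps.+1 r r' ->
  H.[r] = 0 -> H.[r'] = 0 -> r = r'.
Proof.
move=> H0 r0 hd hr e1 e2; have [m [m0 hi hm hj]] := scl_min H0 r0.
have h1 := dgood_scl m0 hj hd.
have [r0' wr] := rve_w (ltn0Sn _) hr r0.
have hr1 : dv 1 (r' / r) by rewrite -(dvM2r _ _ r0) divfK // mul1r dv_w // wr lexx.
have : r' / r = 1.
  apply: (hensel_unique hi hr1 (dv_refl 1) h1); first by rewrite dvBC -ratio_near.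
  by rewrite !horner_scl mulr1 e1 (mulrC r) divfK // e2.
by move=> h; rewrite -(divfK r0 r') h mul1r.
Qed.

Lemma scl_shift H r m x : r != 0 -> m != 0 -> (shift (scl H r m) 1).[x] = (shift H r).[r * x] / m.
Proof. by move=> r0 m0; rewrite !horner_shift horner_scl mulrDr mulr1. Qed.

Lemma coef_scl_shift H r m l : r != 0 -> m != 0 ->
  (shift (scl H r m) 1)`_l = (shift H r)`_l * r ^+ l / m.
Proof.
move=> r0 m0; rewrite -coef_scl; congr (_`_l); rewrite /shift /scl.
rewrite comp_polyZ -!comp_polyA; congr (_ *: (_ \Po _)).
by rewrite comp_polyD comp_polyZ !comp_polyX comp_polyC scalerDr polyC1 alg_polyC.
Qed.

(** In x = (s - r) / r the rescaled expansion has integral coefficients, no constant term, and a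
    linear coefficient of valuation at most eps. As x is divisible by pi^(eps+1), the linear term
    dominates all others. *)
Lemma root_good eps H r s : H != 0 -> r != 0 -> dgood eps H r -> H.[r] = 0 ->
  rve eps.+1 r s -> pgood 0 (shift H r) (s - r).
Proof.
move=> H0 r0 hd e1 hs l; have [m [m0 hi hm hj]] := scl_min H0 r0.
have h1 := dgood_scl m0 hj hd; rewrite expr0 mul1r.
set q := shift (scl H r m) 1.
have iq : ipoly q by apply: ipoly_shift => //; exact: dv_refl.
have [q1 [q1E q1c]] := poly_split1 q; have [q2 [q2E q2c]] := poly_split1 q1.
have iq2 : ipoly q2 by move=> j; rewrite q2c q1c.
have q0 : q`_0 = 0 by rewrite shift0 horner_scl mulr1 e1 mul0r.
have qd : dv q`_1 (pi ^+ eps) by rewrite shift1.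
have q10 : q`_1 != 0 by apply: contraTneq qd => ->; rewrite dv0l pin0.
set x := (s - r) / r.
have hx : dv (pi ^+ eps.+1) x.
  by move: hs; rewrite ratio_near // dvBC /x mulrBl divff.
have x1 : dv 1 x by apply: dv_trans hx; exact: dv_pin.
have xE : r * x = s - r by rewrite /x mulrC divfK.
clearbody x.
rewrite -(dvM2r _ _ (_ : m^-1 != 0)) ?invr_eq0 // -xE -scl_shift // exprMn mulrA mulrAC -coef_scl_shift // -/q.
have qx : q.[x] = x * (q`_1 + q2.[x] * x).
  by rewrite {1}q1E {1}q2E q0 q1c !hornerD !hornerM !hornerX !hornerC hornerD hornerM hornerX hornerC; ring.
have [x0|x0] := eqVneq x 0.
  by rewrite x0; case: l => [|l]; rewrite ?q0 ?mul0r ?dv0 // exprS mul0r mulr0 dv0.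
have hq1 : dv (pi * q`_1) (q2.[x] * x).
  apply: dv_mull; last exact: dv_horner.
  by apply: dv_trans hx; rewrite exprS dvM ?dv_refl.
have [h00 hw] := wDl q10 hq1.
have -> : dv q.[x] (q`_l * x ^+ l) = dv (x * q`_1) (q`_l * x ^+ l).
  by rewrite qx !dvE (wM x0 h00) (wM x0 q10) hw !mulf_eq0 (negPf x0) (negPf q10) (negPf h00).
case: l => [|[|l]]; first by rewrite q0 mul0r dv0.
  by rewrite expr1 mulrC dv_refl.
apply: dv_mull => //; rewrite !exprS; apply: dvM; first exact: dv_refl.
apply: dv_trans qd _; apply: dv_mulr; last by rewrite -(expr1n _ l) dvX.
by apply: dv_trans hx; rewrite dv_pi2.
Qed.

Lemma root_approx eps B H r c : H != 0 -> r != 0 -> dgood eps H r -> H.[r] = 0 ->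
  rve (B.+1 + eps) r c -> rve B.+1 (r - c) (- (H.[c] / H^`().[c])).
Proof.
move=> H0 r0 hd e1 hs; have [m [m0 hi hm hj]] := scl_min H0 r0.
have h1 := dgood_scl m0 hj hd.
have [c0 wc] : c != 0 /\ w r = w c by apply: rve_w hs r0.
have hc : dv 1 (c / r) by rewrite -(dvM2r _ _ r0) divfK // mul1r dv_w // wc lexx.
have e2 : (scl H r m).[1] = 0 by rewrite horner_scl mulr1 e1 mul0r.
have hs' : dv (pi ^+ (B.+1 + eps)) (1 - c / r) by rewrite -ratio_near.
have := hensel_approx hi (dv_refl 1) hc e2 h1 hs'.
rewrite horner_scl deriv_scl (mulrC r (c / r)) divfK // => h.
have := rveM (ltn0Sn B) h (rve_refl _ r); rewrite mulrBl divfK // mul1r.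
congr (rve _ _ _); rewrite mulNr; congr (- _).
have [->|d0] := eqVneq H^`().[c] 0; first by rewrite mulr0 mul0r invr0 !mulr0 mul0r.
by field; rewrite m0 r0 d0.
Qed.

End Scaling.

Lemma size_deriv_le (K : fieldType) (p : {poly K}) d : (size p <= d.+1)%N ->
  (size p^`() <= d)%N.
Proof.
move=> pd; apply/leq_sizeP => j dj; rewrite coef_deriv nth_default ?mul0rn //.
exact: leq_trans pd _.
Qed.

(** * Isolated roots as semialgebraic functions of the coefficients *)

Section RootFunctions.
Variable F : lfield.
Notation E := (nat -> F).
Implicit Types (e : E) (D : E -> Prop) (g h z c : E -> F) (a b r s t x y : F).
Implicit Types (S : E -> F -> Prop) (N M k i j n d eps : nat) (G H : E -> {poly F}).

(* Every point is, for some center c of a finite list, in the region where the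
   expansion of G around c has no cancellation. *)
Definition has_centers d := forall G, fam G -> (forall e, (size (G e) <= d)%N) ->
  exists (cs : seq (E -> F)) eps, (forall c, c \in cs -> sf c) /\
    forall e t, exists2 c, c \in cs & pgood eps (shift (G e) (c e)) (t - c e).

Definition pieces_of (ps : seq ((E -> F) * (E -> F -> Prop))) N (A : E -> F -> Prop) :=
  [/\ (0 < N)%N, forall q, q \in ps -> sf q.1 /\ mono N q.2 &
    forall e t, A e t <-> exists2 q, q \in ps & q.2 e (t - q.1 e)].

Lemma centers_pieces d G N0 (W : F -> Prop) : has_centers d -> fam G ->
  (forall e, (size (G e) <= d)%N) -> (0 < N0)%N ->
  (forall x y, cls N0 x y -> W x -> W y) ->
  exists N ps, pieces_of ps N (fun e t => W (G e).[t]).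
Proof.
move=> hd fG sG N00 hW; have [cs [eps [hcs hc]]] := hd G fG sG.
exists (N0 * (N0 + eps))%N.
exists [seq (c, fun e s => pgood eps (shift (G e) (c e)) s /\ W (shift (G e) (c e)).[s]) | c <- cs].
split=> [|c|e t]; first by rewrite muln_gt0 N00 addn_gt0 N00.
  move=> /mapP[c' c's ->]; have sc := hcs _ c's; split=> //=.
  apply: (@mono_pgood_cls F (fun e => shift (G e) (c' e)) d _ eps N0 W) => //.
  - exact: (fam_shift fG sG sc).
  - by move=> e; rewrite size_shift.
  - by rewrite muln_gt0 N00 addn_gt0 N00.
  - exact: dvdn_mulr.
  - exact: leq_pmull.
split=> [h|[c' /mapP[c ccs ->] /= [_]]]; last by rewrite horner_shift subrK.
have [c ccs hg] := hc e t.
exists (c, fun e s => pgood eps (shift (G e) (c e)) s /\ W (shift (G e) (c e)).[s]).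
  by apply/mapP; exists c.
by rewrite /= horner_shift subrK; split.
Qed.

(* xi is, above D, a root of G that is isolated at the relative precision eps,
   whose valuation and class are controlled by semialgebraic data. *)
Record rootfn D G (xi : E -> F) z k eps : Prop := RootFn {
  rf_D : sa D;
  rf_G : fam G;
  rf_z : sf z;
  rf_k : (0 < k)%N;
  rf_xi0 : forall e, D e -> xi e != 0;
  rf_z0 : forall e, D e -> z e != 0;
  rf_w : forall e, D e -> w (xi e ^+ k) = w (z e);
  rf_root : forall e, D e -> (G e).[xi e] = 0;
  rf_G0 : forall e, D e -> G e != 0;
  rf_good : forall e, D e -> dgood eps (G e) (xi e);
  rf_cls : forall N r, (0 < N)%N -> r != 0 -> sa (fun e => D e /\ cls N r (xi e));
  rf_out : forall e, ~ D e -> xi e = 0 }.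

Lemma rootfn_comp D G xi z k eps phi : rootfn D G xi z k eps -> pmap phi ->
  rootfn (fun e => D (phi e)) (fun e => G (phi e)) (fun e => xi (phi e))
    (fun e => z (phi e)) k eps.
Proof.
move=> h hphi; case: h => h1 h2 h3 h4 h5 h6 h7 h8 h9 h10 h11 h12.
split=> //; try by move=> e; auto.
- exact: sa_comp.
- exact: fam_comp.
- exact: sf_comp.
- by move=> N r N0 r0; apply: (sa_comp (h11 N r N0 r0)).
Qed.

(** [rf_w] settles the thresholds, after raising to the power k, and [rf_cls] settles the
    classes. *)
Lemma sa_rootfn0 D G xi z k eps N S : rootfn D G xi z k eps -> (0 < N)%N -> mono N S ->
  sa (fun e => D e /\ S e (xi e)).
Proof.
move=> h N0; have hD := rf_D h.
elim=> [D' hD'|z2 k2 hz2 k20|M r MN r0|A B _ hA _ hB|A B _ hA _ hB|A _ hA].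
- exact: sa_and.
- apply: sa_ext (sa_and hD (sa_dv (sfX k hz2) (sfX k2 (rf_z h)))) _ => e.
  have key : D e -> dv (z2 e) (xi e ^+ k2) = dv (z2 e ^+ k) (z e ^+ k2).
    move=> de; have s0 := rf_xi0 h de; rewrite -(dvXE _ _ (rf_k h)) -exprM mulnC exprM.
    apply: dv_weq; rewrite ?expf_neq0 ?(rf_z0 h de) //.
    by rewrite [LHS]wX ?expf_neq0 // (rf_w h de) wX // (rf_z0 h de).
  by split=> -[de]; rewrite key.
- by apply: (rf_cls h) => //; exact: dvdn_gt0 MN.
- by apply: sa_ext (sa_or hA hB) _ => e; tauto.
- by apply: sa_ext (sa_and hA hB) _ => e; tauto.
- by apply: sa_ext (sa_and hD (sa_not hA)) _ => e; tauto.
Qed.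

(** The leading term of xi - c is known in every case: that of xi or of -c if one dominates, a
    constant multiple of c if cancellation is bounded, and the Newton correction [eta] if xi is
    close to c. *)
Lemma sa_rootfn D G xi z k eps N d S c : rootfn D G xi z k eps ->
  (forall e, (size (G e) <= d)%N) -> (0 < N)%N -> mono N S -> sf c ->
  sa (fun e => D e /\ S e (xi e - c e)).
Proof.
move=> h sG N0 hS hc; pose N1 := (N + eps)%N; pose B := (N + N1)%N.
have B0 : (0 < B)%N by rewrite addn_gt0 N0.
have N10 : (0 < N1)%N by rewrite addn_gt0 N0.
have N1B : (N1 <= B)%N by rewrite leq_addl.
have [om hom] := split_near F N B0.
have fG := rf_G h.
pose eta e := - ((G e).[c e] / (G e)^`().[c e]).
have heta : sf eta.
  apply/sfN/sf_div; first exact: (sf_horner fG sG).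
  apply: (@sf_horner F _ d) => //; first exact: fam_deriv.
  by move=> e; exact: size_deriv_le (leqW (sG e)).
(* Here xi is about -o c. When -o is close to 1, xi agrees with c to the N + eps digits from which
   [root_approx] delivers N; otherwise fewer than N1 digits or so cancel, a loss that the precision
   [B] of [om] covers. *)
pose g o : E -> F := if rve N1 1 (- o) then eta else fun e => (1 + o) * - c e.
have hg o : sf (g o).
  rewrite /g; case: ifP => _ //; apply: sfM; [exact: sf_const | exact: sfN].
pose Q e s := (dv (pi ^+ N * s) (- c e) /\ S e s) \/
  ((dv (pi ^+ N * - c e) s /\ S e (- c e)) \/
   exists2 o, o \in om & rve B (o * - c e) s /\ S e (g o e)).
have hS' : mono (N * B) S by apply: mono_lift hS; exact: dvdn_mulr.
have NB0 : (0 < N * B)%N by rewrite muln_gt0 N0.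
have hc' : sf (fun e => - c e) by exact: sfN.
have hQ : mono (N * B) Q.
  apply: mono_or; last apply: mono_or; last first.
  - apply: (@mono_bigor F _ om (fun o e s => rve B (o * - c e) s /\ S e (g o e))) => o _.
    apply: mono_and; last by apply: mono_D; exact: sa_mono N0 hS (hg o).
    apply: mono_rve => //; first exact: dvdn_mull.
    by apply: sfM => //; exact: sf_const.
  - apply: mono_and; last by apply: mono_D; exact: sa_mono N0 hS hc'.
    apply: mono_ext (@mono_dv F _ (fun e => pi ^+ N * - c e) (fun _ => 1) 0 1 _ (sf_const _)) _.
      by apply: sfM => //; exact: sf_const.
    by move=> e s; rewrite expr0 expr1 mulr1 mul1r.
  - apply: mono_and hS'.
    apply: mono_ext (@mono_dv F _ (fun e => pi ^+ N) (fun e => - c e) 1 0 (sf_const _) hc') _.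
    by move=> e s; rewrite expr0 expr1 mulr1.
apply: sa_ext (sa_rootfn0 h NB0 hQ) _ => e.
suff key : D e -> Q e (xi e) <-> S e (xi e - c e) by split=> -[de /(key de)].
move=> de; have x0 := rf_xi0 h de.
have h1 : dv (pi ^+ N * xi e) (- c e) -> S e (xi e - c e) <-> S e (xi e).
  move=> hd; have r : rve N (xi e) (xi e - c e) by rewrite /rve opprD addrA subrr add0r dvN.
  by split=> /(mono_sat e N0 hS r).
have h2 : dv (pi ^+ N * - c e) (xi e) -> S e (xi e - c e) <-> S e (- c e).
  move=> hd; have r : rve N (- c e) (xi e - c e) by rewrite /rve opprD addrCA subrr addr0 dvN.
  by split=> /(mono_sat e N0 hS r).
have h3 o : rve B (o * - c e) (xi e) -> S e (xi e - c e) <-> S e (g o e).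
  move=> ho; suff r : rve N (xi e - c e) (g o e) by split=> /(mono_sat e N0 hS r).
  have ho1 : rve N1 (- o * c e) (xi e) by apply: rve_le N1B _; rewrite mulNr -mulrN.
  have oc0 : - o * c e != 0.
    by apply: contraNneq x0 => oc; apply/eqP; rewrite oc in ho1; exact: rve0l ho1.
  have c0 : c e != 0 by move: oc0; rewrite mulf_eq0 negb_or => /andP[].
  rewrite /g; case: ifP => hoN.
    have hr : rve N1 (xi e) (c e).
      apply: (rve_trans N10 (rve_sym N10 ho1)).
      by have := rve_sym N10 (rveM N10 hoN (rve_refl N1 (c e))); rewrite mul1r.
    rewrite /eta; move: hr; rewrite /N1; case: (N) N0 => // N' _ hr.
    exact: (root_approx (rf_G0 h de) x0 (rf_good h de) (rf_root h de) hr).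
  apply: (split_rve (N1 := N1) ho) => //.
  have /orP[//|hx] := dv_total (xi e - c e) (pi ^+ N1 * xi e).
  have hx' : rve N1 (- o * c e) (1 * c e).
    rewrite mul1r; exact: (rve_trans N10 ho1 hx).
  by move: hx'; rewrite ![_ * c e]mulrC rveM2l // => /(rve_sym N10); rewrite hoN.
split=> [[[/h1 i1 /i1]|[[/h2 i1 /i1]|[o _ [/h3 i1 /i1]]]]|hse] //.
have [hh|hh|[o oo hh]] := hom (xi e) (- c e); [left|right; left|right; right].
- by split=> //; apply/(h1 hh).
- by split=> //; apply/(h2 hh).
- by exists o => //; split=> //; apply/(h3 _ hh).
Qed.

Lemma fam_take G n : fam G -> fam (fun e => take_poly n (G e)).
Proof.
move=> hG i; have [i_n|n_i] := ltnP i n.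
  by move: (hG i); congr sf; apply: funext => e; rewrite coef_take_poly i_n.
by have := sf_const (0 : F); congr sf; apply: funext => e; rewrite coef_take_poly ltnNge n_i.
Qed.

Lemma fam_reduce (f R : E -> {poly F}) d (D : nat) : fam f -> (forall e, (size (f e) <= d.+1)%N) ->
  fam R -> (forall e, (size (R e) <= D)%N) ->
  exists R', [/\ fam R', forall e, (size (R' e) <= d)%N &
    forall e t, (f e)`_d != 0 -> (f e).[t] = 0 -> (R' e).[t] = (R e).[t]].
Proof.
move=> hf sf_; elim: D R => [|D IH] R hR sR.
  by exists R; split=> // e; apply: leq_trans (sR e) _.
have [Dd|dD] := ltnP D d; first by exists R; split=> // e; apply: leq_trans (sR e) _.
pose q e : {poly F} := ((R e)`_D / (f e)`_d)%:P * 'X^(D - d).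
(* Truncation enforces the size bound for every [e], even where the leading coefficient of [f e]
   vanishes and the top terms do not cancel. *)
pose R1 e := take_poly D (R e - q e * f e).
have hR1 : fam R1.
  apply: fam_take; apply: fam_D => //.
  have -> : (fun e => - (q e * f e)) = (fun e => (- ((R e)`_D / (f e)`_d))%:P * 'X^(D - d) * f e).
    by apply: funext => e; rewrite /q polyCN !mulNr.
  apply: fam_M => //; apply: fam_M; last exact: fam_const.
  by apply/fam_C/sfN/sf_div.
have [|R' [h1 h2 h3]] := IH R1 hR1; first by move=> e; exact: size_take_poly.
exists R'; split=> // e t fd ft; rewrite h3 //.
have sz : (size (R e - q e * f e)%R <= D)%N.
  apply/leq_sizeP => j; rewrite leq_eqVlt => /orP[/eqP <-|Dj]; rewrite coefB /q -mulrA coefCM coefXnM.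
    by rewrite ltnNge leq_subr /= subKn // divfK // subrr.
  have -> : (j < D - d)%N = false by apply/negbTE; rewrite -leqNgt (leq_trans (leq_subr _ _)) // ltnW.
  rewrite (nth_default _ (leq_trans (sR e) Dj)) [(f e)`_(_ - _)]nth_default ?mulr0 ?subrr //.
  by apply: leq_trans (sf_ e) _; move: Dj dD; clear; lia.
by rewrite /R1 take_poly_id // hornerD hornerN hornerM ft mulr0 subr0.
Qed.

(** The value of p at xi is unchanged when p is reduced modulo G to degree less than d. There
    centers exist by hypothesis, so the condition becomes a finite union of monomial conditions on
    xi minus a center, which [sa_rootfn] handles. Outside D the value of xi is 0. *)
Theorem sf_rootfn D G xi z k eps d : has_centers d -> rootfn D G xi z k eps ->
  (forall e, (size (G e) <= d.+1)%N) -> (forall e, D e -> (G e)`_d != 0) -> sf xi.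
Proof.
move=> hd h sG lG S; elim=> [n p n0 hp|||]; [|by move=> *; exact: sa_or|by move=> *; exact: sa_and
  |by move=> *; exact: sa_not].
have [dp [P [fP sP hP]]] := pf_fam hp.
have hev : pmap (@ev F) by pmaps.
have hod : pmap (@od F) by pmaps.
have [R [fR sR hR]] := fam_reduce (fam_comp (rf_G h) hev) (fun e => sG (ev e))
  (fam_comp fP hod) (fun e => sP (od e)).
have [N0 [N00 _ hW]] := powers_cls F n0.
have [N [ps [N1 hps hpse]]] := centers_pieces hd fR sR N00 hW.
have h' := rootfn_comp h hev.
have h1 : sa (fun e => exists2 q, q \in ps & D (ev e) /\ q.2 e (xi (ev e) - q.1 e)).
  apply: sa_bigor => c cc; have [h2 h3] := hps _ cc.
  exact: (sa_rootfn h' (fun e => sG (ev e)) N1 h3 h2).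
have h2 : sf (fun e => (P (od e)).[0]).
  apply: (@sf_horner F _ dp) => //; [exact: fam_comp | exact: sf_const].
apply: sa_ext (sa_or h1 (sa_and (sa_not (rf_D h')) (sa_powers_sf n0 h2))) _ => e.
have [de|nde] := pselect (D (ev e)).
  have he : p (scons (xi (ev e)) (od e)) = (R e).[xi (ev e)].
    by rewrite hP hR //; [exact: lG | exact: (rf_root h)].
  rewrite he hpse; split=> [[[c cc [_ hcc]]|[]//]|[c cc hcc]]; first by exists c.
  by left; exists c.
rewrite hP (rf_out h nde); split=> [[[c _ []]|[]]//|hh]; by right.
Qed.

End RootFunctions.

(** * Existence of centers, by induction on the degree *)

Section Centers.
Variable F : lfield.
Notation E := (nat -> F).
Implicit Types (e : E) (D : E -> Prop) (g h z c : E -> F) (a b r s t x y : F).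
Implicit Types (S : E -> F -> Prop) (N M k i j n d eps K V : nat) (G : E -> {poly F}).

Lemma nat_bound d : exists V, forall l, (0 < l)%N -> (l <= d)%N -> dv (l%:R : F) (pi ^+ V).
Proof.
elim: d => [|d [V hV]]; first by exists 0%N => l; lia.
have [v hv] := nat_val F (ltn0Sn d).
exists (V + v)%N => l l0; rewrite leq_eqVlt => /orP[/eqP->|ld].
  by rewrite dv_w ?pin0 ?char0 // hv w_pin lez_nat leq_addl.
by apply: dv_trans (hV l l0 ld) _; rewrite dv_pi2 leq_addr.
Qed.

(** If the least valuation were attained only once, that term would dominate the sum of the others
    and give the valuation of the whole. *)
Lemma two_min d (m : nat -> F) j0 : (j0 < d)%N -> (forall j, (j < d)%N -> dv (m j0) (m j)) ->
  m j0 != 0 -> ~~ dv (ssum d m) (m j0) ->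
  exists i, [/\ (i < d)%N, i != j0, m i != 0 & w (m i) = w (m j0)].
Proof.
move=> jd hj m0 hn; apply: contrapT => no; case/negP: hn.
have h : dv (pi * m j0) (\sum_(i < d | i != Ordinal jd) m i).
  apply: dv_sum => i ij; rewrite sdv //; apply/negP=> hi; apply: no.
  have mi0 : m i != 0 by apply: contraTneq hi => ->; rewrite dv0l.
  exists (nat_of_ord i); split=> //.
  by apply/eqP; rewrite eq_le -!dv_w // hi hj.
rewrite /ssum (bigD1 (Ordinal jd)) //=.
by have [h0 hw] := wDl m0 h; rewrite dv_w // hw lexx.
Qed.

Lemma rve_term N (H : {poly F}) s s' l : (0 < N)%N -> rve N s s' ->
  rve N (H`_l * s ^+ l) (H`_l * s' ^+ l).
Proof. by move=> N0 h; apply: rveM => //; [exact: rve_refl | exact: rveX]. Qed.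

(* Conditions on s guaranteeing a root of H in the class of s: the terms of index i
   and j are both least, H' does not cancel at s and H cancels by more than K. *)
Definition nearroot d N K eps i j r (H : {poly F}) s :=
  (cls N r s /\ (forall l, l \in iota 0 d.+1 -> dv (H`_i * s ^+ i) (H`_l * s ^+ l))) /\
  (pgood eps H^`() s /\ ~ pgood K H s).

(** The terms of index i and j have equal valuation: v(s) is read off from a chord of the Newton
    polygon, hence from the coefficients. *)
Definition onball i j (H : {poly F}) s :=
  [/\ H`_i / H`_j != 0, s != 0 & w (s ^+ (j - i)) = w (H`_i / H`_j)].

Lemma pgood_le eps eps' (H : {poly F}) s : (eps <= eps')%N -> pgood eps H s -> pgood eps' H s.
Proof.
by move=> h hg l; apply: dv_trans (hg l) _; rewrite dvM ?dv_refl // dv_pi2.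
Qed.

(** The terms of s H'(s) are l H_l s^l, so comparing them with the terms of H costs at most V, the
    bound on the valuations of the integers l. *)
Lemma nearroot_dgood d N K eps V i j r (H : {poly F}) s :
  (forall l, (0 < l)%N -> (l <= d)%N -> dv (l%:R : F) (pi ^+ V)) ->
  (size H <= d.+1)%N -> (i < j)%N -> (j <= d)%N ->
  onball i j H s -> nearroot d N K eps i j r H s -> dgood (eps + V) H s.
Proof.
move=> hV sH ij jd [z0 s0 hw] [[_ hm] [hg _]].
have pos l : (0 < l)%N -> dv (s * H^`().[s]) (pi ^+ (eps + V) * (H`_l * s ^+ l)).
  case: l => // l _; have [ld|dl] := leqP l.+1 d; last first.
    by rewrite (nth_default _ (leq_trans sH dl)) mul0r mulr0 dv0.
  apply: (@dv_trans _ (pi ^+ eps * (l.+1%:R * (H`_l.+1 * s ^+ l.+1)))).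
    have := dvM (dv_refl s) (hg l); rewrite coef_deriv -mulr_natl.
    by congr dv; rewrite exprS; ring.
  by rewrite exprD -mulrA dvM ?dv_refl // dvM ?dv_refl // hV.
case=> [|l]; last exact: pos.
have [Hi0 Hj0] : H`_i != 0 /\ H`_j != 0.
  by move: z0; rewrite mulf_eq0 invr_eq0 negb_or => /andP[].
(* The constant term is invisible to H', but the term of index j > i is also a least one, so a bound
   against it is a bound against the constant term. *)
apply: dv_trans (pos j _) _; first by move: ij; clear; lia.
rewrite dvM ?dv_refl //; apply: (@dv_trans _ (H`_i * s ^+ i)); last first.
  by apply: hm; rewrite mem_iota.
rewrite dv_w ?mulf_neq0 ?expf_neq0 // !wM ?expf_neq0 // !wX //.
move: hw; rewrite wM ?invr_eq0 // wV // wX //.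
by move: (w s) (w _) (w _) ij; clear => u v v'; nia.
Qed.

Lemma mono_nearroot d N K eps i j r G : fam G -> (forall e, (size (G e) <= d.+1)%N) ->
  (0 < N)%N -> r != 0 ->
  mono (N * (K.+1 * eps.+1)) (fun e s => nearroot d N K eps i j r (G e) s).
Proof.
move=> fG sG N0 r0; apply: mono_and; apply: mono_and.
- by apply: mono_C => //; exact: dvdn_mulr.
- apply: (@mono_bigand F _ (iota 0 d.+1) (fun l e s => dv ((G e)`_i * s ^+ i) ((G e)`_l * s ^+ l))).
  by move=> l _; apply: (@mono_dv F _ (fun e => (G e)`_i) (fun e => (G e)`_l)).
- apply: (@mono_lift F eps.+1); first by rewrite mulnCA dvdn_mull // dvdn_mull.
  apply: (@mono_pgood F _ d.+1) => //; first exact: fam_deriv.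
  by move=> e; exact/size_deriv_le/leqW.
- apply: mono_not; apply: (@mono_lift F K.+1); first by rewrite mulnCA dvdn_mulr.
  exact: (@mono_pgood F _ d.+1).
Qed.

Lemma sa_nearroot d N K eps i j r G N1 r1 : fam G -> (forall e, (size (G e) <= d.+1)%N) ->
  (0 < N)%N -> r != 0 -> (i < j)%N -> (0 < N1)%N -> r1 != 0 ->
  sa (fun e => exists s, [/\ onball i j (G e) s, nearroot d N K eps i j r (G e) s & cls N1 r1 s]).
Proof.
move=> fG sG N0 r0 ij N10 r10.
have hm : mono (N1 * (N * (K.+1 * eps.+1)))
    (fun e s => nearroot d N K eps i j r (G e) s /\ cls N1 r1 s).
  apply: mono_and; last by apply: mono_C => //; exact: dvdn_mulr.
  by apply: mono_lift (mono_nearroot _ _ _ _ fG sG N0 r0); exact: dvdn_mull.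
have hk : (0 < j - i)%N by rewrite subn_gt0.
have hN : (0 < N1 * (N * (K.+1 * eps.+1)))%N by rewrite !muln_gt0 N10 N0.
apply: sa_ext (sa_exists_w hN hk (sf_div (fG i) (fG j)) hm) _ => e.
split=> [[z0 [s [s0 hw [h1 h2]]]]|[s [[z0 s0 hw] h1 h2]]]; first by exists s.
by split=> //; exists s.
Qed.

Lemma shift_lead (p : {poly F}) x d : (size p <= d.+1)%N -> p`_d != 0 -> (shift p x)`_d != 0.
Proof.
move=> sp pd; have sz : size p = d.+1.
  by apply/eqP; rewrite eqn_leq sp ltnNge; apply: contra pd => h; rewrite nth_default.
have -> : d = (size (shift p x)).-1 by rewrite size_shift sz.
by rewrite -lead_coefE lead_coef_eq0 -size_poly_gt0 size_shift sz.
Qed.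

(** For each parameter all admissible s have the same leading term, so Hensel's lemma gives a single
    root, chosen as xi. The work is to show that the class of xi at every level is semialgebraic. *)
Lemma nearroot_fn d eps1 V i j r G : has_centers F d ->
  (forall l, (0 < l)%N -> (l <= d)%N -> dv (l%:R : F) (pi ^+ V)) ->
  fam G -> (forall e, (size (G e) <= d.+1)%N) -> r != 0 -> (i < j)%N -> (j <= d)%N ->
  let e0 := (eps1 + V)%N in
  exists xi, sf xi /\ forall e s, (G e)`_d != 0 -> onball i j (G e) s ->
    nearroot d e0.+1 (e0 + e0) eps1 i j r (G e) s ->
    [/\ (G e).[xi e] = 0, xi e != 0, dgood e0 (G e) (xi e) & rve e0.+1 (xi e) s].
Proof.
move=> hd hV fG sG r0 ij jd e0.
(* [T M] asks for M more digits of cancellation, which puts s M digits closer to the root. [T 0]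
   defines the domain; larger M serve to measure the class of xi. *)
pose T M e s := onball i j (G e) s /\ nearroot d e0.+1 (e0 + e0 + M) eps1 i j r (G e) s.
pose D e := (G e)`_d != 0 /\ exists s, T 0%N e s.
have G0 e : (G e)`_d != 0 -> G e != 0 by apply: contraNneq => ->; rewrite coef0.
have Tgood M e s : T M e s -> dgood e0 (G e) s.
  by move=> [h1 h2]; apply: (nearroot_dgood hV (sG e) ij jd h1 h2).
have Troot M e s : (G e)`_d != 0 -> T M e s ->
    exists2 x, (G e).[x] = 0 & rve (e0 + M).+1 s x.
  move=> gd hT; have hg := Tgood _ _ _ hT; case: hT => -[_ s0 _] [_ [_ hn]].
  exact: (root_exists (G0 _ gd) s0 hg hn).
have Tnear M M' e s s' : T M e s -> T M' e s' -> rve e0.+1 s s'.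
  move=> [[_ s0 hw] [[hc _] _]] [[_ s0' hw'] [[hc' _] _]].
  apply/(rve_cls _ (ltn0Sn _) s0); split; last by apply: cls_trans hc'; rewrite cls_sym.
  move: hw; rewrite -hw' !wX //; move: ij; clear => ij; nia.
have /choice [xi hxi] : forall e, exists x,
    (D e -> (G e).[x] = 0 /\ exists2 s, T 0%N e s & rve e0.+1 s x) /\ (~ D e -> x = 0).
  move=> e; have [de|nde] := pselect (D e); last by exists 0.
  have [gd [s hs]] := de; have [x hx1 hx2] := Troot _ _ _ gd hs.
  by exists x; split=> // _; split=> //; exists s; rewrite ?addn0 in hx2 *.
have xi0 e : D e -> xi e != 0.
  move=> de; have [_ [s hT hr]] := (hxi e).1 de; case: hT => -[_ s0 _] _.
  by have [] := rve_w (ltn0Sn _) hr s0.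
have xigood e : D e -> dgood e0 (G e) (xi e).
  move=> de; have [_ [s hT hr]] := (hxi e).1 de.
  have s0 : s != 0 by case: hT => -[].
  exact: (dgood_near (G0 _ de.1) s0 (Tgood _ _ _ hT) hr).
have xiuniq M e s x : D e -> T M e s -> rve e0.+1 s x -> (G e).[x] = 0 -> x = xi e.
  move=> de hT hr hx; have [hxi1 [s' hT' hr']] := (hxi e).1 de.
  have hxx : rve e0.+1 (xi e) x.
    apply: (rve_trans (ltn0Sn _) (rve_sym (ltn0Sn _) hr')).
    exact: (rve_trans (ltn0Sn _) (Tnear _ _ _ _ _ hT' hT) hr).
  by apply/esym; exact: (root_unique (G0 _ de.1) (xi0 _ de) (xigood _ de) hxx hxi1 hx).
have xiT M e : D e -> T M e (xi e).
  move=> de; have [hx [s hT hr]] := (hxi e).1 de.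
  have [[z0 s0 hw] [[hc hm] [hg _]]] := hT.
  have [x0 wx] := rve_w (ltn0Sn _) hr s0.
  have hcx : cls e0.+1 s (xi e) by case/(rve_cls _ (ltn0Sn _) s0): hr.
  split; first by split=> //; rewrite -hw !wX // wx.
  split; split.
  - exact: cls_trans hc hcx.
  - move=> l hl; rewrite -(dv_rve (ltn0Sn _) (rve_term (G e) i (ltn0Sn _) hr) (rve_term (G e) l (ltn0Sn _) hr)).
    exact: hm.
  - have hr1 : rve eps1.+1 s (xi e) by apply: rve_le hr; rewrite ltnS leq_addr.
    have hmono : mono eps1.+1 (fun e s => pgood eps1 (G e)^`() s).
      apply: (@mono_pgood F _ d.+1) => //; first exact: fam_deriv.
      by move=> e'; exact/size_deriv_le/leqW.
    by apply/(mono_sat e (ltn0Sn _) hmono hr1).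
  - move=> /(_ i); rewrite hx dv0l mulf_eq0 (negPf (pin0 _ _)) mulf_eq0 expf_eq0 (negPf x0) andbF orbF.
    by move: z0; rewrite mulf_eq0 negb_or => /andP[/negPf ->].
have saG M N1 r1 : (0 < N1)%N -> r1 != 0 -> sa (fun e => (G e)`_d != 0 /\ exists s, T M e s /\ cls N1 r1 s).
  move=> N10 r10; apply: sa_and; first exact: sa_neq0.
  apply: sa_ext (sa_nearroot (e0 + e0 + M) eps1 fG sG (ltn0Sn e0) r0 ij N10 r10) _ => e.
  by split=> [[s [h1 h2 h3]]|[s [[h1 h2] h3]]]; exists s.
have saD : sa D.
  have [rs [_ rs0 _ hrs]] := finite_cls F (isT : (0 < 1)%N).
  have h r1 : r1 \in rs -> sa (fun e => (G e)`_d != 0 /\ exists s, T 0%N e s /\ cls 1 r1 s).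
    by move=> /rs0[]; move=> r10 _; exact: saG.
  apply: sa_ext (sa_bigor h) _ => e.
  split=> [[r1 _ [gd [s [hs _]]]]|[gd [s hs]]]; first by split=> //; exists s.
  have s0 : s != 0 by case: hs => -[].
  by have [r1 h1 h2] := hrs _ s0; exists r1 => //; split=> //; exists s.
have rf : rootfn D G xi (fun e => (G e)`_i / (G e)`_j) (j - i) e0.
  split=> //.
  - exact: sf_div.
  - by rewrite subn_gt0.
  - by move=> e de; case: (xiT 0%N e de) => -[].
  - by move=> e de; case: (xiT 0%N e de) => -[].
  - by move=> e de; case: ((hxi e).1 de).
  - by move=> e [gd _]; exact: G0.
  (* At level N1 the class of xi is that of any s with N1 extra digits of cancellation, and xi
     itself is such an s, since the polynomial vanishes there. *)
  - move=> N1 r1 N10 r10; apply: sa_ext (sa_and saD (saG N1 N1 r1 N10 r10)) _ => e.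
    split=> [[de [gd [s [hT hs]]]]|[de hc]]; last first.
      split=> //; split; first by case: de.
      by exists (xi e); split=> //; exact: xiT.
    split=> //; have [x hx hr] := Troot _ _ _ gd hT.
    have s0 : s != 0 by case/and4P: hs.
    have hr0 : rve e0.+1 s x by apply: rve_le hr; rewrite ltnS leq_addr.
    rewrite -(xiuniq _ _ _ _ de hT hr0 hx); apply: cls_trans hs _.
    have hr1 : rve N1 s x by apply: rve_le hr; rewrite (leq_trans (leq_addl e0 N1)).
    by case/(rve_cls _ N10 s0): hr1.
  - by move=> e nde; apply: (hxi e).2.
exists xi; split.
  by apply: (sf_rootfn hd rf) => // e [].
move=> e s gd hb hn; have hT : T 0%N e s by split=> //; rewrite addn0.
have de : D e by split=> //; exists s.
have [hx [s' hT' hr]] := (hxi e).1 de.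
split=> //; [exact: xi0 | exact: xigood |].
apply: (rve_trans (ltn0Sn _) (rve_sym (ltn0Sn _) hr)).
exact: (Tnear _ _ _ _ _ hT' hT).
Qed.

(** At a center c of the derivative, either the expansion of G has bounded cancellation, or two of
    its terms are least; in the latter case Hensel's lemma gives a root c + xi so close to t that
    the expansion around it does not cancel at all. *)
Lemma has_centersS d : has_centers F d -> has_centers F d.+1.
Proof.
move=> hd G fG sG.
have sG' e : (size (G e)^`() <= d)%N by exact: size_deriv_le.
have [cs1 [eps1 [hcs1 hc1]]] := hd _ (fam_deriv fG) sG'.
(* These centers serve the parameters where the coefficient of degree d vanishes: there G equals its
   truncation. *)
have [cs2 [eps2 [hcs2 hc2]]] := hd _ (fam_take d fG) (fun e => size_take_poly d (G e)).
have [V hV] := nat_bound d.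
set e0 := (eps1 + V)%N.
have [rs [_ rs0 _ hrs]] := finite_cls F (ltn0Sn e0).
have fH c : c \in cs1 -> fam (fun e => shift (G e) (c e)).
  by move=> cc; exact: (fam_shift fG sG (hcs1 _ cc)).
have sH c e : (size (shift (G e) (c e)) <= d.+1)%N by rewrite size_shift.
have /choice [xi hxi] : forall q : (E -> F) * (nat * nat * F), exists xi : E -> F,
    let: (c, (i, j, r)) := q in
    c \in cs1 -> r \in rs -> (i < j)%N -> (j <= d)%N ->
    sf xi /\ forall e s, (shift (G e) (c e))`_d != 0 -> onball i j (shift (G e) (c e)) s ->
    nearroot d e0.+1 (e0 + e0) eps1 i j r (shift (G e) (c e)) s ->
    [/\ (shift (G e) (c e)).[xi e] = 0, xi e != 0, dgood e0 (shift (G e) (c e)) (xi e) &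
      rve e0.+1 (xi e) s].
  move=> [c [[i j] r]].
  have [h|h] := pselect [/\ c \in cs1, r \in rs, (i < j)%N & (j <= d)%N]; last first.
    by exists c => h1 h2 h3 h4; case: h.
  have [cc rr ij jd] := h; have [r0 _] := rs0 _ rr.
  have [x hx] := nearroot_fn eps1 hd hV (fH _ cc) (sH c) r0 ij jd.
  by exists x.
have [L hL] : exists L : seq nat, forall i, (i \in L) = (i <= d)%N.
  by exists (iota 0 d.+1) => i; rewrite mem_iota.
pose ijr : seq (nat * nat * F) := [seq u <- [seq (ij, r) |
   ij <- [seq (i, j) | i <- L, j <- L], r <- rs] | (u.1.1 < u.1.2)%N].
have ijrP u : u \in ijr -> [/\ u.2 \in rs, (u.1.1 < u.1.2)%N & (u.1.2 <= d)%N].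
  rewrite mem_filter => /andP[h1 /allpairsP[[ij r] /= [h2 rr hx]]].
  have /allpairsP[[i j] /= [_ jd hij]] := h2.
  move: h1; rewrite hx hij /= => h1; split=> //.
  by move: jd; rewrite hL.
pose qs : seq ((E -> F) * (nat * nat * F)) := [seq (c, u) | c <- cs1, u <- ijr].
exists (cs1 ++ cs2 ++ [seq (fun e => q.1 e + xi q e) | q : (E -> F) * (nat * nat * F) <- qs]), (e0 + e0 + eps2)%N; split.
  move=> c; rewrite !mem_cat => /or3P[/hcs1//|/hcs2//|/mapP[q qq ->]].
  have /allpairsP[[c' [[i j] r]] /= [h1 /ijrP[/= h2 h3 h4] ->]] := qq.
  have [sx _] := hxi (c', (i, j, r)) h1 h2 h3 h4.
  by apply: sfD => //; exact: hcs1.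
move=> e t; have [gd0|gd] := eqVneq (G e)`_d 0.
  have [c cc hg] := hc2 e t.
  exists c; first by rewrite !mem_cat cc orbT.
  have -> : G e = take_poly d (G e).
    apply/polyP => i; rewrite coef_take_poly; have [//|] := ltnP i d.
    rewrite leq_eqVlt => /orP[/eqP <- //|di]; by rewrite nth_default // (leq_trans (sG e)).
  by apply: pgood_le hg; exact: leq_addl.
have [c cc hg] := hc1 e t; rewrite -shift_deriv in hg.
have [hK|hK] := pselect (pgood (e0 + e0) (shift (G e) (c e)) (t - c e)).
  exists c; first by rewrite mem_cat cc.
  by apply: pgood_le hK; exact: leq_addr.
set H := shift (G e) (c e) in hg hK; set s := t - c e in hg hK.
have Hd : H`_d != 0 by exact: shift_lead.
have H0 : H != 0 by apply: contraNneq Hd => ->; rewrite coef0.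
have s0 : s != 0.
  apply: contra_notN hK => /eqP ->; case=> [|l]; last by rewrite expr0n !mulr0 dv0.
  by rewrite expr0 mulr1 horner_coef0 dv_pile.
have [j0 j0d hj] := min_term (fun j => H`_j * s ^+ j) (ltn0Sn d).
have hj' l : dv (H`_j0 * s ^+ j0) (H`_l * s ^+ l).
  have [/hj//|dl] := ltnP l d.+1; by rewrite (nth_default _ (leq_trans (sH c e) dl)) mul0r dv0.
have m0 : H`_j0 * s ^+ j0 != 0.
  apply: contraTneq (hj' d) => ->; by rewrite dv0l mulf_neq0 ?expf_neq0.
have hn : ~~ dv (ssum d.+1 (fun j => H`_j * s ^+ j)) (H`_j0 * s ^+ j0).
  apply: contra_notN hK => hh; apply/(pgoodE _ _ (sH c e)).
  apply/(good_min _ j0d hj); apply: dv_trans hh _; exact: dv_pile.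
have [i0 [i0d ni mi0 wi]] := two_min j0d hj m0 hn.
have hi' l : dv (H`_i0 * s ^+ i0) (H`_l * s ^+ l).
  by apply: dv_trans (hj' l); rewrite dv_w // wi lexx.
have [i [j [[ij jd hmi] [mmi mmj wij]]]] : exists i j, [/\ (i < j)%N, (j <= d)%N &
    (forall l, dv (H`_i * s ^+ i) (H`_l * s ^+ l))] /\ [/\ H`_i * s ^+ i != 0,
    H`_j * s ^+ j != 0 & w (H`_i * s ^+ i) = w (H`_j * s ^+ j)].
  have [h|h|h] := ltngtP i0 j0; last by rewrite h eqxx in ni.
    by exists i0, j0; split.
  by exists j0, i0; split.
have [r rr hr] := hrs _ s0.
have qq : (c, (i, j, r)) \in qs.
  apply: allpairs_f => //; rewrite mem_filter /= ij /=; apply: allpairs_f => //.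
  by apply: allpairs_f; rewrite hL // ltnW // (leq_trans ij).
have hb : onball i j H s.
  have [Hi0 Hj0] : H`_i != 0 /\ H`_j != 0.
    by move: mmi mmj; rewrite !mulf_eq0 !negb_or => /andP[? _] /andP[? _].
  split; rewrite ?mulf_neq0 ?invr_eq0 //.
  move: wij; rewrite !wM ?invr_eq0 ?expf_neq0 // !wX // wV //.
  move: (w s) (w H`_i) (w H`_j) ij; clear => u v v'; nia.
have hnr : nearroot d e0.+1 (e0 + e0) eps1 i j r H s by split; split.
have := hxi (c, (i, j, r)) cc rr ij jd => -[_ /(_ e s Hd hb hnr)].
set x := xi _ e; move=> [hx x0 hxg hxs].
exists (fun e => c e + xi (c, (i, j, r)) e).
  rewrite !mem_cat; apply/orP; right; apply/orP; right.
  by apply/mapP; exists (c, (i, j, r)).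
rewrite /= shift_shift -/x opprD addrA -/s -/H.
apply: (pgood_le (leq0n _)); exact: (root_good H0 x0 hxg hx hxs).
Qed.

Theorem centers d : has_centers F d.
Proof.
elim: d => [|d IH]; last exact: has_centersS.
move=> G fG sG; exists [:: fun _ => 0], 0%N; split=> [c|e t].
  by rewrite inE => /eqP ->; exact: sf_const.
exists (fun _ => 0); first by rewrite inE.
have := sG e; rewrite leqn0 size_poly_eq0 => /eqP -> l.
by rewrite /shift comp_poly0 coef0 mul0r mulr0 dv0.
Qed.

End Centers.

(** * Disjoint monomial pieces, and quantifier elimination *)

Section NormalForm.
Variable F : lfield.
Notation E := (nat -> F).
Implicit Types (e : E) (D : E -> Prop) (g h z c : E -> F) (a b r s t x y : F).
Implicit Types (S A : E -> F -> Prop) (N M k i j n d eps : nat).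

Inductive bmono (cs : seq (E -> F)) : (E -> F -> Prop) -> Prop :=
| bmono_D D : sa D -> bmono cs (fun e _ => D e)
| bmono_at c N S : c \in cs -> (0 < N)%N -> mono N S -> bmono cs (fun e t => S e (t - c e))
| bmono_or S A : bmono cs S -> bmono cs A -> bmono cs (fun e t => S e t \/ A e t)
| bmono_and S A : bmono cs S -> bmono cs A -> bmono cs (fun e t => S e t /\ A e t)
| bmono_not S : bmono cs S -> bmono cs (fun e t => ~ S e t).

Lemma bmono_ext cs S A : bmono cs S -> (forall e t, S e t <-> A e t) -> bmono cs A.
Proof.
move=> h eq; rewrite (_ : A = S) //; apply: funext => e; apply: funext => s.
by apply: propext; rewrite eq.
Qed.

Lemma bmono_sub cs cs' S : {subset cs <= cs'} -> bmono cs S -> bmono cs' S.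
Proof.
move=> h; elim=> [D|c N B cc N0 hB|A B _ ? _ ?|A B _ ? _ ?|A _ ?];
 [exact: bmono_D|apply: bmono_at hB => //; exact: h|exact: bmono_or|exact: bmono_and|exact: bmono_not].
Qed.

Lemma sa_bmono (S : E -> Prop) : sa S -> exists cs, (forall c, c \in cs -> sf c) /\
  bmono cs (fun e t => S (scons t e)).
Proof.
elim=> [n p n0 hp|A B _ [c1 [h1 b1]] _ [c2 [h2 b2]]|A B _ [c1 [h1 b1]] _ [c2 [h2 b2]]
  |A _ [c1 [h1 b1]]].
- have [d [G [fG sG hG]]] := pf_fam hp.
  have [N0 [N00 _ hW]] := powers_cls F n0.
  have [N [ps [N1 hps hpse]]] := centers_pieces (@centers F d) fG sG N00 hW.
  exists [seq q.1 | q <- ps]; split=> [c /mapP[q qq ->]|]; first by case: (hps _ qq).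
  apply: (@bmono_ext _ (fun e t => exists2 q, q \in ps & q.2 e (t - q.1 e))); last first.
    by move=> e t; rewrite hG hpse.
  have {hpse} : forall qs : seq ((E -> F) * (E -> F -> Prop)), {subset qs <= ps} ->
      bmono [seq q.1 | q <- ps] (fun e t => exists2 q, q \in qs & q.2 e (t - q.1 e)).
    elim=> [|q qs IH] hq.
      by apply: bmono_ext (bmono_D _ (sa_const F False)) _ => e t; split=> // -[].
    have qq : q \in ps by apply: hq; rewrite inE eqxx.
    have hqs : {subset qs <= ps} by move=> q' h; apply: hq; rewrite inE h orbT.
    have IH' := IH hqs.
    have hat : bmono [seq q.1 | q <- ps] (fun e t => q.2 e (t - q.1 e)).
      by apply: (bmono_at _ N1 (hps _ qq).2); exact: map_f.
    apply: bmono_ext (bmono_or hat IH') _ => e t; split=> [[h|[q' q1 h]]|[q']].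
    + by exists q; rewrite ?inE ?eqxx.
    + by exists q'; rewrite ?inE ?q1 ?orbT.
    + by rewrite inE => /orP[/eqP->|q1] h; [left|right; exists q'].
  exact.
- exists (c1 ++ c2); split=> [c|]; first by rewrite mem_cat => /orP[/h1|/h2].
  by apply: bmono_or; [apply: bmono_sub b1 | apply: bmono_sub b2] => c cc; rewrite mem_cat cc ?orbT.
- exists (c1 ++ c2); split=> [c|]; first by rewrite mem_cat => /orP[/h1|/h2].
  by apply: bmono_and; [apply: bmono_sub b1 | apply: bmono_sub b2] => c cc; rewrite mem_cat cc ?orbT.
- by exists c1; split=> //; exact: bmono_not.
Qed.

Definition nearest (cs : seq (E -> F)) c e t := forall c', c' \in cs -> dv (t - c' e) (t - c e).

(** When c is nearest to t, the sum (t - c) + (c - c') has valuation at most that of t - c, so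
    [mono_plus] turns a condition at c' into one at c. *)
Lemma bmono_nearest cs c S : (forall c, c \in cs -> sf c) -> c \in cs -> bmono cs S ->
  exists N S', [/\ (0 < N)%N, mono N S' &
    forall e t, nearest cs c e t -> S e t <-> S' e (t - c e)].
Proof.
move=> hcs cc; elim=> [D hD|c' N B cc' N0 hB|A B _ [N1 [A' [n1 a1 e1]]] _ [N2 [B' [n2 b2 e2]]]
   |A B _ [N1 [A' [n1 a1 e1]]] _ [N2 [B' [n2 b2 e2]]]|A _ [N1 [A' [n1 a1 e1]]]].
- by exists 1%N, (fun e _ => D e); split=> //; exact: mono_D.
- have hdl : sf (fun e => c e - c' e) by apply: sfB; exact: hcs.
  have [N' [B' [N'0 hB' hB'e]]] := mono_plus N0 hB hdl.
  exists N', B'; split=> // e t hn; rewrite -hB'e; first by rewrite addrA subrK.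
  by rewrite addrA subrK; exact: hn.
- exists (N1 * N2)%N, (fun e s => A' e s \/ B' e s); split=> [||e t hn].
  + by rewrite muln_gt0 n1.
  + by apply: mono_or; [apply: mono_lift a1; exact: dvdn_mulr | apply: mono_lift b2; exact: dvdn_mull].
  + by rewrite e1 // e2.
- exists (N1 * N2)%N, (fun e s => A' e s /\ B' e s); split=> [||e t hn].
  + by rewrite muln_gt0 n1.
  + by apply: mono_and; [apply: mono_lift a1; exact: dvdn_mulr | apply: mono_lift b2; exact: dvdn_mull].
  + by rewrite e1 // e2.
- exists N1, (fun e s => ~ A' e s); split=> // [|e t hn]; first exact: mono_not.
  by rewrite e1.
Qed.

Lemma dv_add_rve s x : dv (s + x) s <-> s = 0 \/ ~ rve 1 (- x) s.
Proof.
have [->|s0] := eqVneq s 0; first by rewrite dv0; split=> // _; left.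
have key : rve 1 s (- x) = ~~ dv (s + x) s by rewrite /rve expr1 opprK sdv.
split=> [h|[/eqP|h]]; rewrite ?(negPf s0) //.
  by right=> /(rve_sym (isT : (0 < 1)%N)); rewrite key h.
by apply: contraT; rewrite -key => /(rve_sym (isT : (0 < 1)%N)).
Qed.

Lemma mono_nearest cs c : (forall c, c \in cs -> sf c) -> c \in cs ->
  mono 1 (fun e s => nearest cs c e (c e + s)).
Proof.
move=> hcs cc; apply: (@mono_bigand F _ cs (fun c' e s => dv (c e + s - c' e) (c e + s - c e))).
move=> c' cc'; have hx : sf (fun e => - (c e - c' e)) by apply/sfN/sfB; exact: hcs.
apply: mono_ext (mono_or (mono_s0 _ _) (mono_not (mono_rve (dvdnn 1) (isT : (0 < 1)%N) hx))) _ => e s.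
rewrite -dv_add_rve (_ : c e + s - c e = s); last by ring.
by rewrite (_ : c e + s - c' e = s + (c e - c' e)) //; ring.
Qed.

Lemma nearest_exists cs e t : cs != [::] -> exists2 c, c \in cs & nearest cs c e t.
Proof.
elim: cs => // a [|b cs] IH _.
  by exists a; rewrite ?inE // => c'; rewrite inE => /eqP ->; exact: dv_refl.
have [//|c cc hc] := IH.
have /orP[h|h] := dv_total (t - a e) (t - c e).
  exists c => [|c']; first by rewrite inE cc orbT.
  by rewrite inE => /orP[/eqP->|/hc].
exists a => [|c']; first by rewrite inE eqxx.
rewrite inE => /orP[/eqP->|/hc h']; first exact: dv_refl.
exact: dv_trans h' h.
Qed.

(* Each point is attached to its nearest center (the first one in case of a tie);
   this splits the fibres of S into disjoint monomial pieces. *)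
Theorem normal_form (S : E -> Prop) : sa S ->
  exists ps : seq ((E -> F) * (E -> F -> Prop)),
  [/\ forall q, q \in ps -> sf q.1 /\ exists2 N, (0 < N)%N & mono N q.2,
      forall e t, S (scons t e) <-> exists2 q, q \in ps & q.2 e (t - q.1 e) &
      forall e t q q', q \in ps -> q' \in ps ->
        q.2 e (t - q.1 e) -> q'.2 e (t - q'.1 e) -> q = q'].
Proof.
move=> /sa_bmono[cs0 [hcs0 hb0]].
(* The zero function is added so that the list is nonempty and a nearest center exists. *)
pose cs := (fun _ => 0) :: cs0.
have hcs c : c \in cs -> sf c.
  by rewrite inE => /orP[/eqP->|/hcs0//]; exact: sf_const.
have hb : bmono cs (fun e t => S (scons t e)).
  by apply: bmono_sub hb0 => c cc; rewrite inE cc orbT.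
have csn : cs != [::] by [].
clearbody cs.
have /choice [f hf] : forall c, exists S' : E -> F -> Prop, c \in cs ->
    exists N, [/\ (0 < N)%N, mono N S' &
    forall e t, nearest cs c e t -> S (scons t e) <-> S' e (t - c e)].
  move=> c; have [cc|cc] := boolP (c \in cs); last by exists (fun _ _ => True).
  by have [N [S' h]] := bmono_nearest hcs cc hb; exists S' => _; exists N.
pose P c e s := f c e s /\ (nearest cs c e (c e + s) /\
  forall c', c' \in take (index c cs) cs -> ~ dv s (c e - c' e)).
have Pt c e t : P c e (t - c e) <-> f c e (t - c e) /\ (nearest cs c e t /\
    forall c', c' \in take (index c cs) cs -> ~ dv (t - c e) (t - c' e)).
  rewrite /P (_ : c e + (t - c e) = t); last by ring.
  have hd c' : dv (t - c e) (c e - c' e) = dv (t - c e) (t - c' e).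
    rewrite (_ : t - c' e = (t - c e) + (c e - c' e)); last by ring.
    by rewrite [RHS]dv_addl ?dv_refl.
  split=> -[h1 [h2 h3]]; split=> //; split=> // c' /h3; rewrite hd; exact.
exists [seq (c, P c) | c <- cs]; split.
- move=> q /mapP[c cc ->] /=; split; first exact: hcs.
  have [N [N0 hm _]] := hf c cc; exists N => //.
  apply: mono_and => //; apply: mono_and; first by apply: mono_lift (mono_nearest hcs cc); exact: dvd1n.
  apply: (@mono_bigand F _ _ (fun c' e s => ~ dv s (c e - c' e))) => c' /mem_take cc'.
  have hx : sf (fun e => c e - c' e) by apply: sfB; exact: hcs.
  by apply: mono_not; apply: mono_ext (mono_B' N 1 hx) _ => e s; rewrite expr1.
- move=> e t; split=> [hS|[q /mapP[c cc ->] /= /Pt[h1 [h2 _]]]]; last first.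
    by have [N [_ _ h]] := hf c cc; apply/(h e t h2).
  pose a c := `[< nearest cs c e t >].
  have ha : has a cs.
    by have [c cc h] := nearest_exists e t csn; apply/hasP; exists c => //; apply/asboolP.
  pose c := nth (fun _ => 0) cs (find a cs).
  have cc : c \in cs by apply: mem_nth; rewrite -has_find.
  have ac : a c by exact: (nth_find _ ha).
  have hn : nearest cs c e t by apply/asboolP; exact: ac.
  exists (c, P c); first by apply/mapP; exists c.
  apply/Pt; split; first by have [N [_ _ h]] := hf c cc; apply/(h e t hn).
  split=> // c' c't hd.
  have : nearest cs c' e t by move=> c'' cc''; apply: dv_trans (hn _ cc'') hd.
  have hi : (index c cs <= find a cs)%N.
    by rewrite leqNgt; apply/negP=> /(before_find (fun _ => 0)); rewrite /= eqxx.
  have hi' : (index c' cs < index c cs)%N.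
    rewrite -(cat_take_drop (index c cs) cs) index_cat c't.
    apply: leq_trans (_ : size (take (index c cs) cs) <= _)%N; first by rewrite index_mem.
    by rewrite cat_take_drop size_take; case: ltnP.
  have h2 := before_find (fun _ => 0) (leq_trans hi' hi).
  rewrite nth_index in h2; last exact: mem_take c't.
  by move=> /asboolP; rewrite -/(a c') h2.
- move=> e t q q' /mapP[c cc ->] /mapP[c' cc' ->] /= /Pt[_ [h1 h2]] /Pt[_ [h3 h4]].
  suff -> : c = c' by [].
  have [h|h|h] := ltngtP (index c cs) (index c' cs).
  + case: (h4 c); last exact: h1.
    by rewrite -[c](nth_index (fun _ => 0) cc) -(nth_take (fun _ => 0) h) mem_nth // size_take_min leq_min h index_mem.
  + case: (h2 c'); last exact: h3.
    by rewrite -[c'](nth_index (fun _ => 0) cc') -(nth_take (fun _ => 0) h) mem_nth // size_take_min leq_min h index_mem.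
  + by rewrite -(nth_index (fun _ => 0) cc) h nth_index.
Qed.

Theorem sa_exists (S : E -> Prop) : sa S -> sa (fun e => exists t, S (scons t e)).
Proof.
move=> /normal_form[ps [h1 h2 _]].
have h q : q \in ps -> sa (fun e => exists s, q.2 e s).
  by move=> /h1[_ [N N0 hm]]; exact: sa_exists_mono N0 hm.
apply: sa_ext (sa_bigor h) _ => e; split=> [[q qq [s hs]]|[t /h2[q qq ht]]].
  exists (q.1 e + s); apply/h2; exists q => //.
  by rewrite (_ : q.1 e + s - q.1 e = s) //; ring.
by exists q => //; exists (t - q.1 e).
Qed.

Lemma sa_forall (S : E -> Prop) : sa S -> sa (fun e => forall t, S (scons t e)).
Proof.
move=> hS; apply: sa_ext (sa_not (sa_exists (sa_not hS))) _ => e; split=> [h t|h [t]]; last exact.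
by apply: contrapT => ht; apply: h; exists t.
Qed.

(** Substituting g amounts to quantifying over its value, which is possible only now that
    [sa_exists] holds. From here on a function may be given by its graph. *)
Lemma sf_graph g : sa (fun e => e 0 = g (tl e)) -> sf g.
Proof.
move=> hg S hS.
have h1 : pmap (fun e : E => scons (e 0) (ev (tl e))) by pmaps.
have h2 : pmap (fun e : E => scons (e 0) (od (tl e))) by pmaps.
apply: sa_ext (sa_exists (sa_and (sa_comp hg h1) (sa_comp hS h2))) _ => e.
split=> [[t []]|h]; rewrite /= ?tl_scons; first by move=> ->.
by exists (g (ev e)).
Qed.

End NormalForm.

Lemma pifT (T : Type) (P : Prop) (a b : T) : P -> (if pselect P then a else b) = a.
Proof. by case: pselect. Qed.

Lemma pifN (T : Type) (P : Prop) (a b : T) : ~ P -> (if pselect P then a else b) = b.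
Proof. by case: pselect. Qed.

(** * Semialgebraic sets up to bijection *)

Section Objects.
Variable F : lfield.
Notation E := (nat -> F).
Implicit Types (e x y : E) (S A B : E -> Prop) (i j k m n : nat).

Definition fin n e := forall i, (n <= i)%N -> e i = 0.

Lemma fin_le n m e : (n <= m)%N -> fin n e -> fin m e.
Proof. by move=> nm h i mi; apply: h; apply: leq_trans mi. Qed.

Lemma fin_scons n t e : fin n e -> fin n.+1 (scons t e).
Proof. by move=> h [|i] //= ni; exact: h. Qed.

Lemma fin_tl n e : fin n.+1 e -> fin n (tl e).
Proof. by move=> h i ni; exact: h. Qed.

Lemma fin_ext n e e' : fin n e -> fin n e' -> (forall i, (i < n)%N -> e i = e' i) -> e = e'.
Proof.
move=> h h' eq; apply: funext => i; have [/eq//|ni] := ltnP i n.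
by rewrite h // h'.
Qed.

(* Subsets of K^n are encoded as sets of environments vanishing from index n on. *)
Definition definable n A := (forall e, A e -> fin n e) /\
  exists2 S, sa S & forall e, fin n e -> A e <-> S e.

Lemma definable_le n m A : (n <= m)%N -> definable n A -> definable m A.
Proof.
move=> nm [h [S hS hSe]]; split; first by move=> e /h; exact: fin_le.
exists (fun e => S e /\ forall i, (i < m)%N -> (n <= i)%N -> e i = 0) => [|e hm].
  apply: sa_and => //; apply: sa_bounded_all => i _.
  by apply: sa_imp; [exact: sa_const | apply: sa_eq0; exact: sf_var].
split=> [Ae|[Se hi]]; first by split; [apply/hSe => //; exact: h | move=> i _; exact: (h e Ae)].
apply/hSe => // i ni; have [im|mi] := ltnP i m; [exact: hi | exact: hm].
Qed.

Lemma definable_or n A B : definable n A -> definable n B -> definable n (fun e => A e \/ B e).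
Proof.
move=> [h [S hS hSe]] [h' [S' hS' hSe']]; split; first by move=> e [/h|/h'].
by exists (fun e => S e \/ S' e) => [|e fe]; [exact: sa_or | rewrite hSe // hSe'].
Qed.

Lemma definable_and n A S : definable n A -> sa S -> definable n (fun e => A e /\ S e).
Proof.
move=> [h [S' hS hSe]] hS'; split; first by move=> e [/h].
by exists (fun e => S' e /\ S e) => [|e fe]; [exact: sa_and | rewrite hSe].
Qed.

Lemma definable_tl n A S : definable n A -> sa S -> definable n.+1 (fun e => A (tl e) /\ S e).
Proof.
move=> [h [S' hS' hSe]] hS; split=> [e [/h h1 _] [|i]//|]; first exact: h1.
exists (fun e => S' (tl e) /\ S e) => [|e fe]; last by rewrite hSe //; exact: fin_tl.
by apply: sa_and => //; apply: (sa_comp hS'); pmaps.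
Qed.

Record obj := Obj { car :> E -> Prop; odim : nat; odef : definable odim car }.
Implicit Types (X Y Z D : obj).

Lemma obj_fin X e : X e -> fin (odim X) e.
Proof. by case: X => A n [h] /= _; exact: h. Qed.

(* The two arguments are interleaved, so that the arity need not be known. *)
Definition sa2 (R : E -> E -> Prop) := sa (fun e => R (ev e) (od e)).

(** A relation instead of a function: only its trace on X x Y matters, and the definition is
    symmetric, so inverses are free. Composition quantifies over the middle object and therefore
    uses projection. *)
Definition iso X Y := exists R, [/\ sa2 R,
  (forall x, X x -> exists2 y, Y y & R x y), (forall y, Y y -> exists2 x, X x & R x y),
  (forall x y y', X x -> Y y -> Y y' -> R x y -> R x y' -> y = y') &
  (forall x x' y, X x -> X x' -> Y y -> R x y -> R x' y -> x = x')].

Lemma sa_existsn n S : sa S -> sa (fun e => exists2 y, fin n y & S (mix y e)).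
Proof.
elim: n S => [|n IH] S hS.
  have h : pmap (fun e : E => mix (fun _ => 0) e).
    by move=> i; rewrite /mix; case: (odd i); [exact: pf_var | exact: pf_const].
  apply: sa_ext (sa_comp hS h) _ => e; split=> [he|[y y0 hy]]; first by exists (fun _ => 0).
  by rewrite (_ : y = fun _ => 0) in hy => //; apply: funext => i; exact: y0.
have h : pmap (fun e : E => mix (scons (od e 0) (ev e)) (tl (od e))) by pmaps.
apply: sa_ext (sa_exists (IH _ (sa_comp hS h))) _ => e; split=> [[t [y y0]]|[y y0 hy]].
  rewrite ev_mix od_mix tl_scons scons0 => hs; exists (scons t y) => //; exact: fin_scons.
exists (y 0); exists (tl y); first exact: fin_tl.
by rewrite ev_mix od_mix tl_scons scons0 scons_tl.
Qed.

Lemma iso_fun X Y (f : E -> E) : (forall i, (i < odim Y)%N -> sf (fun e => f e i)) ->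
  (forall x, X x -> Y (f x)) -> (forall x x', X x -> X x' -> f x = f x' -> x = x') ->
  (forall y, Y y -> exists2 x, X x & f x = y) -> iso X Y.
Proof.
move=> sf_f hf inj surj; exists (fun x y => forall i, (i < odim Y)%N -> y i = f x i); split.
- apply: sa_bounded_all => i iY; apply: sa_eq.
    by apply: (@sf_pf F (fun e => od e i)); exact: pf_var.
  by apply: (sf_comp (sf_f i iY)); pmaps.
- by move=> x hx; exists (f x) => //; exact: hf.
- by move=> y /surj[x hx <-]; exists x.
- move=> x y y' hx hy hy' h h'; apply: fin_ext (obj_fin hy) (obj_fin hy') _ => i iY.
  by rewrite h // h'.
- move=> x x' y hx hx' hy h h'; apply: inj => //.
  apply: fin_ext (obj_fin (hf _ hx)) (obj_fin (hf _ hx')) _ => i iY.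
  by rewrite -h // h'.
Qed.

Lemma iso_eq X Y : (forall e, X e <-> Y e) -> iso X Y.
Proof.
move=> h; apply: (@iso_fun X Y id) => [i _|x|//|y hy]; [exact: sf_var | by rewrite h |].
by exists y => //; apply/h.
Qed.

Lemma iso_refl X : iso X X. Proof. exact: iso_eq. Qed.

Lemma iso_sym X Y : iso X Y -> iso Y X.
Proof.
move=> [R [h1 h2 h3 h4 h5]]; exists (fun y x => R x y); split=> //.
- have h : pmap (fun e : E => mix (od e) (ev e)) by pmaps.
  by apply: sa_ext (sa_comp h1 h) _ => e; rewrite ev_mix od_mix.
- by move=> y x x' hy hx hx'; exact: h5.
- by move=> y y' x hy hy' hx; exact: h4.
Qed.

Lemma iso_trans X Y Z : iso X Y -> iso Y Z -> iso X Z.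
Proof.
move=> [R [h1 h2 h3 h4 h5]] [R' [h1' h2' h3' h4' h5']].
exists (fun x z => exists2 y, Y y & R x y /\ R' y z); split.
- have [_ [S hS hSe]] := odef Y.
  have p1 : pmap (fun e : E => mix (ev (od e)) (ev e)) by pmaps.
  have p2 : pmap (fun e : E => mix (ev e) (od (od e))) by pmaps.
  have p3 : pmap (@ev F) by pmaps.
  have h := sa_existsn (odim Y) (sa_and (sa_comp hS p3) (sa_and (sa_comp h1 p1) (sa_comp h1' p2))).
  apply: sa_ext h _ => e; split=> [[y hy]|[y hy]]; rewrite ?ev_mix ?od_mix.
    by move=> [] /(hSe y hy) ? ?; exists y.
  move=> h; exists y; first exact: obj_fin hy.
  by rewrite !ev_mix !od_mix; split=> //; apply/(hSe y (obj_fin hy)).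
- move=> x /h2[y hy r]; have [z hz r'] := h2' y hy; exists z => //; by exists y.
- move=> z /h3'[y hy r']; have [x hx r] := h3 y hy; exists x => //; by exists y.
- move=> x z z' hx hz hz' [y hy [r1 r2]] [y' hy' [r3 r4]].
  have e := h4 _ _ _ hx hy hy' r1 r3; rewrite -e in r4; exact: (h4' y).
- move=> x x' z hx hx' hz [y hy [r1 r2]] [y' hy' [r3 r4]].
  have e := h5' _ _ _ hy hy' hz r2 r4; rewrite -e in r3; exact: (h5 x x' y).
Qed.

Lemma oadd_def X Y : definable (maxn (odim X) (odim Y)).+1
  (fun e => (X (tl e) /\ e 0 = 0) \/ (Y (tl e) /\ e 0 = 1)).
Proof.
apply: definable_or; apply: definable_tl.
- apply: definable_le (odef X); exact: leq_maxl.
- by apply: sa_eq; [exact: sf_var | exact: sf_const].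
- apply: definable_le (odef Y); exact: leq_maxr.
- by apply: sa_eq; [exact: sf_var | exact: sf_const].
Qed.

Definition oadd X Y : obj := Obj (oadd_def X Y).

Lemma ocell_def X (C : E -> F -> Prop) : sa (fun e => C (tl e) (e 0)) ->
  definable (odim X).+1 (fun e => X (tl e) /\ C (tl e) (e 0)).
Proof. by move=> h; apply: definable_tl => //; exact: odef. Qed.

Record fibres := Fibres { fib :> E -> F -> Prop; fib_sa : sa (fun e => fib (tl e) (e 0)) }.
Definition ocell X (C : fibres) : obj := Obj (ocell_def X (fib_sa C)).

Definition orestr X S (hS : sa S) : obj := Obj (definable_and (odef X) hS).

Lemma one_neq0 : (1 : F) <> 0. Proof. by apply/eqP; exact: oner_neq0. Qed.

Lemma sf_scons (p : E -> F) (phi : E -> E) i : sf p -> (forall i, sf (fun e => phi e i)) ->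
  sf (fun e => scons (p e) (phi e) i).
Proof. by move=> hp hphi; case: i => [|i] /=. Qed.

Lemma sf_tl i : sf (fun e : E => tl e i). Proof. exact: (sf_var i.+1). Qed.

Lemma iso_split X (A B : obj) : (forall e, X e <-> A e \/ B e) ->
  (forall e, A e -> B e -> False) -> iso X (oadd A B).
Proof.
move=> hX hAB; have [_ [S hS hSe]] := odef A.
pose f e : E := scons (if pselect (fin (odim A) e /\ S e) then 0 else 1) e.
(* Membership in A is tested on coordinates below [odim X] only: on X the others vanish, whereas
   testing all of them would be an infinite conjunction. *)
pose g e : E := scons (if pselect (S e /\ forall i, (i < odim X)%N -> (odim A <= i)%N -> e i = 0) then 0 else 1) e.
have gA e : X e -> (A e <-> S e /\ forall i, (i < odim X)%N -> (odim A <= i)%N -> e i = 0).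
  move=> xe; split=> [ae|[se hi]].
    have fa := obj_fin ae; split; first exact/hSe.
    by move=> i _; exact: fa.
  apply/hSe => // i Ai; have [iX|Xi] := ltnP i (odim X); [exact: hi | exact: (obj_fin xe)].
apply: (@iso_fun X _ g) => [i _|x hx|x x' _ _|y].
- apply: sf_scons; last exact: sf_var.
  apply: sf_if; [|exact: sf_const|exact: sf_const].
  apply: sa_and => //; apply: sa_bounded_all => j _.
  by apply: sa_imp; [exact: sa_const | apply: sa_eq0; exact: sf_var].
- have [h|h] := pselect (A x).
    by rewrite /g pifT; [left; rewrite tl_scons | apply/gA].
  rewrite /g pifN; last by move/(gA x hx).
  by right; rewrite tl_scons; split=> //; have /hX[] := hx.
- by move=> /(congr1 (@tl F)); rewrite /g !tl_scons.
- move=> [[ay y0]|[by_ y1]].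
    have xy : X (tl y) by apply/hX; left.
    by exists (tl y) => //; rewrite /g pifT; [rewrite -[RHS]scons_tl y0 | apply/gA].
  have xy : X (tl y) by apply/hX; right.
  exists (tl y) => //; rewrite /g pifN; first by rewrite -[RHS]scons_tl y1.
  by move/(gA _ xy) => ay; apply: hAB ay by_.
Qed.

Lemma oadd0 X Y e : oadd X Y e -> e 0 = 0 -> X (tl e).
Proof. by case=> -[] // _ -> /one_neq0. Qed.

Lemma oadd1 X Y e : oadd X Y e -> e 0 = 1 -> Y (tl e).
Proof. by case=> -[] // _ -> /esym/one_neq0. Qed.

Lemma oadd_iso X X' Y Y' : iso X X' -> iso Y Y' -> iso (oadd X Y) (oadd X' Y').
Proof.
move=> [R [h1 h2 h3 h4 h5]] [R' [h1' h2' h3' h4' h5']].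
exists (fun x y => x 0 = y 0 /\ ((x 0 = 0 -> R (tl x) (tl y)) /\ (x 0 = 1 -> R' (tl x) (tl y)))).
have p1 : pmap (fun e : E => mix (tl (ev e)) (tl (od e))) by pmaps.
have ev0 a : sa (fun e : E => ev e 0 = a).
  by apply: sa_eq; [exact: (sf_var 0%N) | exact: sf_const].
split.
- apply: sa_and; first by apply: sa_eq; [exact: (sf_var 0%N) | exact: (sf_var 1%N)].
  apply: sa_and; apply: sa_imp => //.
    by apply: sa_ext (sa_comp h1 p1) _ => e; rewrite ev_mix od_mix.
  by apply: sa_ext (sa_comp h1' p1) _ => e; rewrite ev_mix od_mix.
- move=> x [[/h2[y hy r] x0]|[/h2'[y hy r] x0]].
    exists (scons 0 y); first by left; rewrite tl_scons.
    by rewrite !tl_scons x0; split=> //; split=> // /esym/one_neq0.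
  exists (scons 1 y); first by right; rewrite tl_scons.
  by rewrite !tl_scons x0; split=> //; split=> // /one_neq0.
- move=> y [[/h3[x hx r] y0]|[/h3'[x hx r] y0]].
    exists (scons 0 x); first by left; rewrite tl_scons.
    by rewrite !tl_scons y0; split=> //; split=> // /esym/one_neq0.
  exists (scons 1 x); first by right; rewrite tl_scons.
  by rewrite !tl_scons y0; split=> //; split=> // /one_neq0.
- move=> x y y' hx hy hy' [a1 [a2 a3]] [b1 [b2 b3]].
  rewrite -[y]scons_tl -[y']scons_tl -a1 -b1; congr (scons _ _).
  case: (hx) => [[hx' x0]|[hx' x0]].
    apply: (h4 _ _ _ hx' _ _ (a2 x0) (b2 x0)); [apply: oadd0 hy _ | apply: oadd0 hy' _]; congruence.
  apply: (h4' _ _ _ hx' _ _ (a3 x0) (b3 x0)); [apply: oadd1 hy _ | apply: oadd1 hy' _]; congruence.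
- move=> x x' y hx hx' hy [a1 [a2 a3]] [b1 [b2 b3]].
  rewrite -[x]scons_tl -[x']scons_tl a1 b1; congr (scons _ _).
  case: (hy) => [[hy' y0]|[hy' y0]].
    have [x0 x0'] : x 0 = 0 /\ x' 0 = 0 by split; congruence.
    exact: (h5 _ _ _ (oadd0 hx x0) (oadd0 hx' x0') hy' (a2 x0) (b2 x0')).
  have [x0 x0'] : x 0 = 1 /\ x' 0 = 1 by split; congruence.
  exact: (h5' _ _ _ (oadd1 hx x0) (oadd1 hx' x0') hy' (a3 x0) (b3 x0')).
Qed.

Lemma oaddC X Y : iso (oadd X Y) (oadd Y X).
Proof.
apply: (@iso_fun _ _ (fun e => scons (1 - e 0) (tl e))) => [i _|x|x x' _ _|y].
- by apply: sf_scons; [apply: sfB; [exact: sf_const | exact: sf_var] | exact: sf_tl].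
- by move=> [[hx x0]|[hx x0]]; [right|left]; rewrite /= tl_scons x0 ?subr0 ?subrr.
- move=> h; rewrite -[x]scons_tl -[x']scons_tl.
  have -> : tl x = tl x' by move: (congr1 (@tl F) h); rewrite !tl_scons.
  have : 1 - x 0 = 1 - x' 0 by exact: (congr1 (fun e : E => e 0) h).
  by move=> /(congr1 (fun t => 1 - t)); rewrite !subKr => ->.
- move=> hy; exists (scons (1 - y 0) (tl y)); last by rewrite tl_scons /= subKr scons_tl.
  by case: hy => [[hy y0]|[hy y0]]; [right|left]; rewrite /= tl_scons y0 ?subr0 ?subrr.
Qed.

Lemma oaddP X Y e : oadd X Y e <->
  (exists2 a, X a & e = scons 0 a) \/ (exists2 b, Y b & e = scons 1 b).
Proof.
split=> [[[h e0]|[h e0]]|[[a h ->]|[a h ->]]].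
- by left; exists (tl e) => //; rewrite -e0 scons_tl.
- by right; exists (tl e) => //; rewrite -e0 scons_tl.
- by left; rewrite /= tl_scons.
- by right; rewrite /= tl_scons.
Qed.

Lemma iso_fun2 X Y (f g : E -> E) : (forall i, (i < odim Y)%N -> sf (fun e => f e i)) ->
  (forall x, X x -> Y (f x) /\ g (f x) = x) -> (forall y, Y y -> X (g y) /\ f (g y) = y) ->
  iso X Y.
Proof.
move=> hf h1 h2; apply: (iso_fun hf) => [x /h1[]//|x x' /h1[_ e1] /h1[_ e2] e|y /h2[hy e]].
  by rewrite -e1 e e2.
by exists (g y).
Qed.

Lemma oaddA X Y Z : iso (oadd X (oadd Y Z)) (oadd (oadd X Y) Z).
Proof.
apply: iso_sym.
pose f e : E := if pselect (e 0 = 1) then scons 1 (scons 1 (tl e)) else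
   if pselect (e 1%N = 0) then tl e else scons 1 (scons 0 (tl (tl e))).
pose g e : E := if pselect (e 0 = 0) then scons 0 e else
   if pselect (e 1%N = 0) then scons 0 (scons 1 (tl (tl e))) else tl e.
have n10 : (1 : F) = 0 -> False by exact: one_neq0.
have n01 : (0 : F) = 1 -> False by move=> h; apply: one_neq0.
have f1 z : f (scons 1 z) = scons 1 (scons 1 z) by rewrite /f pifT.
have f00 a : f (scons 0 (scons 0 a)) = scons 0 a by rewrite /f pifN // pifT.
have f01 a : f (scons 0 (scons 1 a)) = scons 1 (scons 0 a) by rewrite /f pifN // pifN.
have g0 a : g (scons 0 a) = scons 0 (scons 0 a) by rewrite /g pifT.
have g10 a : g (scons 1 (scons 0 a)) = scons 0 (scons 1 a) by rewrite /g pifN // pifT.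
have g11 a : g (scons 1 (scons 1 a)) = scons 1 a by rewrite /g pifN // pifN.
apply: (@iso_fun2 _ _ f g) => [i _|x|y].
- have e1 : sa (fun e : E => e 0 = 1) by apply: sa_eq; [exact: sf_var | exact: sf_const].
  have e2 : sa (fun e : E => e 1%N = 0) by apply: sa_eq; [exact: sf_var | exact: sf_const].
  have := sf_if e1 (@sf_scons (fun _ => 1) (fun e => scons 1 (tl e)) i (sf_const 1)
    (fun j => @sf_scons (fun _ => 1) (@tl F) j (sf_const 1) sf_tl))
    (sf_if e2 (sf_tl i) (@sf_scons (fun _ => 1) (fun e => scons 0 (tl (tl e))) i (sf_const 1)
    (fun j => @sf_scons (fun _ => 0) (fun e => tl (tl e)) j (sf_const 0) (fun k => sf_var k.+2)))).
  by congr sf; apply: funext => e; rewrite /f; case: pselect => [h|nh] //; case: pselect.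
- move=> /oaddP[[u /oaddP[[a ha ->]|[b hb ->]] ->]|[c hc ->]].
  + by rewrite f00 g0; split=> //; apply/oaddP; left; exists a.
  + rewrite f01 g10; split=> //; apply/oaddP; right; exists (scons 0 b) => //.
    by apply/oaddP; left; exists b.
  + rewrite f1 g11; split=> //; apply/oaddP; right; exists (scons 1 c) => //.
    by apply/oaddP; right; exists c.
- move=> /oaddP[[a ha ->]|[u /oaddP[[b hb ->]|[c hc ->]] ->]].
  + rewrite g0 f00; split=> //; apply/oaddP; left; exists (scons 0 a) => //.
    by apply/oaddP; left; exists a.
  + rewrite g10 f01; split=> //; apply/oaddP; left; exists (scons 1 b) => //.
    by apply/oaddP; right; exists b.
  + by rewrite g11 f1; split=> //; apply/oaddP; right; exists c.
Qed.

Lemma oadd_empty X Y : (forall e, ~ Y e) -> iso (oadd X Y) X.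
Proof.
move=> hY; apply: (@iso_fun2 _ _ (@tl F) (scons 0)) => [i _|x|y hy]; first exact: sf_tl.
  by move=> /oaddP[[a ha ->]|[b /hY//]].
by rewrite tl_scons; split=> //; apply/oaddP; left; exists y.
Qed.

Lemma ocellP X (C : fibres) e : ocell X C e <-> exists a t, [/\ X a, C a t & e = scons t a].
Proof.
split=> [[h1 h2]|[a [t [h1 h2 ->]]]]; last by rewrite /= tl_scons.
by exists (tl e), (e 0); rewrite scons_tl.
Qed.

Lemma ocell_iso_base X X' (W : fibres) : (forall e e', W e = W e') ->
  iso X X' -> iso (ocell X W) (ocell X' W).
Proof.
move=> hW [R [h1 h2 h3 h4 h5]]; exists (fun x y => x 0 = y 0 /\ R (tl x) (tl y)).
have p1 : pmap (fun e : E => mix (tl (ev e)) (tl (od e))) by pmaps.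
split.
- apply: sa_and; first by apply: sa_eq; [exact: (sf_var 0%N) | exact: (sf_var 1%N)].
  by apply: sa_ext (sa_comp h1 p1) _ => e; rewrite ev_mix od_mix.
- move=> x /ocellP[a [t [ha ht ->]]]; have [b hb r] := h2 a ha.
  exists (scons t b); last by rewrite !tl_scons.
  by apply/ocellP; exists b, t; split=> //; rewrite (hW b a).
- move=> x /ocellP[a [t [ha ht ->]]]; have [b hb r] := h3 a ha.
  exists (scons t b); last by rewrite !tl_scons.
  by apply/ocellP; exists b, t; split=> //; rewrite (hW b a).
- move=> x y y' [hx _] [hy _] [hy' _] [e1 r1] [e2 r2].
  by rewrite -[y]scons_tl -[y']scons_tl -e1 -e2 (h4 _ _ _ hx hy hy' r1 r2).
- move=> x x' y [hx _] [hx' _] [hy _] [e1 r1] [e2 r2].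
  by rewrite -[x]scons_tl -[x']scons_tl e1 e2 (h5 _ _ _ hx hx' hy r1 r2).
Qed.

Lemma ocell_iso X (C C' : fibres) (f : E -> F -> F) : sf (fun e => f (tl e) (e 0)) ->
  (forall e t, X e -> C e t -> C' e (f e t)) ->
  (forall e t t', X e -> C e t -> C e t' -> f e t = f e t' -> t = t') ->
  (forall e t', X e -> C' e t' -> exists2 t, C e t & f e t = t') ->
  iso (ocell X C) (ocell X C').
Proof.
move=> hf h1 h2 h3; apply: (@iso_fun _ _ (fun e => scons (f (tl e) (e 0)) (tl e))) => [i _|x|x x'|y].
- by apply: sf_scons => //; exact: sf_tl.
- move=> /ocellP[a [t [ha ht ->]]]; apply/ocellP; exists a, (f a t).
  by rewrite tl_scons; split=> //; exact: h1.
- move=> /ocellP[a [t [ha ht ->]]] /ocellP[a' [t' [ha' ht' ->]]]; rewrite !tl_scons !scons0 => eq.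
  have aa : a = a' by move: (congr1 (@tl F) eq); rewrite !tl_scons.
  subst a'; congr (scons _ _); apply: (h2 a) => //.
  exact: (congr1 (fun e : E => e 0) eq).
- move=> /ocellP[a [t' [ha ht' ->]]]; have [t ht e] := h3 a t' ha ht'.
  exists (scons t a); last by rewrite tl_scons scons0 e.
  by apply/ocellP; exists a, t.
Qed.

Lemma ocell_point X (C : fibres) (g : E -> F) : sf g -> (forall e t, X e -> C e t <-> t = g e) ->
  iso (ocell X C) X.
Proof.
move=> hg hC; apply: (@iso_fun2 _ _ (@tl F) (fun e => scons (g e) e)) => [i _|x|y hy].
- exact: sf_tl.
- by move=> /ocellP[a [t [ha /(hC a t ha) -> ->]]]; rewrite tl_scons.
- rewrite tl_scons; split=> //; apply/ocellP; exists y, (g y); split=> //.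
  exact/(hC y _ hy).
Qed.

Lemma ocell_split X (C A B : fibres) : (forall e t, X e -> C e t <-> A e t \/ B e t) ->
  (forall e t, X e -> A e t -> B e t -> False) -> iso (ocell X C) (oadd (ocell X A) (ocell X B)).
Proof.
move=> h1 h2; apply: iso_split => [e|e [hx ha] [_ hb]]; last exact: (h2 (tl e) (e 0)).
split=> [[hx hc]|[[hx ha]|[hx hb]]].
- by have [h|h] := (h1 (tl e) (e 0) hx).1 hc; [left|right].
- by split=> //; apply/(h1 _ _ hx); left.
- by split=> //; apply/(h1 _ _ hx); right.
Qed.

Lemma ocell_oadd X Y (W : fibres) : (forall e e', W e = W e') ->
  iso (ocell (oadd X Y) W) (oadd (ocell X W) (ocell Y W)).
Proof.
move=> hW; pose f e : E := scons (e 1%N) (scons (e 0) (tl (tl e))).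
have ff t u a : f (scons t (scons u a)) = scons u (scons t a).
  by rewrite /f !tl_scons.
apply: (@iso_fun2 _ _ f f) => [i _|x|y].
- apply: sf_scons => [|j]; first exact: sf_var.
  by apply: sf_scons => [|k]; [exact: sf_var | exact: (sf_var k.+2)].
- move=> /ocellP[b [t [/oaddP[[a ha ->]|[a ha ->]] ht ->]]]; rewrite !ff; split=> //; apply/oaddP.
    by left; exists (scons t a) => //; apply/ocellP; exists a, t; rewrite (hW a (scons 0 a)).
  by right; exists (scons t a) => //; apply/ocellP; exists a, t; rewrite (hW a (scons 1 a)).
- move=> /oaddP[[b /ocellP[a [t [ha ht ->]]] ->]|[b /ocellP[a [t [ha ht ->]]] ->]]; rewrite !ff; split=> //.
    apply/ocellP; exists (scons 0 a), t; rewrite (hW _ a); split=> //.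
    by apply/oaddP; left; exists a.
  apply/ocellP; exists (scons 1 a), t; rewrite (hW _ a); split=> //.
  by apply/oaddP; right; exists a.
Qed.

End Objects.

#[export] Instance iso_equiv (F : lfield) : Equivalence (@iso F).
Proof.
split; [exact: iso_refl | exact: iso_sym | exact: iso_trans].
Qed.

#[export] Instance oadd_proper (F : lfield) : Proper (@iso F ==> @iso F ==> @iso F) (@oadd F).
Proof. by move=> X X' hX Y Y' hY; exact: oadd_iso. Qed.

Section Multiples.
Variable F : lfield.
Implicit Types (X Y Z D : obj F) (m n : nat).

Lemma oempty_def : definable 0 (fun _ : nat -> F => False).
Proof. by split=> //; exists (fun _ => False) => //; exact: sa_const. Qed.
Definition oempty : obj F := Obj oempty_def.

Fixpoint omul n X := if n is m.+1 then oadd X (omul m X) else oempty.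

Lemma oadd0r X : iso (oadd X oempty) X. Proof. by apply: oadd_empty => e. Qed.
Lemma oadd0l X : iso (oadd oempty X) X.
Proof. by rewrite oaddC; exact: oadd0r. Qed.

Lemma omulD m n X : iso (omul (m + n) X) (oadd (omul m X) (omul n X)).
Proof.
elim: m => [|m IH]; first by rewrite add0n /= oadd0l; reflexivity.
by rewrite addSn /= IH oaddA; reflexivity.
Qed.

Lemma omul_iso n X Y : iso X Y -> iso (omul n X) (omul n Y).
Proof. by move=> h; elim: n => [|n IH] /=; [reflexivity | exact: oadd_iso]. Qed.

Lemma omul_absorb n X Y : iso (oadd Y X) Y -> iso (oadd Y (omul n X)) Y.
Proof.
move=> h; elim: n => [|n IH] /=; first exact: oadd0r.
by rewrite oaddA h.
Qed.

Lemma omul_idem n X : (0 < n)%N -> iso (oadd X X) X -> iso (omul n X) X.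
Proof.
move=> n0 h; case: n n0 => // n _ /=; exact: omul_absorb.
Qed.

End Multiples.

(** * Rays, their cosets and their images under power maps *)

Section Lines.
Variable F : lfield.
Notation E := (nat -> F).
Implicit Types (e : E) (a b r s t x y : F) (N M k i j n m v : nat) (X Y D : obj F).

Record uset := USet { us :> F -> Prop; us_sa : sa (fun e : E => us (e 0)) }.
Implicit Types (W : uset).

Definition cfib W : fibres F := @Fibres F (fun _ => W) (us_sa W).
Definition oprod D W := ocell D (cfib W).

Lemma oprod_iso D W W' (f : F -> F) : sf (fun e : E => f (e 0)) ->
  (forall t, W t -> W' (f t)) -> (forall t t', W t -> W t' -> f t = f t' -> t = t') ->
  (forall t', W' t' -> exists2 t, W t & f t = t') -> iso (oprod D W) (oprod D W').
Proof.
move=> hf h1 h2 h3; apply: (@ocell_iso _ _ _ _ (fun _ => f)) => //=.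
- by move=> e t _; exact: h1.
- by move=> e t t' _; exact: h2.
- by move=> e t' _; exact: h3.
Qed.

Lemma oprod_split D W A B : (forall t, W t <-> us A t \/ us B t) ->
  (forall t, us A t -> us B t -> False) -> iso (oprod D W) (oadd (oprod D A) (oprod D B)).
Proof. by move=> h1 h2; apply: ocell_split => [e t _|e t _]; [exact: h1 | exact: h2]. Qed.

Lemma oprod_eq D W W' : (forall t, us W t <-> us W' t) -> iso (oprod D W) (oprod D W').
Proof. by move=> h; apply: iso_eq => e; split=> -[h1 h2]; split=> //; apply/h. Qed.

(* pi^(N Z) (1 + pi^M O), cut to O. *)
Definition ray_pred N M t := [/\ t != 0, (N%:Z %| w t)%Z, dv (pi ^+ M) (ac t - 1) & dv 1 t].

Lemma ray_sa N M : (0 < N)%N -> (0 < M)%N -> sa (fun e : E => ray_pred N M (e 0)).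
Proof.
move=> N0 M0; have NM0 : (0 < N * M)%N by rewrite muln_gt0 N0.
pose W t := [/\ t != 0, (N%:Z %| w t)%Z & dv (pi ^+ M) (ac t - 1)].
have h : sa (fun e : E => W (e 0)).
  apply: (@sa_clsW F (N * M) W) NM0 _ (sf_var 0) => x y /and4P[x0 y0 h1 h2] [_ h3 h4].
  split=> //.
    rewrite (_ : w y = w x - (w x - w y)); last by ring.
    by apply: rpredB => //; apply: dvdz_trans h1; rewrite PoszM dvdz_mulr.
  rewrite (_ : ac y - 1 = (ac x - 1) - (ac x - ac y)); last by ring.
  by apply: dvB => //; apply: dv_trans h2; rewrite dv_pi2 leq_pmull.
apply: sa_ext (sa_and h (sa_dv (sf_const 1) (sf_var 0))) _ => e.
by split=> [[[]]|[]].
Qed.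

Definition ray N M (N0 : (0 < N)%N) (M0 : (0 < M)%N) : uset :=
  @USet (ray_pred N M) (ray_sa N0 M0).

Lemma uO_sa : sa (fun e : E => dv 1 (e 0)).
Proof. by apply: sa_dv; [exact: sf_const | exact: sf_var]. Qed.
Definition uO : uset := @USet (fun t => dv 1 t) uO_sa.

Definition uK : uset := @USet (fun t => True) (sa_const F True).

Lemma ubig_sa (ls : seq F) (W : uset) :
  sa (fun e : E => exists2 l, l \in ls & W (e 0 / l)).
Proof.
apply: sa_bigor => l _.
have h := sa_sf (us_sa W) (sf_div (sf_var 0) (sf_const l)).
exact: h.
Qed.
Definition ubig ls W : uset :=
  @USet (fun t => exists2 l, l \in ls & W (t / l)) (ubig_sa ls W).

Lemma oprod_scale D W (l : F) : l != 0 -> iso (oprod D (ubig [:: l] W)) (oprod D W).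
Proof.
move=> l0; apply: (@oprod_iso _ _ _ (fun t => t / l)).
- by apply: sf_div; [exact: sf_var | exact: sf_const].
- by move=> t [l']; rewrite inE => /eqP ->.
- by move=> t t' _ _ /(congr1 (fun x => x * l)); rewrite !divfK.
- move=> t' ht'; exists (t' * l); last by rewrite mulfK.
  by exists l; rewrite ?inE // mulfK.
Qed.

Lemma oprod_big D W (ls : seq F) : uniq ls -> (forall l, l \in ls -> l != 0) ->
  (forall l l' t, l \in ls -> l' \in ls -> us W (t / l) -> us W (t / l') -> l = l') ->
  iso (oprod D (ubig ls W)) (omul (size ls) (oprod D W)).
Proof.
elim: ls => [|l ls IH] /=.
  by move=> _ _ _; apply: iso_eq => e; split=> // -[_ []].
move=> /andP[nl ul] h0 hd.
rewrite (@oprod_split _ _ (ubig [:: l] W) (ubig ls W)).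
- rewrite oprod_scale ?h0 ?inE ?eqxx // IH //; first by reflexivity.
    by move=> l' h; apply: h0; rewrite inE h orbT.
  by move=> l1 l2 t h1 h2; apply: hd; rewrite inE ?h1 ?h2 orbT.
- move=> t; split=> [[l']|[[l']|[l' h1 h2]]].
  + by rewrite inE => /orP[/eqP->|h] hw; [left; exists l; rewrite ?inE | right; exists l'].
  + by rewrite inE => /eqP-> h; exists l; rewrite ?inE ?eqxx.
  + by exists l'; rewrite ?inE ?h1 ?orbT.
- move=> t [l']; rewrite inE => /eqP -> h1 [l2 h2 h3].
  have e : l = l2 by apply: (hd _ _ t) => //; rewrite inE ?eqxx // h2 orbT.
  by rewrite e h2 in nl.
Qed.

Lemma w_div x y : x != 0 -> y != 0 -> w (x / y) = w x - w y.
Proof. by move=> x0 y0; rewrite wM ?invr_eq0 // wV. Qed.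

(* pi^N (1 + pi^M O) cut to O splits off its units, and is invariant under pi^N. *)
Lemma ray_shift D N M (N0 : (0 < N)%N) (M0 : (0 < M)%N) :
  iso (oprod D (ray N0 M0)) (oadd (oprod D uO) (oprod D (ray N0 M0))).
Proof.
have ball_sa : sa (fun e : E => dv (pi ^+ M) (e 0 - 1)).
  by apply: sa_dv; [exact: sf_const | apply: sfB; [exact: sf_var | exact: sf_const]].
pose ball := @USet (fun t => dv (pi ^+ M) (t - 1)) ball_sa.
have e1 : iso (oprod D ball) (oprod D uO).
  apply: (@oprod_iso _ _ _ (fun t => (t - 1) / pi ^+ M)).
  - apply: sf_div; [apply: sfB; [exact: sf_var | exact: sf_const] | exact: sf_const].
  - by move=> t h; rewrite /= -(dvM2r _ _ (pin0 F M)) divfK ?pin0 // mul1r.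
  - move=> t t' _ _ /(congr1 (fun x => x * pi ^+ M + 1)).
    by rewrite !divfK ?pin0 // !subrK.
  - move=> t' h; exists (t' * pi ^+ M + 1); last by rewrite addrK mulfK ?pin0.
    by rewrite /= addrK dv_mull ?dv_refl.
apply: iso_trans (@oprod_split D _ ball (ubig [:: pi ^+ N] (ray N0 M0)) _ _) _; last first.
- by apply: oadd_iso e1 _; apply: oprod_scale; rewrite pin0.
- move=> t h [l]; rewrite inE => /eqP -> [_ h1 _ h3].
  have [_ t0 wt] : [/\ dv 1 t, t != 0 & w t = 0].
    by move: h; rewrite /= -(prednK M0); exact: unit1.
  move: h3; rewrite dv_w ?oner_neq0 ?mulf_neq0 ?invr_eq0 ?pin0 // w1 w_div ?pin0 // wt w_pin.
  by move: N0; clear; lia.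
- move=> t; split=> [[t0 h1 h2 h3]|[h|[l]]].
  + have [wt|wt] := eqVneq (w t) 0; first by left; rewrite -(ac_unit wt).
    right; exists (pi ^+ N); rewrite ?inE //; have p0 := pin0 F N.
    split; first by rewrite mulf_neq0 ?invr_eq0.
    * by rewrite w_div // w_pin; apply: rpredB => //; exact: dvdzz.
    * rewrite acM ?invr_eq0 // acV // -[pi ^+ N]/(pi ^ N%:Z) ac_piz invr1 mulr1 //.
    * move: h3; rewrite !dv_w ?oner_neq0 ?mulf_neq0 ?invr_eq0 // w1 w_div // w_pin.
      move: h1 wt => /dvdzP[q ->] qN h; rewrite subr_ge0.
      have : 0 < q * N%:Z by rewrite lt_neqAle eq_sym qN h.
      by rewrite pmulr_lgt0 // => q0; rewrite ler_peMl // -gtz0_ge1.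
  + have [t1 t0 wt] : [/\ dv 1 t, t != 0 & w t = 0].
      by move: h; rewrite /= -(prednK M0); exact: unit1.
    by split=> //; rewrite ?wt ?dvdz0 // ac_unit.
  + rewrite inE => /eqP ->; have p0 := pin0 F N.
    move=> [t0 h1 h2 h3]; have tt0 : t != 0 by move: t0; rewrite mulf_eq0 negb_or => /andP[].
    have tE : t = t / pi ^+ N * pi ^+ N by rewrite divfK.
    split=> //.
    * by rewrite tE wM // w_pin rpredD // dvdzz.
    * by rewrite tE acM // -[pi ^+ N]/(pi ^ N%:Z) ac_piz mulr1.
    * by rewrite tE dv_mulr // dv_pin.
Qed.

(** On valuations the power map multiplies by n; on angular components it is the bijection of
    [root1], [pow1] and [pow1_inj], at the cost of v digits. *)
Lemma ray_power D N M n v (N0 : (0 < N)%N) (M0 : (0 < M)%N) (n0 : (0 < n)%N)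
  (Nn0 : (0 < n * N)%N) (Mv0 : (0 < M + v)%N) : w (n%:R : F) = v%:Z -> (v < M)%N ->
  iso (oprod D (ray N0 M0)) (oprod D (ray Nn0 Mv0)).
Proof.
move=> wn vM; apply: (@oprod_iso _ _ _ (fun t => t ^+ n)).
- exact/sfX/sf_var.
- move=> t [t0 h1 h2 h3]; split.
  + by rewrite expf_neq0.
  + by rewrite wX // PoszM mulrC; apply: dvdz_mul => //; exact: dvdzz.
  + by rewrite acX //; exact: (pow1 n0 wn vM).
  + by rewrite -(expr1n _ n) dvX.
- move=> t t' [t0 h1 h2 h3] [t0' h1' h2' h3'] e.
  have wE : w t = w t' by have := congr1 (@w F) e; rewrite !wX //; move: n0; clear; nia.
  have aE : ac t = ac t'.
    by apply: (pow1_inj n0 wn vM h2 h2'); rewrite -!acX // e.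
  by rewrite [t]acE [t' in RHS]acE aE wE.
- move=> y [y0 h1 h2 h3]; have [u uE hu] := root1 n0 wn vM h2.
  have /dvdzP[q qE] := h1.
  have a0 : ac y != 0 by rewrite ac_neq0.
  have u0 : u != 0 by apply: contraNneq a0 => u0; rewrite -uE u0 expr0n; case: (n) n0.
  have wu : w u = 0 by have := congr1 (@w F) uE; rewrite wX // w_ac //; move: n0; clear; nia.
  exists (u * pi ^ (q * N%:Z)).
    split.
    + by rewrite mulf_neq0 ?piz0.
    + by rewrite wM ?piz0 // w_piz wu add0r dvdz_mull.
    + by rewrite acM ?piz0 // ac_piz mulr1 ac_unit.
    + rewrite dv_w ?oner_neq0 ?mulf_neq0 ?piz0 // w1 wM ?piz0 // w_piz wu add0r.
      move: h3; rewrite dv_w ?oner_neq0 // w1 qE PoszM; move: n0; clear; nia.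
  rewrite exprMn uE [RHS]acE; congr (_ * _); rewrite qE exprnP exprz_exp PoszM.
  by congr (_ ^ _); ring.
Qed.

(** The cosets of the smaller ray are represented by pi^(N j) x with j < n and x in [mus]. As j is
    the remainder of v(t) / N modulo n, dividing an integral t by its representative leaves it
    integral. *)
Lemma ray_refine D N M n v (N0 : (0 < N)%N) (M0 : (0 < M)%N) (n0 : (0 < n)%N)
  (Nn0 : (0 < n * N)%N) (Mv0 : (0 < M + v)%N) (mus : seq F) : uniq mus ->
  (forall x, x \in mus -> dv (pi ^+ M) (x - 1)) ->
  (forall x y, x \in mus -> y \in mus -> dv (pi ^+ (M + v)) (x - y) -> x = y) ->
  (forall x, dv (pi ^+ M) (x - 1) -> exists2 y, y \in mus & dv (pi ^+ (M + v)) (y - x)) ->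
  iso (oprod D (ray N0 M0)) (omul (n * size mus) (oprod D (ray Nn0 Mv0))).
Proof.
move=> umu h1 h2 h3.
have M1 : M = M.-1.+1 by rewrite prednK.
have hmu x : x \in mus -> [/\ dv 1 x, x != 0 & w x = 0].
  by move=> /h1; rewrite M1; exact: unit1.
pose ls := [seq pi ^+ (N * j) * x | j <- iota 0 n, x <- mus].
have lsP l : l \in ls -> exists j x, [/\ (j < n)%N, x \in mus & l = pi ^+ (N * j) * x].
  by move=> /allpairsP[[j x] /= [jn hx ->]]; exists j, x; rewrite mem_iota in jn.
have wl j x : x \in mus -> w (pi ^+ (N * j) * x) = (N * j)%N%:Z.
  by move=> /hmu[_ x0 wx]; rewrite wM ?pin0 // w_pin wx addr0.
have acl j x : x \in mus -> ac (pi ^+ (N * j) * x) = x.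
  move=> /hmu[_ x0 wx]; rewrite acM ?pin0 // -[pi ^+ (N * j)]/(pi ^ (N * j)%N%:Z) ac_piz mul1r.
  exact: ac_unit.
have szl : size ls = (n * size mus)%N by rewrite size_allpairs size_iota.
have inj j x j' x' : x \in mus -> x' \in mus ->
    pi ^+ (N * j) * x = pi ^+ (N * j') * x' -> j = j' /\ x = x'.
  move=> hx hx' e; have := congr1 (@w F) e; have := congr1 (@ac F) e.
  rewrite !acl // !wl // => -> /eqP; rewrite eqz_nat eqn_pmul2l // => /eqP ->.
  by split.
have uls : uniq ls.
  apply: allpairs_uniq => //; first exact: iota_uniq.
  move=> [j x] [j' x'] /allpairsP[[j1 x1] /= [_ hx [-> ->]]] /allpairsP[[j2 x2] /= [_ hx' [-> ->]]].
  by move=> /(inj _ _ _ _ hx hx')[-> ->].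
rewrite -szl -oprod_big //; first last.
- move=> l l' t /lsP[j [x [jn hx ->]]] /lsP[j' [x' [jn' hx' ->]]].
  have [_ x0 wx] := hmu _ hx; have [_ x0' wx'] := hmu _ hx'.
  move=> [t0 i1 i2 i3] [_ i1' i2' i3'].
  have tt0 : t != 0 by move: t0; rewrite mulf_eq0 negb_or => /andP[].
  have xx : x = x'.
    apply: h2 => //; move: i2 i2'; rewrite !acM ?invr_eq0 ?mulf_neq0 ?pin0 // !acV ?mulf_neq0 ?pin0 // !acl //.
    move=> i2 i2'; rewrite (_ : x - x' = (ac t / x' - 1) * x' - (ac t / x - 1) * x); last by field; rewrite x0 x0'.
    by apply: dvB; apply: dv_mulr => //; rewrite dv_w ?oner_neq0 // w1 ?wx ?wx'.
  have jj : j = j'.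
    move: i1 i1'; rewrite !w_div ?mulf_neq0 ?pin0 // !wl // => /dvdzP[q qE] /dvdzP[q' qE'].
    have : (N * j)%N%:Z - (N * j')%N%:Z = (q' - q) * (n * N)%N%:Z by move: qE qE'; clear; lia.
    rewrite !PoszM => h; have h' : j%:Z - j'%:Z = (q' - q) * n%:Z by move: h N0; clear; nia.
    move: h' jn jn'; move: (q' - q) => k; clear => h' jn jn'.
    have [hk|[hk|hk]] : k <= -1 \/ k = 0 \/ 1 <= k by lia.
    + by nia.
    + by rewrite hk in h'; lia.
    + by nia.
  by rewrite xx jj.
- by move=> l /lsP[j [x [_ /hmu[_ x0 _] ->]]]; rewrite mulf_neq0 ?pin0.
apply: oprod_eq => t; split=> [[t0 i1 i2 i3]|[l /lsP[j [x [jn hx ->]]]]].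
  have [x hx hxt] := h3 _ i2; have [x1 x0 wx] := hmu _ hx.
  have /dvdzP[q qE] := i1.
  have q0 : 0 <= q by move: i3; rewrite dv_w ?oner_neq0 // w1 qE; move: N0; clear; nia.
  pose j := (`|q| %% n)%N; have jn : (j < n)%N by rewrite ltn_pmod.
  exists (pi ^+ (N * j) * x).
    by apply/allpairsP; exists (j, x); rewrite mem_iota.
  have l0 : pi ^+ (N * j) * x != 0 by rewrite mulf_neq0 ?pin0.
  have [q' [q'0 qE']] : exists q' : int, 0 <= q' /\ q = q' * n%:Z + j%:Z.
    exists (`|q| %/ n)%N%:Z; split=> //; have := divn_eq `|q| n; rewrite -/j.
    by move: q0; clear; lia.
  have wtl : w (t / (pi ^+ (N * j) * x)) = q' * (n * N)%N%:Z.
    by rewrite w_div // wl // qE qE' !PoszM; ring.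
  split.
  - by rewrite mulf_neq0 ?invr_eq0.
  - by rewrite wtl dvdz_mull.
  - rewrite acM ?invr_eq0 // acV // acl // (_ : ac t / x - 1 = (ac t - x) / x); last by field.
    by apply: dv_mulr; rewrite 1?dvBC // dv_w ?oner_neq0 ?invr_eq0 // wV // wx w1.
  - by rewrite dv_w ?oner_neq0 ?mulf_neq0 ?invr_eq0 // w1 wtl mulr_ge0.
have [x1 x0 wx] := hmu _ hx; move=> [t0 i1 i2 i3].
have tt0 : t != 0 by move: t0; rewrite mulf_eq0 negb_or => /andP[].
have l0 : pi ^+ (N * j) * x != 0 by rewrite mulf_neq0 ?pin0.
have tE : t = t / (pi ^+ (N * j) * x) * (pi ^+ (N * j) * x) by rewrite divfK.
split=> //.
- rewrite tE wM // wl // rpredD //; first by apply: dvdz_trans i1; rewrite PoszM dvdz_mull.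
  by rewrite PoszM dvdz_mulr.
- rewrite tE acM // acl //; set u := ac _ in i2 *.
  rewrite (_ : u * x - 1 = (u - 1) * x + (x - 1)); last by ring.
  apply: dvD; last exact: h1.
  by apply: dv_mulr => //; apply: dv_trans i2; rewrite dv_pi2 leq_addr.
- by rewrite tE dv_mulr // dv_mull ?dv_pin.
Qed.

End Lines.

(** * Absorption: rays, O and K are the same up to bijection *)

Section Absorption.
Variable F : lfield.
Notation E := (nat -> F).
Implicit Types (e : E) (a b r s t x y : F) (N M k i j n m v : nat) (X Y D : obj F).
Implicit Types (W : uset F).

Lemma omulM n m X : iso (omul (n * m) X) (omul m (omul n X)).
Proof.
elim: m => [|m IH]; first by rewrite muln0; reflexivity.
by rewrite mulnS /=; apply: iso_trans (omulD _ _ _) _; apply: oadd_iso => //; exact: iso_refl.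
Qed.

Lemma ball_reps M v : exists mus : seq F, [/\ uniq mus,
  (forall x, x \in mus -> dv (pi ^+ M) (x - 1)),
  (forall x y, x \in mus -> y \in mus -> dv (pi ^+ (M + v)) (x - y) -> x = y) &
  (forall x, dv (pi ^+ M) (x - 1) -> exists2 y, y \in mus & dv (pi ^+ (M + v)) (y - x))].
Proof.
have [rs hrs] := int_finite F (M + v).
pose P x : Prop := dv (pi ^+ M) (x - 1).
have dM x : dv (pi ^+ (M + v)) x -> dv (pi ^+ M) x.
  by apply: dv_trans; rewrite dv_pi2 leq_addr.
have [x _|x y z|r|x hx|mus [h1 h2 h3 h4]] :=
  @transversal F (fun x y => dv (pi ^+ (M + v)) (x - y)) P [seq x <- rs | dv (pi ^+ M) (x - 1)].
- by rewrite subrr dv0.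
- by move=> h1 h2; rewrite (_ : y - z = (x - z) - (x - y)); [exact: dvB | ring].
- by rewrite mem_filter => /andP[].
- have hx1 : dv 1 x.
    by rewrite -(subrK 1 x) dvD ?dv_refl //; apply: dv_trans hx; exact: dv_pin.
  have [r rr hr] := hrs x hx1; exists r; last by rewrite dvBC.
  rewrite mem_filter rr andbT (_ : r - 1 = (x - 1) - (x - r)); last by ring.
  by apply: dvB => //; exact: dM.
- by exists mus; split=> // x /h2; rewrite mem_filter => /andP[].
Qed.

Lemma ray_mul D N M n v (N0 : (0 < N)%N) (M0 : (0 < M)%N) : (0 < n)%N ->
  w (n%:R : F) = v%:Z -> (v < M)%N -> exists2 x, (0 < x)%N &
  iso (oprod D (ray F N0 M0)) (omul (n * x) (oprod D (ray F N0 M0))).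
Proof.
move=> n0 wn vM; have [mus [h1 h2 h3 h4]] := ball_reps M v.
have Nn0 : (0 < n * N)%N by rewrite muln_gt0 n0.
have Mv0 : (0 < M + v)%N by rewrite addn_gt0 M0.
exists (size mus).
  by have [|y] := h4 1; [rewrite subrr dv0 | case: (mus)].
have e1 := ray_refine D N0 M0 n0 Nn0 Mv0 h1 h2 h3 h4.
apply: iso_trans e1 _; apply: omul_iso.
by apply: iso_sym; exact: ray_power wn vM.
Qed.

(** Since n is a unit, the power map keeps the precision M: there is one representative in [mus],
    and the number of cosets is exactly n. *)
Lemma ray_mul1 D N M n (N0 : (0 < N)%N) (M0 : (0 < M)%N) : (0 < n)%N ->
  w (n%:R : F) = 0%N%:Z ->
  iso (oprod D (ray F N0 M0)) (omul n (oprod D (ray F N0 M0))).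
Proof.
move=> n0 wn.
have Nn0 : (0 < n * N)%N by rewrite muln_gt0 n0.
have Mv0 : (0 < M + 0)%N by rewrite addn0.
have e1 : iso (oprod D (ray F N0 M0)) (omul (n * size [:: (1 : F)]) (oprod D (ray F Nn0 Mv0))).
  apply: ray_refine => // [x|x y|x hx].
  - by rewrite inE => /eqP ->; rewrite subrr dv0.
  - by rewrite !inE => /eqP -> /eqP ->.
  - by exists 1; rewrite ?inE // addn0 dvBC.
rewrite muln1 in e1; apply: iso_trans e1 _; apply: omul_iso.
by apply: iso_sym; exact: ray_power wn M0.
Qed.

(** a = (q + 1) a says that a absorbs q a, hence also x copies of q a; since a = q x a, this reads a
    + a = a, and no cancellation has been used. *)
Lemma ray_double D N M (N0 : (0 < N)%N) (M0 : (0 < M)%N) : w ((@resp F)%:R : F) < M%:Z ->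
  let A := oprod D (ray F N0 M0) in iso (oadd A A) A.
Proof.
move=> hM A; have p0 : (0 < @resp F)%N by apply: ltnW; exact: resp_gt1.
have [v hv] := nat_val F p0; rewrite hv ltz_nat in hM.
have [x x0 ex] := ray_mul D N0 M0 p0 hv hM.
have e1 : iso A (omul (@resp F).+1 A) by apply: ray_mul1 => //; exact: w_respS.
have e2 : iso (oadd A (omul x (omul (@resp F) A))) A by apply: omul_absorb; apply: iso_sym.
apply: iso_trans e2; apply: oadd_iso; first exact: iso_refl.
exact: iso_trans ex (omulM _ _ _).
Qed.

Lemma punit_sa : sa (fun e : E => e 0 = 0).
Proof. by apply: sa_eq0; exact: sf_var. Qed.
Definition upt : uset F := @USet F (fun t => t = 0) punit_sa.

Lemma uO0_sa : sa (fun e : E => dv 1 (e 0) /\ e 0 != 0).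
Proof. by apply: sa_and; [exact: uO_sa | apply: sa_neq0; exact: sf_var]. Qed.
Definition uO0 : uset F := @USet F (fun t => dv 1 t /\ t != 0) uO0_sa.

Lemma O_split D : iso (oprod D (uO F)) (oadd D (oprod D uO0)).
Proof.
apply: iso_trans (@oprod_split F D (uO F) upt uO0 _ _) _.
- move=> t; split=> [h|[->|[]//]]; last exact: dv0.
  by have [t0|t0] := eqVneq t 0; [left | right].
- by move=> t -> [_]; rewrite eqxx.
- apply: oadd_iso; last exact: iso_refl.
  by apply: (@ocell_point F D _ (fun _ => 0)); first exact: sf_const.
Qed.

Lemma O0_rays D N (N0 : (0 < N)%N) : exists2 n, (0 < n)%N &
  iso (oprod D uO0) (omul n (oprod D (ray F N0 N0))).
Proof.
have [rs [h1 h2 h3 h4]] := finite_cls F N0.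
exists (size rs).
  by have [r] := h4 1 (oner_neq0 _); case: (rs).
have key t l : l \in rs -> ray_pred N N (t / l) <-> cls N l t /\ dv 1 t.
  move=> lr; have [l0 /andP[l1 l2]] := h2 _ lr.
  have al0 : ac l != 0 by rewrite ac_neq0.
  split=> [[t0 i1 i2 i3]|[hc ht]].
    have tt0 : t != 0 by move: t0; rewrite mulf_eq0 negb_or => /andP[].
    rewrite w_div // in i1.
    split.
      rewrite cls_sym /cls l0 tt0 i1 /=.
      move: i2; rewrite acM ?invr_eq0 // acV // => i2.
      rewrite (_ : ac t - ac l = (ac t / ac l - 1) * ac l); last by field.
      by apply: dv_mulr => //; rewrite dv_w ?oner_neq0 // w_ac // w1.
    move: i3; rewrite !dv_w ?oner_neq0 // w1 w_div //; move: l1; clear; lia.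
  have /and4P[_ t0 i1 i2] := hc.
  split; first by rewrite mulf_neq0 ?invr_eq0.
  - by rewrite w_div // -rpredN opprB.
  - rewrite acM ?invr_eq0 // acV // (_ : ac t / ac l - 1 = (ac t - ac l) / ac l); last by field.
    by apply: dv_mulr; rewrite 1?dvBC // dv_w ?oner_neq0 ?invr_eq0 // wV // w_ac // w1.
  - move: ht; rewrite !dv_w ?oner_neq0 ?mulf_neq0 ?invr_eq0 // w1 w_div //.
    have /dvdzP[q qE] := i1; move: qE l1 l2; move: (w t) (w l); clear => u u' qE l1 l2 hu.
    have [hq|hq] : q <= 0 \/ 1 <= q by lia.
      by nia.
    by nia.
apply: iso_trans (oprod_big D (W := ray F N0 N0) h1 _ _).
- apply: oprod_eq => t; split=> [[ht t0]|[l lr /(key _ _ lr)[hc ht]]].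
    by have [l lr hl] := h4 t t0; exists l => //; apply/(key _ _ lr).
  by split=> //; case/and4P: hc.
- by move=> l /h2[].
- move=> l l' t lr lr' /(key _ _ lr)[hc _] /(key _ _ lr')[hc' _].
  by apply: h3 => //; apply: cls_trans hc _; rewrite cls_sym.
Qed.

(* The class a of a ray satisfies a = 2a = a + [O] and [O] = 1 + a, whence a = [O]
   absorbs both the point and itself. *)
Lemma O_absorb D : [/\ iso (oadd D (oprod D (uO F))) (oprod D (uO F)),
  iso (oadd (oprod D (uO F)) (oprod D (uO F))) (oprod D (uO F)),
  iso (oprod D uO0) (oprod D (uO F)) &
  forall N (N0 : (0 < N)%N), w ((@resp F)%:R : F) < N%:Z ->
    iso (oprod D (ray F N0 N0)) (oprod D (uO F))].
Proof.
set O := oprod D (uO F).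
have main N (N0 : (0 < N)%N) : w ((@resp F)%:R : F) < N%:Z ->
    let A := oprod D (ray F N0 N0) in [/\ iso A O, iso (oadd A A) A & iso (oprod D uO0) A].
  move=> hN A; have e2 : iso (oadd A A) A by exact: ray_double.
  have [n n0 en] := O0_rays D N0; rewrite -/A in en.
  have e3 : iso (oprod D uO0) A by apply: iso_trans en _; apply: omul_idem.
  have e4 : iso O (oadd D A).
    by apply: iso_trans (O_split D) _; apply: oadd_iso e3; exact: iso_refl.
  have e5 : iso A (oadd O A) by exact: ray_shift.
  split=> //; apply: iso_trans e5 _.
  apply: iso_trans (oadd_iso e4 (iso_refl A)) _.
  apply: iso_trans (iso_sym (oaddA _ _ _)) _.
  apply: iso_trans (oadd_iso (iso_refl D) e2) _; exact: iso_sym.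
have [v hv] := nat_val F (ltnW (@resp_gt1 F)).
have hN : w ((@resp F)%:R : F) < v.+1%:Z by rewrite hv ltz_nat.
have [e1 e2 e3] := main v.+1 (ltn0Sn v) hN.
set A := oprod D _ in e1 e2 e3.
have eO : iso O (oadd D A).
  by apply: iso_trans (O_split D) _; apply: oadd_iso e3; exact: iso_refl.
split.
- apply: iso_trans (iso_sym eO); apply: oadd_iso; first exact: iso_refl.
  exact: iso_sym.
- by apply: (iso_trans _ e1); apply: (iso_trans _ e2); apply: oadd_iso; apply: iso_sym.
- exact: iso_trans e3 e1.
- by move=> N N0 hN'; have [] := main N N0 hN'.
Qed.

Lemma K_O D : iso (oprod D (uK F)) (oprod D (uO F)).
Proof.
have nO_sa : sa (fun e : E => ~ dv 1 (e 0)) by apply: sa_not; exact: uO_sa.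
pose nO := @USet F (fun t => ~ dv 1 t) nO_sa.
have [h1 h2 h3 _] := O_absorb D.
apply: iso_trans h2; apply: iso_trans (@oprod_split F D _ (uO F) nO _ _) _.
- by move=> t; split=> // _; have [h|h] := pselect (dv 1 t); [left | right].
- by move=> t.
apply: oadd_iso; first exact: iso_refl.
(* A non-integral t has v(pi t) <= 0, so (pi t)^-1 runs through O minus 0. *)
apply: iso_trans h3; apply: (@oprod_iso _ _ _ _ (fun t => (pi * t)^-1)).
- by apply: sfV; apply: sfM; [exact: sf_const | exact: sf_var].
- move=> t /= ht; have t0 : t != 0 by apply: contra_notN ht => /eqP ->; exact: dv0.
  have pt0 : pi * t != 0 by rewrite mulf_neq0 ?pi_neq0.
  split; last by rewrite invr_eq0.
  move/negP: ht; rewrite !dv_w ?oner_neq0 ?invr_eq0 // w1 wV // wM ?pi_neq0 // w_pi.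
  by clear; lia.
- by move=> t t' _ _ /invr_inj /(mulfI pi_neq0).
- move=> u [hu u0]; exists (pi * u)^-1; last first.
    by rewrite invfM invrK mulrA mulVf ?pi_neq0 // mul1r.
  apply/negP; rewrite dv_w ?oner_neq0 ?invr_eq0 ?mulf_neq0 ?pi_neq0 // w1 wV ?mulf_neq0 ?pi_neq0 //.
  rewrite wM ?pi_neq0 // w_pi; move: hu; rewrite dv_w ?oner_neq0 // w1.
  by clear; lia.
Qed.

End Absorption.

(** * Cells and their endpoints *)

Section Cells.
Variable F : lfield.
Notation E := (nat -> F).
Implicit Types (e : E) (a b r s t x y : F) (N M k i j n m v : nat) (X Y D : obj F).
Implicit Types (A C : E -> F -> Prop) (g h z : E -> F).

Definition sap A := sa (fun e : E => A (tl e) (e 0)).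

Lemma mono_sap N A : (0 < N)%N -> mono N A -> sap A.
Proof.
move=> N0 hA; have p : pmap (@tl F) by pmaps.
exact: (sa_mono N0 (mono_comp hA p) (sf_var 0)).
Qed.

Lemma sap_exists A : sap A -> sa (fun e => exists t, A e t).
Proof.
move=> h; apply: sa_ext (sa_exists h) _ => e.
by split=> -[t ht]; exists t; move: ht; rewrite tl_scons.
Qed.

Lemma sap_forall A : sap A -> sa (fun e => forall t, A e t).
Proof.
move=> h; apply: sa_ext (sa_forall h) _ => e.
by split=> ht t; move: (ht t); rewrite tl_scons.
Qed.

Lemma sap_at A g : sap A -> sf g -> sa (fun e => A e (g e)).
Proof.
move=> h hg; apply: sa_ext (sa_sf h hg) _ => e; by rewrite tl_scons.
Qed.

Lemma sf_tlc g : sf g -> sf (fun e => g (tl e)).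
Proof. by move=> hg; apply: sf_comp hg _; pmaps. Qed.

Lemma sa_tl (S : E -> Prop) : sa S -> sa (fun e => S (tl e)).
Proof. by move=> hS; apply: sa_comp hS _; pmaps. Qed.

(** Where the fibre is empty the value is set to 0, so that the graph is definable everywhere and
    [sf_graph] applies. *)
Lemma sf_unique A : sap A -> (forall e t t', A e t -> A e t' -> t = t') ->
  exists2 g, sf g & forall e, (exists t, A e t) -> A e (g e).
Proof.
move=> hA hu.
have /choice [g hg] : forall e, exists t, ((exists t', A e t') -> A e t) /\ (~ (exists t', A e t') -> t = 0).
  move=> e; have [[t ht]|no] := pselect (exists t, A e t); first by exists t; split=> // -[]; exists t.
  by exists 0.
exists g => [|e /(hg e).1//].
apply: sf_graph; have h2 := sa_tl (sap_exists hA).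
apply: sa_ext (sa_or hA (sa_and (sa_not h2) (sa_eq0 (sf_var 0)))) _ => e.
have [h3 h4] := hg (tl e); split=> [[h|[no e0]]|e0].
- by apply: (hu (tl e) _ _ h); apply: h3; exists (e 0).
- by rewrite e0 h4.
- have [h|no] := pselect (exists t, A (tl e) t); first by left; rewrite e0; exact: h3.
  by right; split=> //; rewrite e0 h4.
Qed.

(* The point is the k-th root of z times a constant depending only on the class of z;
   it is pinned down by its class at a higher precision. *)
Lemma section N r z k : (0 < N)%N -> r != 0 -> (0 < k)%N -> sf z ->
  exists2 g, sf g & forall e, z e != 0 -> (exists s, cls N r s /\ w (s ^+ k) = w (z e)) ->
    cls N r (g e) /\ w (g e ^+ k) = w (z e).
Proof.
move=> N0 r0 k0 hz; have [v hv] := nat_val F k0.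
pose M := (N + v)%N; have vM : (v < M)%N by rewrite /M -add1n leq_add2r.
have M0 : (0 < M)%N by rewrite (leq_ltn_trans _ vM).
have Mv0 : (0 < M + v)%N by rewrite addn_gt0 M0.
have [rs [_ rs0 rsu hrs]] := finite_cls F Mv0.
have ar0 : ac r != 0 by rewrite ac_neq0.
pose A e t := (exists2 l, l \in rs & cls (M + v) l (z e) /\ t ^+ k = z e * (ac r ^+ k / ac l)) /\
  (t != 0 /\ dv (pi ^+ M) (ac t - ac r)).
have ball_cls (x y : F) : cls M x y -> (x != 0 /\ dv (pi ^+ M) (ac x - ac r)) ->
    (y != 0 /\ dv (pi ^+ M) (ac y - ac r)).
  move=> /and4P[_ y0 _ h] [_ h']; split=> //.
  by rewrite (_ : ac y - ac r = (ac x - ac r) - (ac x - ac y)); [exact: dvB | ring].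
have sA : sap A.
  apply: sa_and; last exact: (sa_clsW M0 ball_cls (sf_var 0)).
  apply: (@sa_bigor F _ rs (fun l e => cls (M + v) l (z (tl e)) /\ e 0 ^+ k = z (tl e) * (ac r ^+ k / ac l))).
  move=> l /rs0[l0 _]; apply: sa_and; first by apply: sa_cls => //; exact: sf_tlc.
  by apply: sa_eq; [apply/sfX/sf_var | apply: sfM; [exact: sf_tlc | exact: sf_const]].
have near1 t : t != 0 -> dv (pi ^+ M) (ac t - ac r) -> dv (pi ^+ M) (ac t / ac r - 1).
  move=> t0 h; rewrite (_ : ac t / ac r - 1 = (ac t - ac r) / ac r); last by field.
  by apply: dv_mulr => //; rewrite dv_w ?oner_neq0 ?invr_eq0 // wV // w_ac // w1.
have [|g sg hg] := sf_unique sA.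
  move=> e t t' [[l lr [hl1 hl2]] [t0 ht]] [[l' lr' [hl1' hl2']] [t0' ht']].
  have ll : l = l' by apply: rsu => //; apply: cls_trans hl1 _; rewrite cls_sym.
  have tk : t ^+ k = t' ^+ k by rewrite hl2 hl2' ll.
  have wE : w t = w t' by have := congr1 (@w F) tk; rewrite !wX //; move: k0; clear; nia.
  have aE : ac t / ac r = ac t' / ac r.
    apply: (pow1_inj k0 hv vM (near1 _ t0 ht) (near1 _ t0' ht')).
    by rewrite !expr_div_n -!acX // tk.
  by rewrite [t]acE [t' in RHS]acE wE -(divfK ar0 (ac t)) aE divfK.
exists g => // e z0 [s [hs hw]].
have s0 : s != 0 by case/and4P: hs.
have [l lr hl] := hrs _ z0; have [l0 _] := rs0 _ lr.
have al0 : ac l != 0 by rewrite ac_neq0.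
have az0 : ac (z e) != 0 by rewrite ac_neq0.
have [|u uE hu] := root1 (b := ac (z e) / ac l) k0 hv vM.
  rewrite (_ : _ - 1 = (ac (z e) - ac l) / ac l); last by field.
  apply: dv_mulr; last by rewrite dv_w ?oner_neq0 ?invr_eq0 // wV // w_ac // w1.
  by rewrite dvBC; case/and4P: hl.
have u0 : u != 0 by move: hu; rewrite -(prednK M0) => /unit1[].
have wu : w u = 0 by move: hu; rewrite -(prednK M0) => /unit1[].
have wz : w (z e) = w s * k%:Z by rewrite -hw wX.
have [|[l' lr' [hl1 hl2]] [g0 hga]] := hg e.
  have hp : (pi ^ w s : F) ^+ k = pi ^ (w s * k%:Z) by rewrite exprnP exprz_exp.
  exists (ac r * u * pi ^ w s); split.
    exists l => //; split=> //; rewrite !exprMn uE [z e in RHS]acE wz hp.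
    by set P := pi ^ _; move: (ac (z e)) (ac l) al0 (ac r ^+ k) P => a b b0 c P; field.
  split; first by rewrite !mulf_neq0 ?piz0.
  rewrite !acM ?mulf_neq0 ?piz0 // ac_piz mulr1 ac_piz mulr1 (ac_unit wu).
  by rewrite (_ : ac r * u - ac r = ac r * (u - 1)); [apply: dv_mull => //; rewrite dv_w ?oner_neq0 // w_ac // w1 | ring].
have wg : w (g e ^+ k) = w (z e).
  have [l0' _] := rs0 _ lr'; have al0' : ac l' != 0 by rewrite ac_neq0.
  rewrite hl2 wM ?mulf_neq0 ?expf_neq0 ?invr_eq0 // wM ?expf_neq0 ?invr_eq0 // wX // wV // !w_ac //.
  by clear; lia.
split=> //; rewrite /cls r0 g0 /=; apply/andP; split.
  have -> : w (g e) = w s by move: wg; rewrite wX // wz; move: k0; clear; nia.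
  by case/and4P: hs.
by rewrite dvBC; apply: dv_trans hga; rewrite dv_pi2 leq_addr.
Qed.

Lemma sf_first (ms : seq (E -> F)) A : (forall m : E -> F, m \in ms -> sf m) -> sap A ->
  exists2 g, sf g & forall e, (exists2 m : E -> F, m \in ms & A e (m e)) -> A e (g e).
Proof.
move=> hms hA; elim: ms hms => [|m ms IH] hms.
  by exists (fun _ => 0) => [|e []//]; exact: sf_const.
have [|g sg hg] := IH; first by move=> m' h; apply: hms; rewrite inE h orbT.
have sm : sf m by apply: hms; rewrite inE eqxx.
exists (fun e => if pselect (A e (m e)) then m e else g e).
  by apply: sf_if => //; exact: sap_at.
move=> e h; have [ha|na] := pselect (A e (m e)); first by rewrite pifT.
rewrite pifN //; apply: hg; case: h => m'; rewrite inE => /orP[/eqP->//|mm ha].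
by exists m'.
Qed.

Definition cell N r C := [/\ mono N C, r != 0, forall e s, C e s -> cls N r s /\ dv 1 s &
  forall e s s' s'', C e s -> C e s'' -> cls N r s' -> w s <= w s' -> w s' <= w s'' -> C e s'].

Lemma cell_same N r C e s s' : (0 < N)%N -> cell N r C -> C e s -> cls N r s' ->
  w s = w s' -> C e s'.
Proof.
move=> N0 [_ _ _ hc] hs hs' ws; apply: (hc e s s' s) => //; by rewrite ws.
Qed.

(** An extreme point of a cell is a boundary point for the step pi^(+-N), so its valuation is among
    those listed by [mono_boundary], and [section] realizes them inside the class of r. The lower
    end always exists because cells lie in O. *)
Lemma cell_ends N r C : (0 < N)%N -> cell N r C ->
  exists lo hi, [/\ sf lo, sf hi,
    forall e, (exists s, C e s) -> C e (lo e) /\ forall s, C e s -> w (lo e) <= w s &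
    forall e, (exists2 s, C e s & forall s', C e s' -> w s' <= w s) ->
      C e (hi e) /\ forall s, C e s -> w s <= w (hi e)].
Proof.
move=> N0 hC; have [hm r0 hcl hconv] := hC.
have [cs hcs hb] := mono_boundary N0 hm.
have C0 e s : C e s -> s != 0 by move=> /hcl[/and4P[]].
have /choice [f hf] : forall c : (E -> F) * nat, exists g, c \in cs -> sf g /\
    forall e, c.1 e != 0 -> (exists s, cls N r s /\ w (s ^+ c.2) = w (c.1 e)) ->
    cls N r (g e) /\ w (g e ^+ c.2) = w (c.1 e).
  move=> c; have [cc|nc] := boolP (c \in cs); last by exists c.1.
  by have [h1 h2] := hcs _ cc; have [g sg hg] := section N0 r0 h2 h1; exists g.
have near e s (i : int) : C e s -> `|i| = 1 -> ~ C e (s * pi ^ (N%:Z * i)) ->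
    exists2 g, g \in [seq f c | c <- cs] & C e (g e) /\ w (g e) = w s.
  move=> hs i1 hn; have [c cc [c0 hw]] := hb e s i (C0 e s hs) i1 hs hn.
  have [hsc _] := hcl _ _ hs; have [_ k0] := hcs _ cc.
  have [|h1 h2] := (hf c cc).2 e c0; first by exists s.
  have wE : w s = w (f c e).
    have g0 : f c e != 0 by case/and4P: h1.
    move: h2; rewrite -hw !wX //; last exact: C0 hs.
    by move=> h2; apply/esym; apply: (mulIf _ h2); rewrite eqz_nat -lt0n.
  exists (f c); first by apply/mapP; exists c.
  by split=> //; exact: cell_same hs h1 wE.
have hms g : g \in [seq f c | c <- cs] -> sf g.
  by move=> /mapP[c cc ->]; case: (hf c cc).
have sC : sap C by exact: mono_sap hm.
pose Lo e t := C e t /\ forall s, C e s -> dv t s.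
pose Hi e t := C e t /\ forall s, C e s -> dv s t.
have p1 : pmap (fun e : E => scons (e 0) (tl (tl e))) by pmaps.
have sLo : sap Lo.
  apply: sa_and => //; apply: sap_forall; apply: sa_imp; first exact: (sa_comp sC p1).
  by apply: sa_dv; [exact: (sf_var 1) | exact: sf_var].
have sHi : sap Hi.
  apply: sa_and => //; apply: sap_forall; apply: sa_imp; first exact: (sa_comp sC p1).
  by apply: sa_dv; [exact: sf_var | exact: (sf_var 1)].
have [lo slo hlo] := sf_first hms sLo.
have [hi shi hhi] := sf_first hms sHi.
exists lo, hi; split=> // [e [s hs]|e [s hs hmax]].
  have [s1 hs1 hmin] : exists2 s, C e s & forall s', C e s' -> w s <= w s'.
    move: {-1}(`|w s|%N) (leqnn `|w s|%N) => m; elim: m s hs => [|m IH] s hs hm0.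
    all: have ws : 0 <= w s by have [_] := hcl _ _ hs; rewrite dv_w ?oner_neq0 ?(C0 e s) // w1.
      exists s => // s' hs'; have : 0 <= w s' by have [_] := hcl _ _ hs'; rewrite dv_w ?oner_neq0 ?(C0 e s') // w1.
      by move: hm0 ws; clear; lia.
    have [[s' [hs' hlt]]|no] := pselect (exists s', C e s' /\ w s' < w s).
      by apply: (IH s' hs'); have := (hcl _ _ hs').2; rewrite dv_w ?oner_neq0 ?(C0 e s') // w1; move: hm0 hlt; clear; lia.
    by exists s => // s' hs'; rewrite leNgt; apply/negP => h; apply: no; exists s'.
  have [|g gg [hg wg]] := near e s1 (-1) hs1 (normrN1 _).
    move=> /hmin; rewrite wM ?piz0 ?(C0 e s1) // w_piz; move: N0; clear; lia.
  have [h1 h2] : Lo e (lo e).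
    apply: hlo; exists g => //; split=> // s' hs'.
    by rewrite dv_w ?(C0 e) // wg; exact: hmin.
  by split=> // s' hs'; rewrite -dv_w ?(C0 e) //; exact: h2.
have [|g gg [hg wg]] := near e s 1 hs (normr1 _).
  move=> /hmax; rewrite wM ?piz0 ?(C0 e s) // w_piz; move: N0; clear; lia.
have [h1 h2] : Hi e (hi e).
  apply: hhi; exists g => //; split=> // s' hs'.
  by rewrite dv_w ?(C0 e) // wg; exact: hmax.
by split=> // s' hs'; rewrite -dv_w ?(C0 e) //; exact: h2.
Qed.

Definition mkfib A (hA : sap A) : fibres F := @Fibres F A hA.

Lemma ray_cls N (N0 : (0 < N)%N) r (m s : F) : m != 0 -> cls N r m ->
  ray_pred N N (s / m) <-> cls N r s /\ w m <= w s.
Proof.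
move=> m0 hm; have am0 : ac m != 0 by rewrite ac_neq0.
have r0 : r != 0 by case/and4P: hm.
split=> [[t0 i1 i2 i3]|[hs ws]].
  have s0 : s != 0 by move: t0; rewrite mulf_eq0 negb_or => /andP[].
  split; last by move: i3; rewrite dv_w ?oner_neq0 // w1 w_div // subr_ge0.
  apply: cls_trans hm _; rewrite cls_sym /cls s0 m0 /=; apply/andP; split.
    by move: i1; rewrite w_div.
  move: i2; rewrite acM ?invr_eq0 // acV // => i2.
  rewrite (_ : ac s - ac m = (ac s / ac m - 1) * ac m); last by field.
  by apply: dv_mulr => //; rewrite dv_w ?oner_neq0 // w_ac // w1.
have s0 : s != 0 by case/and4P: hs.
have /and4P[_ _ i1 i2] : cls N s m by apply: cls_trans hm; rewrite cls_sym.
split; first by rewrite mulf_neq0 ?invr_eq0.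
- by rewrite w_div.
- rewrite acM ?invr_eq0 // acV // (_ : ac s / ac m - 1 = (ac s - ac m) / ac m); last by field.
  by apply: dv_mulr => //; rewrite dv_w ?oner_neq0 ?invr_eq0 // wV // w_ac // w1.
- by rewrite dv_w ?oner_neq0 ?mulf_neq0 ?invr_eq0 // w1 w_div // subr_ge0.
Qed.

(** Dividing by the lower end turns each fibre into the whole ray. *)
Lemma cell_unbounded D N r C (hC : sap C) (N0 : (0 < N)%N) : cell N r C ->
  (forall e, D e -> (exists s, C e s) /\ ~ exists2 s, C e s & forall s', C e s' -> w s' <= w s) ->
  iso (ocell D (mkfib hC)) (oprod D (ray F N0 N0)).
Proof.
move=> hc hD; have [lo [hi [slo _ hlo _]]] := cell_ends N0 hc.
have [hm r0 hcl hconv] := hc.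
have lo0 e : D e -> lo e != 0 by move=> /hD[/hlo[/hcl[/and4P[]]]].
have big e n : D e -> exists2 s, C e s & n%:Z <= w s.
  move=> de; elim: n => [|n [s hs hn]].
    have [[s hs] _] := hD e de; exists s => //; have [hs1 hs2] := hcl _ _ hs.
    have s0 : s != 0 by case/and4P: hs1.
    by move: hs2; rewrite dv_w ?oner_neq0 // w1.
  have [_ hno] := hD e de; apply: contrapT => no; apply: hno; exists s => // s' hs'.
  rewrite leNgt; apply/negP => h; apply: no; exists s' => //; move: hn h; clear; lia.
apply: (@ocell_iso F D _ _ (fun e s => s / lo e)) => /=.
- by apply: sf_div; [exact: sf_var | exact: sf_tlc].
- move=> e s de hs; have [h1 h2] := hlo e (hD e de).1.
  by apply/(ray_cls N0 _ (lo0 e de) (hcl _ _ h1).1); split; [exact: (hcl _ _ hs).1 | exact: h2].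
- by move=> e s s' de _ _ /(congr1 (fun x => x * lo e)); rewrite !divfK ?lo0.
- move=> e t de ht; exists (t * lo e); last by rewrite mulfK ?lo0.
  have [h1 h2] := hlo e (hD e de).1.
  have /(ray_cls N0 _ (lo0 e de) (hcl _ _ h1).1)[h3 h4] : ray_pred N N (t * lo e / lo e).
    by rewrite mulfK ?lo0.
  have [s hs hsn] := big e (absz (w (t * lo e))) de.
  by apply: hconv h1 hs h3 h4 _; apply: le_trans hsn; clear; lia.
Qed.

(* With c the class of a bounded cell scaled to start at 1 and a that of the whole ray
   over D: the complement of the cell in the ray is again a ray, so a = c + a; and c
   contains a ball, so c = c + [O] = c + a. *)
Lemma cell_bounded D N r C (hC : sap C) (N0 : (0 < N)%N) : w ((@resp F)%:R : F) < N%:Z ->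
  cell N r C ->
  (forall e, D e -> exists2 s, C e s & forall s', C e s' -> w s' <= w s) ->
  iso (ocell D (mkfib hC)) (oprod D (uO F)).
Proof.
move=> hN hc hD; have [lo [hi [slo shi hlo hhi]]] := cell_ends N0 hc.
have [hm r0 hcl hconv] := hc.
have hne e : D e -> exists s, C e s by move=> /hD[s hs _]; exists s.
have lo0 e : D e -> lo e != 0 by move=> /hne/hlo[/hcl[/and4P[]]].
have hi0 e : D e -> hi e != 0 by move=> /hD/hhi[/hcl[/and4P[]]].
pose ga e := hi e / lo e.
have sga : sf ga by exact: sf_div.
have ga0 e : D e -> ga e != 0 by move=> de; rewrite mulf_neq0 ?invr_eq0 ?lo0 ?hi0.
have gaR e : D e -> ray_pred N N (ga e).
  move=> de; have [h1 h2] := hlo e (hne e de); have [h3 h4] := hhi e (hD e de).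
  by apply/(ray_cls N0 _ (lo0 e de) (hcl _ _ h1).1); split; [exact: (hcl _ _ h3).1 | exact: h4].
have sray : sap (fun _ t => ray_pred N N t) by exact: ray_sa.
have sgt : sap (fun e t => dv t (ga e)) by apply: sa_dv; [exact: sf_var | exact: sf_tlc].
have sC' : sap (fun e t => ray_pred N N t /\ dv t (ga e)) by exact: sa_and.
have sC2 : sap (fun e t => ray_pred N N t /\ ~ dv t (ga e)) by apply: sa_and => //; exact: sa_not.
have sball : sap (fun e t => dv (pi ^+ N) (t - 1)).
  by apply: sa_dv; [exact: sf_const | apply: sfB; [exact: sf_var | exact: sf_const]].
have sC3 : sap (fun e t => (ray_pred N N t /\ dv t (ga e)) /\ ~ dv (pi ^+ N) (t - 1)).
  by apply: sa_and => //; exact: sa_not.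
have [_ OO _ RO] := O_absorb D.
set O := oprod D (uO F) in OO RO *.
pose A := oprod D (ray F N0 N0).
have AO : iso A O by exact: RO.
pose C' := ocell D (mkfib sC').
have CC' : iso (ocell D (mkfib hC)) C'.
  apply: (@ocell_iso F D _ _ (fun e s => s / lo e)) => /=.
  - by apply: sf_div; [exact: sf_var | exact: sf_tlc].
  - move=> e s de hs; have [h1 h2] := hlo e (hne e de).
    have s0 : s != 0 by have [/and4P[]] := hcl _ _ hs.
    split; first by apply/(ray_cls N0 _ (lo0 e de) (hcl _ _ h1).1); split; [exact: (hcl _ _ hs).1 | exact: h2].
    rewrite /ga dvM2r ?invr_eq0 ?lo0 // dv_w ?hi0 //; exact: (hhi e (hD e de)).2.
  - by move=> e s s' de _ _ /(congr1 (fun x => x * lo e)); rewrite !divfK ?lo0.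
  - move=> e t de [ht htg]; exists (t * lo e); last by rewrite mulfK ?lo0.
    have [h1 h2] := hlo e (hne e de); have [h5 _] := hhi e (hD e de).
    have /(ray_cls N0 _ (lo0 e de) (hcl _ _ h1).1)[h3 h4] : ray_pred N N (t * lo e / lo e).
      by rewrite mulfK ?lo0.
    apply: (hconv _ _ _ _ h1 h5 h3 h4); rewrite -dv_w ?hi0 //; last by case/and4P: h3.
    by move: htg; rewrite /ga -(dvM2r _ _ (lo0 e de)) divfK ?lo0.
(* The part of the ray above the cell starts one step pi^N after the top [ga e]; dividing by
   [ga e * pi ^+ N] makes it the whole ray again. *)
have e1 : iso A (oadd C' A).
  apply: iso_trans (@ocell_split F D (cfib (ray F N0 N0)) (mkfib sC') (mkfib sC2) _ _) _.
  - by move=> e t _ /=; split=> [h|[[]|[]]//]; have [h'|h'] := pselect (dv t (ga e)); [left|right].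
  - by move=> e t _ /= [_ h] [_ /(_ h)].
  apply: oadd_iso; first exact: iso_refl.
  have pg e : D e -> ga e * pi ^+ N != 0 by move=> de; rewrite mulf_neq0 ?pin0 ?ga0.
  have pgw e : D e -> w (ga e * pi ^+ N) = w (ga e) + N%:Z.
    by move=> de; rewrite wM ?pin0 ?ga0 // w_pin.
  have pgc e : D e -> cls N 1 (ga e * pi ^+ N).
    move=> de; have [_ i1 i2 _] := gaR e de.
    rewrite cls_sym /cls pg ?oner_neq0 //= pgw // w1 subr0 rpredD ?dvdzz //=.
    by rewrite acM ?pin0 ?ga0 // -[pi ^+ N]/(pi ^ N%:Z) ac_piz mulr1 (ac_unit (w1 F)).
  have rayc t : ray_pred N N t -> cls N 1 t.
    move=> [t0 i1 i2 _]; rewrite cls_sym /cls t0 oner_neq0 /= w1 subr0 i1 /=.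
    by rewrite (ac_unit (w1 F)).
  apply: (@ocell_iso F D _ _ (fun e t => t / (ga e * pi ^+ N))) => /=.
  - apply: sf_div; first exact: sf_var.
    by apply: sfM; [exact: sf_tlc | exact: sf_const].
  - move=> e t de [ht /negP htg]; apply/(ray_cls N0 _ (pg e de) (pgc e de)).
    split; first exact: rayc.
    have [t0 i1 _ _] := ht; have [_ j1 _ _] := gaR e de.
    rewrite pgw //; rewrite dv_w ?ga0 // -ltNge in htg.
    move: i1 j1 => /dvdzP[q qE] /dvdzP[q' qE']; rewrite qE qE' in htg *.
    have N1 := N0; move: N1 htg; clear => N1 h.
    have hq : q' + 1 <= q by nia.
    by nia.
  - by move=> e s s' de _ _ /(congr1 (fun x => x * (ga e * pi ^+ N))); rewrite !divfK ?pg.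
  - move=> e t de ht; exists (t * (ga e * pi ^+ N)); last by rewrite mulfK ?pg.
    have /(ray_cls N0 _ (pg e de) (pgc e de))[h3 h4] :
      ray_pred N N (t * (ga e * pi ^+ N) / (ga e * pi ^+ N)) by rewrite mulfK ?pg.
    have t0 : t * (ga e * pi ^+ N) != 0 by case/and4P: h3.
    have hw0 : 0 <= w (ga e).
      by have [_ _ _] := gaR e de; rewrite dv_w ?oner_neq0 ?ga0 // w1.
    rewrite pgw // in h4.
    split; last first.
      by apply/negP; rewrite dv_w ?ga0 // -ltNge; have N1 := N0; move: N1 h4; clear; lia.
    have c11 : cls N 1 (1 : F) by apply: cls_refl; exact: oner_neq0.
    rewrite -[X in ray_pred _ _ X]divr1.
    apply/(ray_cls N0 _ (oner_neq0 F) c11); split=> //.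
    by rewrite w1; move: h4 hw0; clear; lia.
have ball1 t : dv (pi ^+ N) (t - 1) -> [/\ dv 1 t, t != 0 & w t = 0].
  by rewrite -{1}(prednK N0); exact: unit1.
pose B := ocell D (mkfib sball).
have BO : iso B O.
  apply: (@ocell_iso F D _ _ (fun e t => (t - 1) / pi ^+ N)) => /=.
  - apply: sf_div; [apply: sfB; [exact: sf_var | exact: sf_const] | exact: sf_const].
  - by move=> e t _ h; rewrite -(dvM2r _ _ (pin0 F N)) divfK ?pin0 // mul1r.
  - move=> e t t' _ _ _ /(congr1 (fun x => x * pi ^+ N + 1)).
    by rewrite !divfK ?pin0 // !subrK.
  - move=> e t' _ h; exists (t' * pi ^+ N + 1); last by rewrite addrK mulfK ?pin0.
    by rewrite addrK dv_mull ?dv_refl.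
have e2 : iso C' (oadd (ocell D (mkfib sC3)) B).
  apply: (@ocell_split F D (mkfib sC') (mkfib sC3) (mkfib sball)) => [e t de|e t _] /=.
    split=> [h|[[]//|h]].
      by have [h'|h'] := pselect (dv (pi ^+ N) (t - 1)); [right|left].
    have [t1 t0 wt] := ball1 t h; have [g0 _ _ g1] := gaR e de; split.
      by split=> //; rewrite ?wt ?dvdz0 // ac_unit.
    by rewrite dv_w // wt; move: g1; rewrite dv_w ?oner_neq0 // w1.
  by move=> [_ h] /h.
(* The ball 1 + pi^N O is the lowest layer of the cell; it is a copy of O, and [O] = 2 [O]. *)
have e3 : iso C' (oadd C' O).
  apply: (iso_trans e2); apply: iso_sym.
  apply: iso_trans (oadd_iso e2 (iso_refl O)) _.
  apply: iso_trans (iso_sym (oaddA _ _ _)) _.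
  apply: oadd_iso; first exact: iso_refl.
  apply: iso_trans (oadd_iso BO (iso_refl O)) _.
  by apply: iso_trans OO _; apply: iso_sym.
apply: iso_trans CC' _; apply: iso_trans e3 _.
apply: iso_trans (oadd_iso (iso_refl C') (iso_sym AO)) _.
by apply: iso_trans (iso_sym e1) _.
Qed.

(** Boundedness of the fibre is a semialgebraic condition on the base, so the base is cut in two and
    both cases are added. *)
Lemma cell_iso D N r C (hC : sap C) : (0 < N)%N -> w ((@resp F)%:R : F) < N%:Z ->
  cell N r C -> (forall e, D e -> exists s, C e s) ->
  iso (ocell D (mkfib hC)) (oprod D (uO F)).
Proof.
move=> N0 hN hc hD.
pose Bd e := exists2 s, C e s & forall s', C e s' -> w s' <= w s.
have [_ _ hcl _] := hc.
have C0 e s : C e s -> s != 0 by move=> /hcl[/and4P[]].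
have p1 : pmap (fun e : E => scons (e 0) (tl (tl e))) by pmaps.
have sBd : sa Bd.
  have h : sa (fun e => exists t, C e t /\ forall s, C e s -> dv s t).
    apply: sap_exists; apply: sa_and => //; apply: sap_forall; apply: sa_imp; first exact: (sa_comp hC p1).
    by apply: sa_dv; [exact: sf_var | exact: (sf_var 1)].
  apply: sa_ext h _ => e; split=> [[t [h1 h2]]|[t h1 h2]]; exists t => //.
    by move=> s' hs'; rewrite -dv_w ?(C0 e) //; exact: h2.
  by split=> // s' hs'; rewrite dv_w ?(C0 e) //; exact: h2.
have sUb := sa_not sBd.
pose D1 := orestr D sBd; pose D2 := orestr D sUb.
have e1 : iso (ocell D1 (mkfib hC)) (oprod D1 (uO F)).
  by apply: (cell_bounded hC N0 hN hc) => e [].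
have e2 : iso (ocell D2 (mkfib hC)) (oprod D2 (uO F)).
  apply: iso_trans (cell_unbounded hC N0 hc _) _; last by have [_ _ _ h] := O_absorb D2; exact: h.
  by move=> e [de hn]; split=> //; exact: hD.
have sp (W : fibres F) : iso (ocell D W) (oadd (ocell D1 W) (ocell D2 W)).
  apply: iso_split => [e|e [[_ h] _] [[_ h'] _]]; last exact: h'.
  split=> [[h1 h2]|[[[h1 _] h2]|[[h1 _] h2]]] //.
  by have [h|h] := pselect (Bd (tl e)); [left|right].
apply: iso_trans (sp _) _; apply: iso_sym; apply: iso_trans (sp _) _.
by apply: oadd_iso; apply: iso_sym.
Qed.

End Cells.

(** * Classification up to bijection, and zero sets of polynomials *)

Section Classification.
Variable F : lfield.
Notation E := (nat -> F).
Implicit Types (e : E) (a b r s t x y : F) (N M k i j n m v : nat) (X Y D : obj F).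
Implicit Types (A C : E -> F -> Prop) (g h z : E -> F).

Lemma mono_inv N A : mono N A -> exists2 A', mono N A' &
  forall e s, s != 0 -> A' e s <-> A e s^-1.
Proof.
elim=> {A} [D hD|z k hz k0|M r MN r0|A B _ [A' hA eA] _ [B' hB eB]|A B _ [A' hA eA] _ [B' hB eB]|A _ [A' hA eA]].
- by exists (fun e _ => D e) => //; exact: mono_D.
- exists (fun e s => dv (z e * s ^+ k) (1 * s ^+ 0)); first by apply: mono_dv => //; exact: sf_const.
  move=> e s s0; have sk0 : s ^+ k != 0 by rewrite expf_neq0.
  by rewrite mul1r expr0 -[in X in _ <-> X](dvM2r _ _ sk0) exprVn mulVf.
- exists (fun _ s => cls M r^-1 s); first by apply: mono_C; rewrite ?invr_eq0.
  by move=> e s s0; split=> /clsV; rewrite invrK.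
- exists (fun e s => A' e s \/ B' e s); first exact: mono_or.
  by move=> e s s0; rewrite eA // eB.
- exists (fun e s => A' e s /\ B' e s); first exact: mono_and.
  by move=> e s s0; rewrite eA // eB.
- exists (fun e s => ~ A' e s); first exact: mono_not.
  by move=> e s s0; rewrite eA.
Qed.

Section Target.
(** The dissection serves two targets: with [P] always true it classifies all objects, and with
    [P e] saying that a polynomial vanishes on the whole line above e it bounds zero sets. Lines are
    needed only over a base where [P] holds. *)
Variables (D : obj F) (Q : obj F -> Prop) (P : E -> Prop).
Hypothesis Qiso : forall X Y, iso X Y -> Q X -> Q Y.
Hypothesis Qadd : forall X Y, Q X -> Q Y -> Q (oadd X Y).
Hypothesis Q0 : Q (oempty F).
Hypothesis Qbase : forall (S : E -> Prop) (hS : sa S), Q (orestr D hS).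
Hypothesis Qline : forall (S : E -> Prop) (hS : sa S), (forall e, D e -> S e -> P e) ->
  Q (oprod (orestr D hS) (uO F)).

Lemma Q_eq A B (hA : sap A) (hB : sap B) : (forall e t, D e -> A e t <-> B e t) ->
  Q (ocell D (mkfib hA)) -> Q (ocell D (mkfib hB)).
Proof.
move=> h; apply: Qiso; apply: iso_eq => e /=.
by split=> -[h1 h2]; split=> //; move: h2; apply h.
Qed.

Lemma Q_split A B C (hA : sap A) (hB : sap B) (hC : sap C) :
  (forall e t, D e -> C e t <-> A e t \/ B e t) -> (forall e t, D e -> A e t -> B e t -> False) ->
  Q (ocell D (mkfib hA)) -> Q (ocell D (mkfib hB)) -> Q (ocell D (mkfib hC)).
Proof.
move=> h1 h2 qA qB.
by apply: Qiso (iso_sym (@ocell_split _ D (mkfib hC) (mkfib hA) (mkfib hB) h1 h2)) (Qadd qA qB).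
Qed.

Lemma Q_bigor (I : eqType) (rs : seq I) (B : I -> E -> F -> Prop) C (hC : sap C) :
  (forall i : I, i \in rs -> exists hB : sap (B i), Q (ocell D (mkfib hB))) ->
  (forall e t, D e -> C e t <-> exists2 i : I, i \in rs & B i e t) ->
  (forall e t (i j : I), i \in rs -> j \in rs -> B i e t -> B j e t -> i = j) ->
  Q (ocell D (mkfib hC)).
Proof.
elim: rs C hC => [|a rs IH] C hC hB CE hd.
  apply: Qiso Q0; apply: iso_eq => e; split=> // -[/= /CE h /h[]] //.
have hB' (i : I) : i \in rs -> exists hB : sap (B i), Q (ocell D (mkfib hB)).
  by move=> ir; apply: hB; rewrite inE ir orbT.
have hd' e t (i j : I) : i \in rs -> j \in rs -> B i e t -> B j e t -> i = j.
  by move=> ir jr; apply: hd; rewrite inE ?ir ?jr orbT.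
have sB : sap (fun e t => exists2 i : I, i \in rs & B i e t).
  by apply: sa_bigor => i /hB'[].
have IH' : Q (ocell D (mkfib sB)) by apply: IH hB' _ hd'.
have [ar|nar] := boolP (a \in rs).
  apply: Q_eq IH' => e t /CE ->; split=> -[i ir Bi]; exists i => //.
    by rewrite inE ir orbT.
  by move: ir; rewrite inE => /orP[/eqP->|].
have [hBa Qa] := hB a (mem_head _ _).
apply: Q_split Qa IH' => e t de.
  rewrite CE //; split=> [[i]|[h|[i ir h]]].
  - by rewrite inE => /orP[/eqP-> h|ir h]; [left | right; exists i].
  - by exists a; rewrite ?inE ?eqxx.
  - by exists i; rewrite ?inE ?ir ?orbT.
move=> h1 [i ir h2]; have ai : a = i by apply: hd h1 h2; rewrite inE ?eqxx ?ir ?orbT.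
by rewrite ai ir in nar.
Qed.

Lemma cell_class N r C (hC : sap C) : (0 < N)%N -> w ((@resp F)%:R : F) < N%:Z ->
  cell N r C -> (forall e s, D e -> C e s -> P e) -> Q (ocell D (mkfib hC)).
Proof.
move=> N0 hN cC CP.
have hS := sap_exists hC; pose D1 := orestr D hS.
have h1 : iso (ocell D1 (mkfib hC)) (oprod D1 (uO F)).
  by apply: cell_iso N0 hN cC _ => e [].
apply: Qiso (Qline hS _) => [|e de [s] /CP]; last exact.
apply: iso_trans (iso_sym h1) _; apply: iso_eq => e /=.
by split=> [[[]]//|[de hc]]; split=> //; split=> //; exists (e 0).
Qed.

Lemma cells_class N r C A cs (hCA : sap (fun e s => C e s /\ A e s)) :
  (0 < N)%N -> w ((@resp F)%:R : F) < N%:Z ->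
  cell N r C -> mono N A -> sfs cs ->
  (forall e s s', C e s -> C e s' ->
    (forall c, c \in cs -> dv (c.1 e) (s ^+ c.2) = dv (c.1 e) (s' ^+ c.2)) ->
    A e s <-> A e s') ->
  (forall e s, D e -> C e s -> A e s -> P e) -> Q (ocell D (mkfib hCA)).
Proof.
move=> N0 hN + hA; elim: cs C hCA => [|[z k] cs IH] C hCA hC hcs hdec hP.
  apply: (@cell_class N r) => // [|e s de []]; last exact: hP.
  have [mC r0 h1 h2] := hC; split=> [||e s [/h1]|] //; first exact: mono_and.
  move=> e s s' s'' [cs1 as1] [cs2 as2] cl l1 l2.
  have c' : C e s' by apply: (h2 e s s' s'').
  split=> //; apply/(hdec e s s' cs1 c') => //.
have [sz k0] := hcs _ (mem_head _ _); rewrite /= in sz k0.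
have hcs' : sfs cs by move=> c cc; apply: hcs; rewrite inE cc orbT.
have [mC r0 h1 h2] := hC.
have mz : mono N (fun e s => dv (z e) (s ^+ k)) by exact: mono_B.
have C0 e s : C e s -> s != 0 by move=> /h1[/and4P[]].
have mono_dvz e s s' : C e s -> cls N r s' -> w s <= w s' ->
    dv (z e) (s ^+ k) -> dv (z e) (s' ^+ k).
  move=> hs hs' ws h; apply: dv_trans h _; have s0 := C0 _ _ hs.
  by apply: dvX; rewrite dv_w //; case/and4P: hs'.
have c1 : cell N r (fun e s => C e s /\ dv (z e) (s ^+ k)).
  split=> //; [exact: mono_and | by move=> e s [/h1] |].
  move=> e s s' s'' [a1 a2] [a3 a4] cl l1 l2; split; first exact: (h2 e s s' s'').
  exact: mono_dvz a1 cl l1 a2.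
have c2 : cell N r (fun e s => C e s /\ ~ dv (z e) (s ^+ k)).
  split=> //; [exact/mono_and/mono_not | by move=> e s [/h1] |].
  move=> e s s' s'' [a1 a2] [a3 a4] cl l1 l2.
  have c' : C e s' by apply: (h2 e s s' s'').
  split=> // h; apply: a4; apply: mono_dvz c' _ l2 h; exact: (h1 _ _ a3).1.
have s1 : sap (fun e s => (C e s /\ dv (z e) (s ^+ k)) /\ A e s).
  by apply: (mono_sap N0); apply: mono_and => //; case: c1.
have s2 : sap (fun e s => (C e s /\ ~ dv (z e) (s ^+ k)) /\ A e s).
  by apply: (mono_sap N0); apply: mono_and => //; case: c2.
apply: (Q_split (hA := s1) (hB := s2)).
- move=> e t _; split=> [[a1 a2]|[[[a1 _] a2]|[[a1 _] a2]]] //.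
  by have [h|h] := pselect (dv (z e) (t ^+ k)); [left|right].
- by move=> e t _ [[_ h] _] [[_ /(_ h)]].
- apply: IH c1 hcs' _ _ => [e s s' [a1 a2] [a3 a4] ag|e s de [a1 _]]; last exact: hP.
  by apply: hdec => // c; rewrite inE => /orP[/eqP->|/ag//]; rewrite /= a2 a4.
- apply: IH c2 hcs' _ _ => [e s s' [a1 a2] [a3 a4] ag|e s de [a1 _]]; last exact: hP.
  apply: hdec => // c; rewrite inE => /orP[/eqP->|/ag//] /=.
  by apply/idP/idP => h; [case: a2 | case: a4].
Qed.

Lemma mono_class_O N A (hA : sap A) : (0 < N)%N -> w ((@resp F)%:R : F) < N%:Z ->
  mono N A -> (forall e s, A e s -> dv 1 s /\ s != 0) ->
  (forall e s, D e -> A e s -> P e) -> Q (ocell D (mkfib hA)).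
Proof.
move=> N0 hN mA A0 hP.
have [rs [_ rs0 rsu hrs]] := finite_cls F N0.
have [cs hcs hdec] := mono_thresholds N0 mA.
have mO : mono N (fun (_ : E) s => dv 1 s).
  apply: mono_ext (@mono_B F N (fun _ => 1) 1 (sf_const 1) isT) _ => e s.
  by rewrite expr1.
pose C r := fun (_ : E) s => cls N r s /\ dv 1 s.
apply: (@Q_bigor _ rs (fun r e s => C r e s /\ A e s)).
- move=> r /rs0[r0 _].
  have cC : cell N r (C r).
    split=> //; first by apply: mono_and => //; exact: mono_C.
    move=> e s s' s'' [/and4P[_ s0 _ _] o1] _ cl l1 _; split=> //.
    apply: dv_trans o1 _; rewrite dv_w //; last by case/and4P: cl.
  have sC : sap (fun e s => C r e s /\ A e s).
    by apply: (mono_sap N0); apply: mono_and => //; case: cC.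
  exists sC; apply: (cells_class sC N0 hN cC mA hcs) => [e s s' [c1 _] [c2 _]|e s de _]; last exact: hP.
  by apply: hdec; apply: cls_trans c2; rewrite cls_sym.
- move=> e s _; split=> [h|[r _ []]//]; have [o s0] := A0 _ _ h.
  by have [r rr cr] := hrs s s0; exists r.
- move=> e s r r' rr rr' [[c1 _] _] [[c2 _] _]; apply: rsu => //.
  by apply: cls_trans c1 _; rewrite cls_sym.
Qed.

Lemma mono_class N A (hA : sap A) : (0 < N)%N -> mono N A ->
  (forall e s, D e -> A e s -> s != 0 -> P e) -> Q (ocell D (mkfib hA)).
Proof.
(* A multiple of N is also a level for [A]; it is taken beyond v(q), as [ray_double] requires. *)
wlog hN : N / w ((@resp F)%:R : F) < N%:Z => [hw|] N0 mA hP.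
  have NM : (N %| N * `|w ((@resp F)%:R : F)|.+1)%N by rewrite dvdn_mulr.
  apply: (hw (N * `|w ((@resp F)%:R : F)|.+1)%N) => //; last exact: mono_lift mA.
    by move: (w _) N0; clear; nia.
  by rewrite muln_gt0 N0.
have mO : mono N (fun (_ : E) s => dv 1 s).
  apply: mono_ext (@mono_B F N (fun _ => 1) 1 (sf_const 1) isT) _ => e s.
  by rewrite expr1.
have m0 : mono N (fun (_ : E) s => s = 0) by exact: mono_s0.
have m0' : mono N (fun (_ : E) s => s != 0) by exact: mono_sneq0.
have mA0 := mono_and m0 mA; have mA1 := mono_and (mono_and m0' mO) mA.
have mA2 := mono_and (mono_and m0' (mono_not mO)) mA.
have hA0 := mono_sap N0 mA0; have hA1 := mono_sap N0 mA1; have hA2 := mono_sap N0 mA2.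
have hA12 : sap (fun e s => s != 0 /\ A e s) by apply: (mono_sap N0); exact: mono_and.
apply: (Q_split (hA := hA0) (hB := hA12)).
- move=> e s _; split=> [h|[[]|[]]//].
  by have [s0|s0] := eqVneq s 0; [left|right].
- by move=> e s _ [-> _] []; rewrite eqxx.
- have hS : sa (fun e => A e 0) by apply: sap_at => //; exact: sf_const.
  apply: Qiso (Qbase hS); apply: iso_sym.
  apply: iso_trans (@ocell_point _ (orestr D hS) (mkfib hA0) (fun _ => 0) (sf_const 0) _).
    apply: iso_eq => e /=; split=> [[de [e0 h]]|[[de _] h]//].
    by split=> //; split=> //; rewrite -e0.
  by move=> e t [_ h] /=; split=> [[]//|->].
apply: (Q_split (hA := hA1) (hB := hA2)).
- move=> e s _; split=> [[h1 h2]|[[[h1 h2] h3]|[[h1 h2] h3]]] //.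
  by have [o|o] := pselect (dv 1 s); [left|right].
- by move=> e s _ [[_ h] _] [[_ /(_ h)]].
- apply: mono_class_O N0 hN mA1 _ _ => [e s [[]]//|e s de [[s0 _] h]]; exact: hP h s0.
(* The non-integral part is carried into O by inversion. *)
have [A' mA' eA'] := mono_inv mA2.
have mB := mono_and (mono_and m0' mO) mA'.
have hB := mono_sap N0 mB.
have : Q (ocell D (mkfib hB)).
  apply: mono_class_O N0 hN mB _ _ => [e s [[]]//|e s de [[s0 _]]] /eA' - /(_ s0)[[i0 _] h].
  exact: hP h i0.
apply: Qiso; apply: (@ocell_iso F D _ _ (fun e s => s^-1)) => /=.
- exact/sfV/sf_var.
- by move=> e s de [[s0 _]] /eA'; exact.
- by move=> e s s' _ _ _ /invr_inj.
- move=> e s de [[s0 o] h]; exists s^-1; last by rewrite invrK.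
  have i0 : s^-1 != 0 by rewrite invr_eq0.
  split; last by apply/eA' => //; rewrite invrK.
  split=> //; have ow : ~~ (0 <= w s) by rewrite -(w1 F) -dv_w ?oner_neq0 //; exact/negP.
  by rewrite dv_w ?oner_neq0 // w1 wV //; move: ow; clear; lia.
Qed.

End Target.

Lemma full_def n : definable n (@fin F n).
Proof. by split=> //; exists (fun _ => True) => //; exact: sa_const. Qed.
Definition full n : obj F := Obj (full_def n).

Lemma fibred_class n X (Q : obj F -> Prop) (P : E -> Prop) : odim X = n.+1 ->
  (forall X Y, iso X Y -> Q X -> Q Y) -> (forall X Y, Q X -> Q Y -> Q (oadd X Y)) ->
  Q (oempty F) -> (forall (S : E -> Prop) (hS : sa S), Q (orestr (full n) hS)) ->
  (forall (S : E -> Prop) (hS : sa S), (forall e, fin n e -> S e -> P e) ->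
    Q (oprod (orestr (full n) hS) (uO F))) ->
  (forall e (f : nat -> F), fin n e -> injective f -> (forall j, X (scons (f j) e)) -> P e) ->
  Q X.
Proof.
move=> dX Qiso Qadd Q0 Qb Ql hinf.
have [hf [S sS SE]] := odef X; rewrite dX in hf SE.
have [ps [hps psE psd]] := normal_form sS.
have hX : sap (fun e t => S (scons t e)).
  by apply: sa_ext sS _ => e; rewrite scons_tl.
have iX : iso (ocell (full n) (mkfib hX)) X.
  apply: iso_eq => e /=; rewrite scons_tl; split=> [[h1 h2]|h].
    by apply/SE => //; rewrite -[e]scons_tl; exact: fin_scons.
  by split; [exact/fin_tl/hf | apply/SE => //; exact: hf].
apply: (Qiso _ _ iX).
apply: (@Q_bigor (full n) Q Qiso Qadd Q0 _ ps (fun q e t => q.2 e (t - q.1 e))) => [q qp|e t _|e t q q' h1 h2]; last exact: psd.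
  have [sq [N N0 mq]] := hps q qp.
  have sB : sap (fun e t => q.2 e (t - q.1 e)).
    have p1 : pmap (@tl F) by pmaps.
    apply: (sa_mono N0 (mono_comp mq p1) (g := fun e => e 0 - q.1 (tl e))).
    by apply: sfB; [exact: sf_var | exact: sf_tlc].
  exists sB; have sq2 := mono_sap N0 mq.
  apply: (Qiso (ocell (full n) (mkfib sq2))).
    apply: (@ocell_iso F (full n) _ _ (fun e t => t + q.1 e)) => /=.
    - by apply: sfD; [exact: sf_var | exact: sf_tlc].
    - by move=> e t _; rewrite addrK.
    - by move=> e t t' _ _ _ /addIr.
    - by move=> e t _ h; exists (t - q.1 e); rewrite ?subrK.
  apply: (mono_class Qiso Qadd Q0 Qb Ql sq2 N0 mq) => e s de hs s0.
  (* A nonzero s in a monomial piece comes with all s (1 + pi^(N + j)), which share its leading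
     term: the fibre is infinite, and this is what yields [P e]. *)
  apply: (hinf e (fun j => s * (1 + pi ^+ (N + j)) + q.1 e) de) => [i j /addIr/(mulfI s0)/addrI|j].
    by move=> /(congr1 (@w F)); rewrite !w_pin => -[]; clear; lia.
  apply/SE; first exact: fin_scons.
  apply/psE; exists q => //; rewrite addrK.
  apply/(mono_sat e (s := s) (s' := s * (1 + pi ^+ (N + j))) N0 mq) => //.
  rewrite /rve (_ : s - _ = - (s * pi ^+ (N + j))); last by ring.
  by rewrite dvN mulrC dvM2l // dv_pi2 leq_addr.
exact: psE.
Qed.

Fixpoint Kpow k : obj F := if k is j.+1 then oprod (Kpow j) (uK F) else full 0.

(** Finite sets appear as multiples of the point K^0, which is why the exponent j starts at 1. *)
Definition nice k X := (exists m, iso X (omul m (Kpow 0))) \/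
  exists2 j, (1 <= j <= k)%N & iso X (Kpow j).

Lemma KpowS k : iso (Kpow k.+1) (oprod (Kpow k) (uO F)).
Proof. exact: K_O. Qed.

Lemma Kpow_double k : (0 < k)%N -> iso (oadd (Kpow k) (Kpow k)) (Kpow k).
Proof.
case: k => // k _; have [_ h _ _] := O_absorb (Kpow k).
apply: iso_trans (oadd_iso (KpowS k) (KpowS k)) _.
exact: iso_trans h (iso_sym (KpowS k)).
Qed.

Lemma Kpow_step k : iso (oadd (Kpow k) (Kpow k.+1)) (Kpow k.+1).
Proof.
have [h _ _ _] := O_absorb (Kpow k).
apply: iso_trans (oadd_iso (iso_refl _) (KpowS k)) _.
exact: iso_trans h (iso_sym (KpowS k)).
Qed.

Lemma Kpow_absorb i j : (i <= j)%N -> (0 < j)%N -> iso (oadd (Kpow i) (Kpow j)) (Kpow j).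
Proof.
move=> + j0; rewrite leq_eqVlt => /orP[/eqP->|]; first exact: Kpow_double.
case: j j0 => // j _; elim: j => [|j IH] ij.
  by move: ij; rewrite ltnS leqn0 => /eqP->; exact: Kpow_step.
move: ij; rewrite ltnS leq_eqVlt => /orP[/eqP->|ij]; first exact: Kpow_step.
apply: iso_trans (oadd_iso (iso_refl _) (iso_sym (Kpow_step _))) _.
apply: iso_trans (oaddA _ _ _) _.
apply: iso_trans (oadd_iso (IH ij) (iso_refl _)) _; exact: Kpow_step.
Qed.

Lemma nice_iso k X Y : iso X Y -> nice k X -> nice k Y.
Proof.
move=> /iso_sym h [[m hm]|[j jk hj]]; [left; exists m | right; exists j => //].
  exact: iso_trans h hm.
exact: iso_trans h hj.
Qed.

Lemma nice_le k k' X : (k <= k')%N -> nice k X -> nice k' X.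
Proof.
move=> kk [h|[j /andP[j1 jk] hj]]; [by left | right; exists j => //].
by rewrite j1 (leq_trans jk).
Qed.

Lemma nice_empty k : nice k (oempty F).
Proof. by left; exists 0; exact: iso_refl. Qed.

Lemma nice_add k X Y : nice k X -> nice k Y -> nice k (oadd X Y).
Proof.
have mixed m j Z : (0 < j)%N -> iso Z (Kpow j) -> iso (oadd (omul m (Kpow 0)) Z) (Kpow j).
  move=> j0 hZ; apply: iso_trans (oaddC _ _) _.
  apply: iso_trans (oadd_iso hZ (iso_refl _)) _.
  apply: omul_absorb; apply: iso_trans (oaddC _ _) _; exact: Kpow_absorb.
move=> [[m hX]|[i ik hX]] [[m' hY]|[j jk hY]].
- left; exists (m + m')%N; apply: iso_trans (oadd_iso hX hY) _.
  exact/iso_sym/omulD.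
- right; exists j => //; apply: iso_trans (oadd_iso hX (iso_refl _)) _.
  by apply: mixed => //; case/andP: jk.
- right; exists i => //; apply: iso_trans (oaddC _ _) _.
  apply: iso_trans (oadd_iso hY (iso_refl _)) _.
  by apply: mixed => //; case/andP: ik.
have [ij|/ltnW ij] := leqP i j; right.
  exists j => //; apply: iso_trans (oadd_iso hX hY) _.
  by apply: Kpow_absorb => //; case/andP: jk.
exists i => //; apply: iso_trans (oaddC _ _) _; apply: iso_trans (oadd_iso hY hX) _.
by apply: Kpow_absorb => //; case/andP: ik.
Qed.

Lemma nice_line k X : nice k X -> nice k.+1 (oprod X (uO F)).
Proof.
have base Y : iso X Y -> iso (oprod X (uO F)) (oprod Y (uO F)) by exact: ocell_iso_base.
move=> [[m /base hX]|[j /andP[_ jk] /base hX]]; last first.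
  right; exists j.+1; first by rewrite /= ltnS.
  exact: iso_trans hX (iso_sym (KpowS _)).
apply: nice_iso (iso_sym hX) _; elim: m {hX base} => [|m IH] /=.
  apply: nice_iso (nice_empty _); apply: iso_eq => e; split=> // -[]//.
apply: nice_iso (iso_sym (@ocell_oadd F _ _ (cfib (uO F)) _)) _ => //.
apply: nice_add IH; right; exists 1 => //; exact: iso_sym (KpowS 0).
Qed.

Theorem classification X : nice (odim X) X.
Proof.
move: {-1}(odim X) (erefl (odim X)) => n; elim: n X => [|n IH] X dX.
  have fX e : X e -> e = fun _ => 0.
    by move=> /obj_fin; rewrite dX => h; apply: funext => i; exact: h.
  have [h|no] := pselect (X (fun _ => 0)).
    left; exists 1; apply: iso_trans (iso_sym (oadd0r _)).
    apply: iso_eq => e; split=> [/fX->//|h']; rewrite (_ : e = fun _ => 0) //.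
    by apply: funext => i; exact: h'.
  left; exists 0; apply: iso_eq => e; split=> // h; have := h; rewrite (fX _ h); exact: no.
have IHr (S : E -> Prop) (hS : sa S) : nice n (orestr (full n) hS) by exact: IH.
apply: (@fibred_class n X (nice n.+1) (fun _ => True)) => //.
- exact: nice_iso.
- exact: nice_add.
- exact: nice_empty.
- by move=> S hS; apply: nice_le (IHr _ hS).
- by move=> S hS _; apply: nice_line; exact: IHr.
Qed.

(** If h vanishes at infinitely many points of the line above e, it vanishes on the whole line. Such
    e are zeros of h with its first coordinate frozen at that of a point where h is nonzero, a
    nonzero polynomial in one variable less; so the base loses a dimension by induction. *)
Lemma nice_zeros n X h : pf h -> odim X = n -> (exists2 e, fin n e & h e != 0) ->
  (forall e, X e -> h e = 0) -> (0 < n)%N -> nice n.-1 X.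
Proof.
elim: n X h => // n IH X h ph dX [e0 fe0 he0] hX _ /=.
pose P e := forall t, h (scons t e) = 0.
have IHr (S : E -> Prop) (hS : sa S) : nice n (orestr (full n) hS) by exact: (classification (orestr _ hS)).
apply: (@fibred_class n X (nice n) P) => //.
- exact: nice_iso.
- exact: nice_add.
- exact: nice_empty.
- move=> S hS SP; pose h' e := h (scons (e0 0) e).
  have ph' : pf h' by exact: (pf_comp ph (pmap_scons (pf_const (e0 0%N)) (@pmap_id F))).
  have he' : exists2 e, fin n e & h' e != 0.
    by exists (tl e0); [exact: fin_tl | rewrite /h' scons_tl].
  have SX e : orestr (full n) hS e -> h' e = 0 by move=> [fe /(SP _ fe)]; exact.
  (* With no variable left the base is empty, as h would vanish at its nonzero point. *)
  case: n IH dX fe0 IHr S hS SP he' SX => [|n] IH dX fe0 IHr S hS SP [e fe he'] SX.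
    apply: nice_iso (nice_empty _); apply: iso_eq => e1; split=> // -[[/= h1 /(SP _ h1)/(_ (e0 0)) h2] _].
    move: he'; rewrite -/(h' _) in h2; rewrite -[h' _]/(h' e).
    have -> : e = tl e1 by apply: funext => i; rewrite fe // h1.
    by rewrite h2 eqxx.
  apply: nice_line; apply: (IH _ h') => //; by exists e.
- move=> e f fe inj hf t.
  have [d [G [_ _ hG]]] := pf_fam ph; rewrite hG.
  have [->|G0] := eqVneq (G e) 0; first by rewrite horner0.
  have := @max_poly_roots _ (G e) (mkseq f (size (G e))) G0; rewrite size_mkseq ltnn.
  move=> H; suff : false by []; apply: H.
  - apply/allP => x /mapP[j _ ->]; rewrite /root -hG; apply/eqP/hX/hf.
  - by rewrite map_inj_uniq ?iota_uniq.
Qed.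

End Classification.

(** * Dimension *)

Section Dimension.
Variable F : lfield.
Notation E := (nat -> F).
Implicit Types (e x y : E) (a b r s t : F) (N M k i j n m v : nat) (X Y Z D : obj F).
Implicit Types (p h g : E -> F).

Definition near N e e' := forall i, dv (pi ^+ N) (e' i - e i).

Lemma near_le M N e e' : (M <= N)%N -> near N e e' -> near M e e'.
Proof. by move=> MN h i; apply: dv_trans (h i); rewrite dv_pi2. Qed.

Lemma near_refl N e : near N e e.
Proof. by move=> i; rewrite subrr dv0. Qed.

Lemma scale_O a : exists N, dv 1 (pi ^+ N * a).
Proof.
have [->|a0] := eqVneq a 0; first by exists 0; rewrite mulr0 dv0.
exists `|w a|%N; rewrite dv_w ?oner_neq0 ?mulf_neq0 ?pin0 // wM ?pin0 // w_pin w1.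
by clear; lia.
Qed.

Lemma dv_mul_scale M N a b : dv (pi ^+ (M + N)) a -> dv 1 (pi ^+ N * b) -> dv (pi ^+ M) (a * b).
Proof.
move=> h1 h2; rewrite -(dvM2r _ _ (pin0 F N)) -exprD -[pi ^+ (M + N)]mulr1.
by rewrite (_ : a * b * _ = a * (pi ^+ N * b)); [exact: dvM | ring].
Qed.

Lemma pf_near p e M : pf p -> exists N, forall e', near N e e' -> dv (pi ^+ M) (p e' - p e).
Proof.
move=> hp; elim: hp M => [a|i|p1 p2 _ IH1 _ IH2|p1 p2 _ IH1 _ IH2] M.
- by exists 0 => e' _; rewrite subrr dv0.
- by exists M => e' /(_ i).
- have [N1 h1] := IH1 M; have [N2 h2] := IH2 M; exists (maxn N1 N2) => e' h.
  rewrite opprD addrACA dvD // ?h1 ?h2 //; apply: near_le h; rewrite ?leq_maxl ?leq_maxr //.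
have [A hA] := scale_O (p1 e); have [B hB] := scale_O (p2 e).
have [N1 h1] := IH1 (M + B)%N; have [N2 h2] := IH2 (M + A)%N.
exists (maxn N1 N2) => e' h.
have {}h1 : dv (pi ^+ (M + B)) (p1 e' - p1 e) by apply/h1/near_le/h/leq_maxl.
have {}h2 : dv (pi ^+ (M + A)) (p2 e' - p2 e) by apply/h2/near_le/h/leq_maxr.
rewrite (_ : _ - _ = (p1 e' - p1 e) * p2 e + (p1 e' - p1 e) * (p2 e' - p2 e) +
  (p2 e' - p2 e) * p1 e); last by ring.
apply: dvD; last exact: dv_mul_scale h2 hA.
apply: dvD; first exact: dv_mul_scale h1 hB.
apply: dv_mulr; first by apply: dv_trans h1; rewrite dv_pi2 leq_addr.
by apply: dv_trans h2; exact: dv_pin.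
Qed.

Lemma pf_near_powers n p e : (0 < n)%N -> pf p -> p e != 0 -> exists N, forall e',
  near N e e' -> powers n (p e) <-> powers n (p e').
Proof.
move=> n0 hp pe0; have [M [M0 _ hM]] := powers_cls F n0.
have [N hN] := pf_near e (M + `|w (p e)|%N) hp; exists N => e' /hN h.
have : rve M (p e) (p e').
  rewrite /rve dvBC; apply: dv_trans h.
  rewrite dv_w ?mulf_neq0 ?pin0 // wM ?pin0 // !w_pin; move: (w _); clear; lia.
move=> /(rve_cls _ M0 pe0)[_ c]; split; apply: hM => //; by rewrite cls_sym.
Qed.

Lemma pf_line p e e' : pf p -> exists q : {poly F},
  forall t, p (fun i => e i + t * (e' i - e i)) = q.[t].
Proof.
elim=> [a|i|p1 p2 _ [q1 h1] _ [q2 h2]|p1 p2 _ [q1 h1] _ [q2 h2]].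
- by exists a%:P => t; rewrite hornerC.
- by exists ((e i)%:P + 'X * (e' i - e i)%:P) => t; rewrite !hornerE.
- by exists (q1 + q2) => t; rewrite hornerD h1 h2.
- by exists (q1 * q2) => t; rewrite hornerM h1 h2.
Qed.

Lemma pin_inj : injective (fun n => pi ^+ n : F).
Proof. by move=> i j /(congr1 (@w F)); rewrite !w_pin => -[]. Qed.

Lemma nonroot (q : {poly F}) : q != 0 -> exists t, q.[t] != 0.
Proof.
move=> q0; apply: contrapT => no.
have := @max_poly_roots _ q (mkseq (fun n => pi ^+ n) (size q)) q0; rewrite size_mkseq ltnn.
move=> H; suff : false by []; apply: H.
  apply/allP => x _; rewrite /root; apply: contrapT => /negP h; by apply: no; exists x.
by rewrite map_inj_uniq ?iota_uniq //; exact: pin_inj.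
Qed.

Definition nonzero k h := exists2 e, fin k e & h e != 0.

(** Both functions are restricted to the line through the two witnesses, where they are nonzero
    polynomials in t; their product has a nonroot because the field is infinite. *)
Lemma nonzero_mul k p h : pf p -> pf h -> nonzero k p -> nonzero k h ->
  nonzero k (fun e => p e * h e).
Proof.
move=> hp hh [e fe pe] [e' fe' he'].
have [q1 h1] := pf_line e e' hp; have [q2 h2] := pf_line e e' hh.
have l0 : (fun i => e i + 0 * (e' i - e i)) = e by apply: funext => i; ring.
have l1 : (fun i => e i + 1 * (e' i - e i)) = e' by apply: funext => i; ring.
have q10 : q1 != 0 by apply: contraNneq pe => q0; rewrite -l0 h1 q0 horner0.
have q20 : q2 != 0 by apply: contraNneq he' => q0; rewrite -l1 h2 q0 horner0.
have [t ht] := nonroot (mulf_neq0 q10 q20).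
exists (fun i => e i + t * (e' i - e i)); last by rewrite h1 h2 -hornerM.
by move=> i ki; rewrite fe // fe' // subrr mulr0 addr0.
Qed.

(** h is a product of the polynomials in the description that are not identically zero on K^k. Off
    its zeros each condition is locally constant, since P_n is a union of classes. *)
Lemma sa_generic k (S : E -> Prop) : sa S -> exists h, [/\ pf h, nonzero k h &
  forall e, fin k e -> h e != 0 -> exists N, forall e', fin k e' -> near N e e' -> S e <-> S e'].
Proof.
elim=> {S} [n p n0 hp|S S' _ [h [ph nh hh]] _ [h' [ph' nh' hh']]
  |S S' _ [h [ph nh hh]] _ [h' [ph' nh' hh']]|S _ [h [ph nh hh]]].
- have [np|np] := pselect (nonzero k p).
    exists p; split=> // e _ pe; have [N hN] := pf_near_powers n0 hp pe.
    by exists N => e' _; exact: hN.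
  (* A polynomial vanishing on all of K^k gives an empty condition there and contributes the factor
     1. *)
  have p0 e : fin k e -> p e = 0.
    by move=> fe; apply: contrapT => /eqP pe; apply: np; exists e.
  exists (fun _ => 1); split; first exact: pf_const.
    by exists (fun _ => 0) => //; exact: oner_neq0.
  by move=> e fe _; exists 0 => e' fe' _; rewrite !p0.
- exists (fun e => h e * h' e); split; [exact: pf_mul | exact: nonzero_mul |].
  move=> e fe; rewrite mulf_eq0 negb_or => /andP[/(hh _ fe)[N hN] /(hh' _ fe)[N' hN']].
  exists (maxn N N') => e' fe' hn.
  by rewrite (hN e') ?(hN' e') //; apply: near_le hn; rewrite ?leq_maxl ?leq_maxr.
- exists (fun e => h e * h' e); split; [exact: pf_mul | exact: nonzero_mul |].
  move=> e fe; rewrite mulf_eq0 negb_or => /andP[/(hh _ fe)[N hN] /(hh' _ fe)[N' hN']].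
  exists (maxn N N') => e' fe' hn.
  by rewrite (hN e') ?(hN' e') //; apply: near_le hn; rewrite ?leq_maxl ?leq_maxr.
exists h; split=> // e fe he; have [N hN] := hh _ fe he.
by exists N => e' fe' hn; rewrite (hN e').
Qed.

Definition ball k N e e' := fin k e' /\ near N e e'.

Lemma ball_or_zeros k X : odim X = k ->
  (exists e N, fin k e /\ forall e', ball k N e e' -> X e') \/
  exists h, [/\ pf h, nonzero k h & forall e, X e -> h e = 0].
Proof.
move=> dX; have [hf [S sS SE]] := odef X; rewrite dX in hf SE.
have [h [ph nh hh]] := sa_generic k sS.
have [[e [Xe he]]|no] := pselect (exists e, X e /\ h e != 0).
  left; have fe := hf _ Xe; have [N hN] := hh e fe he; exists e, N; split=> // e' [fe' ne'].
  by apply/SE/(hN e') => //; apply/SE.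
right; exists h; split=> // e Xe; apply: contrapT => /eqP he; by apply: no; exists e.
Qed.

Definition finite_obj X := exists l : seq E, forall e, X e -> e \in l.

Lemma finite_iso X Y : iso X Y -> finite_obj Y -> finite_obj X.
Proof.
move=> [R [_ h2 h3 h4 h5]] [l hl].
have /choice [f hf] : forall y, exists x : E, forall x', X x' -> Y y -> R x' y -> x' = x.
  move=> y; have [[x [Xx [Yy r]]]|no] := pselect (exists x, X x /\ Y y /\ R x y).
    by exists x => x' Xx' _ r'; exact: (h5 _ _ y).
  by exists y => x' Xx' Yy r; case: no; exists x'.
exists (map f l) => x Xx; have [y Yy r] := h2 x Xx.
by rewrite (hf y x) // map_f // hl.
Qed.

Lemma finite_mul m : finite_obj (omul m (Kpow F 0)).
Proof.
elim: m => [|m [l hl]]; first by exists [::].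
exists (scons 0 (fun _ => 0) :: map (scons 1) l) => e /oaddP[[a a0 ->]|[b /hl b0 ->]].
  rewrite (_ : a = fun _ => 0) ?mem_head //; apply: funext => i; exact: a0.
by rewrite inE map_f ?orbT.
Qed.

Lemma KpowP k e : Kpow F k e <-> fin k e.
Proof.
elim: k e => [|k IH] e //=; rewrite IH; split=> [[h _]|h]; last by split=> //; exact: fin_tl.
by rewrite -[e]scons_tl; exact: fin_scons.
Qed.

Lemma odim_Kpow k : odim (Kpow F k) = k.
Proof. by elim: k => //= k ->. Qed.

Lemma infinite_Kpow k : (0 < k)%N -> ~ finite_obj (Kpow F k).
Proof.
move=> k0 [l hl]; pose f n : E := scons (pi ^+ n) (fun _ => 0).
have fi : injective f by move=> i j /(congr1 (fun e => e 0)) /pin_inj.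
have := @uniq_leq_size _ (mkseq f (size l).+1) l; rewrite size_mkseq ltnn.
move=> H; suff : false by []; apply: H.
  by rewrite map_inj_uniq ?iota_uniq.
move=> e /mapP[i _ ->]; apply: hl; apply/KpowP => j kj.
by rewrite /f; case: j kj => // kj; move: k0; rewrite ltnNge kj.
Qed.

Section Image.
Variables (R : E -> E -> Prop) (X Y : obj F).
Hypothesis sR : sa2 R.

Lemma oimage_def (X' : obj F) : definable (odim Y) (fun y => Y y /\ exists2 x, X' x & R x y).
Proof.
have [hf [S sS SE]] := odef X'.
split=> [y [/obj_fin]//|]; have [_ [SY sSY SYE]] := odef Y.
exists (fun y => SY y /\ exists2 x, fin (odim X') x & S x /\ R x y).
  apply: sa_and => //.
  have p1 : pmap (@ev F) by pmaps.
  apply: sa_ext (sa_existsn (odim X') (sa_and (sa_comp sS p1) sR)) _ => e.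
  by split=> -[x hx h]; exists x => //; move: h; rewrite ev_mix od_mix.
move=> y fy; rewrite SYE //; split=> -[h1 [x h2]].
  by move=> r; split=> //; exists x; [exact: hf | split=> //; apply/SE => //; exact: hf].
by move=> [/(SE _ h2) h3 r]; split=> //; exists x.
Qed.

Definition oimage (X' : obj F) : obj F := Obj (oimage_def X').

Lemma oimage_iso (X' : obj F) :
  (forall x, X x -> exists2 y, Y y & R x y) ->
  (forall x y y', X x -> Y y -> Y y' -> R x y -> R x y' -> y = y') ->
  (forall x x' y, X x -> X x' -> Y y -> R x y -> R x' y -> x = x') ->
  (forall x, X' x -> X x) -> iso X' (oimage X').
Proof.
move=> h1 h2 h3 sub; exists R; split=> //.
- by move=> x X'x; have [y Yy r] := h1 x (sub _ X'x); exists y => //; split=> //; exists x.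
- by move=> y [_].
- by move=> x y y' /sub Xx [Yy _] [Yy' _]; exact: h2.
- by move=> x x' y /sub Xx /sub Xx' [Yy _]; exact: h3.
Qed.

End Image.

Lemma iso_sub X Y (X' : obj F) : iso X Y -> (forall x, X' x -> X x) ->
  exists2 Y', odim Y' = odim Y /\ (forall y, Y' y -> Y y) & iso X' Y'.
Proof.
move=> [R [sR h1 _ h2 h3]] sub; exists (oimage Y sR X'); last exact: oimage_iso h1 h2 h3 sub.
by split=> // y [].
Qed.

Lemma finite_inj (T : finType) (A : F -> Prop) (R : F -> T -> Prop) :
  (forall a, A a -> exists t : T, R a t) ->
  (forall a b (t : T), A a -> A b -> R a t -> R b t -> a = b) ->
  exists l : seq F, forall a, A a -> a \in l.
Proof.
move=> h1 h2.
have /choice [f hf] : forall t : T, exists a, forall b, A b -> R b t -> b = a.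
  move=> t; have [[a [Aa r]]|no] := pselect (exists a, A a /\ R a t).
    by exists a => b Ab rb; exact: (h2 _ _ t).
  by exists 0 => b Ab rb; case: no; exists b.
exists (map f (enum T)) => a Aa; have [t r] := h1 a Aa.
by rewrite (hf t a) // map_f // mem_enum.
Qed.

(** Nested balls: a pair holds a center and the exponent of a radius, and step n shrinks the ball
    until it avoids the finite list [l n]. Completeness supplies the common point. *)
Lemma uncountable (l : nat -> seq F) : exists a, forall n, a \notin l n.
Proof.
have next n (c : F * nat) : exists c' : F * nat, [/\ (c.2 < c'.2)%N, dv (pi ^+ c.2) (c'.1 - c.1) &
    forall a, a \in l n -> ~~ dv (pi ^+ c'.2) (a - c'.1)].
  have [j hj] : exists j, c.1 + pi ^+ (c.2 + j) \notin l n.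
    apply: contrapT => no.
    have := @uniq_leq_size _ (mkseq (fun j => c.1 + pi ^+ (c.2 + j)) (size (l n)).+1) (l n).
    rewrite size_mkseq ltnn => H; suff : false by []; apply: H.
      rewrite map_inj_uniq ?iota_uniq // => i j /addrI/pin_inj; clear; lia.
    by move=> x /mapP[j _ ->]; apply: contrapT => /negP h; apply: no; exists j.
  set u := c.1 + _ in hj.
  have [M [cM hM]] : exists M, (c.2 < M)%N /\ forall a, a \in l n -> ~~ dv (pi ^+ M) (a - u).
    elim: (l n) hj => [|a s IH]; first by exists c.2.+1.
    rewrite inE negb_or => /andP[ua /IH[M [cM hM]]].
    have au : a - u != 0 by rewrite subr_eq0 eq_sym.
    exists (maxn M (absz (w (a - u))).+1); split=> [|b]; first by rewrite leq_max cM.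
    rewrite inE => /orP[/eqP->|/hM]; last first.
      by apply: contraNN => h; apply: dv_trans h; rewrite dv_pi2 leq_maxl.
    rewrite dv_w ?pin0 // w_pin -ltNge; move: (w _); clear; lia.
  exists (u, M); split=> //=; rewrite /u addrC addKr dv_pi2 leq_addr //.
have /choice [f hf] : forall nc : nat * (F * nat), exists c' : F * nat,
    [/\ (nc.2.2 < c'.2)%N, dv (pi ^+ nc.2.2) (c'.1 - nc.2.1) &
    forall a, a \in l nc.1 -> ~~ dv (pi ^+ c'.2) (a - c'.1)] by move=> [n c]; exact: next.
pose c := fix c n : F * nat := if n is m.+1 then f (m, c m) else (0, 0%N).
have cS n : [/\ ((c n).2 < (c n.+1).2)%N, dv (pi ^+ (c n).2) ((c n.+1).1 - (c n).1) &
    forall a, a \in l n -> ~~ dv (pi ^+ (c n.+1).2) (a - (c n.+1).1)] := hf (n, c n).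
have cge n : (n <= (c n).2)%N.
  by elim: n => // n IH; have [h _ _] := cS n; exact: leq_ltn_trans IH h.
have [n|a ha] := @lf_complete F (fun n => (c n).1).
  have [_ h _] := cS n; apply: dv_trans h; change (dv (pi ^+ n : F) (pi ^+ (c n).2)).
  by rewrite dv_pi2.
exists a => n; apply/negP => al; have [_ _ /(_ a al)/negP] := cS n; apply.
have mono_c i : ((c n.+1).2 <= (c (n.+1 + i)%N).2)%N.
  elim: i => [|i IH]; rewrite ?addn0 // addnS; have [h _ _] := cS (n.+1 + i)%N.
  exact: leq_trans IH (ltnW h).
have close i : dv (pi ^+ (c n.+1).2) ((c (n.+1 + i)%N).1 - (c n.+1).1).
  elim: i => [|i IH]; first by rewrite addn0 subrr dv0.
  rewrite addnS; have [_ h _] := cS (n.+1 + i)%N.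
  rewrite (_ : _ - _ = ((c (n.+1 + i).+1%N).1 - (c (n.+1 + i)%N).1) +
    ((c (n.+1 + i)%N).1 - (c n.+1).1)); last by ring.
  by apply: dvD IH; apply: dv_trans h; rewrite dv_pi2.
set M := (c n.+1).2.
rewrite (_ : a - _ = ((c (n.+1 + M)%N).1 - (c n.+1).1) - ((c (n.+1 + M)%N).1 - a)); last by ring.
apply: dvB (close M) _; apply: dv_trans (ha (n.+1 + M)%N).
change (dv (pi ^+ M : F) (pi ^+ (n.+1 + M)%N)); by rewrite dv_pi2 leq_addl.
Qed.

(** Two balls whose centers agree modulo pi^N meet, so they carry the same label. As pi^N e is
    integral, it has finitely many residues modulo pi^(N+N), and these determine e modulo pi^N. *)
Lemma finite_balls k N (A : F -> Prop) (B : F -> E -> Prop) :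
  (forall a, A a -> exists e, [/\ fin k e, forall i, dv 1 (pi ^+ N * e i) &
    forall e', ball k N e e' -> B a e']) ->
  (forall a b e, B a e -> B b e -> a = b) -> exists l : seq F, forall a, A a -> a \in l.
Proof.
move=> hA hB; have [rs hrs] := @lf_finite F (N + N).
pose R a (t : {ffun 'I_k -> 'I_(size rs)}) := exists e, [/\ fin k e,
  forall i : 'I_k, dv (pi ^+ (N + N)) (pi ^+ N * e i - rs`_(t i)) &
  forall e', ball k N e e' -> B a e'].
apply: (@finite_inj _ A R) => [a /hA[e [fe Oe be]]|a b t _ _ [e [fe he be]] [e' [fe' he' be']]].
  have /choice [f hf] : forall i : 'I_k, exists j : 'I_(size rs),
      dv (pi ^+ (N + N)) (pi ^+ N * e i - rs`_j).
    move=> i; have [r rr hr] := hrs _ (Oe i).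
    have ir : (index r rs < size rs)%N by rewrite index_mem.
    by exists (Ordinal ir); rewrite /= nth_index.
  by exists [ffun i => f i], e; split=> // i; rewrite ffunE.
have nn : near N e e'.
  move=> i; have [ki|ik] := leqP k i; first by rewrite fe // fe' // subrr dv0.
  rewrite -(dvM2l _ _ (pin0 F N)) -exprD.
  rewrite (_ : _ * _ = (pi ^+ N * e' i - rs`_(t (Ordinal ik))) -
    (pi ^+ N * e i - rs`_(t (Ordinal ik)))); last by ring.
  by apply: dvB; [exact: (he' (Ordinal ik)) | exact: (he (Ordinal ik))].
by apply: (hB a b e'); [apply: be | apply: be'; split=> //; exact: near_refl].
Qed.

(* The images of the hyperplanes e 0 = a are disjoint; if each contained a ball, the
   field would be a countable union of finite sets, as only finitely many balls of
   given radius lie in a bounded region. *)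
Theorem dim_unique j Z : iso (Kpow F j) Z -> (j <= odim Z)%N.
Proof.
move: {2}(odim Z) (erefl (odim Z)) => k; elim/ltn_ind: k j Z => k IH j Z dZ iZ.
rewrite dZ leqNgt; apply/negP; case: j iZ => // j iZ; rewrite ltnS => kj.
have [k0|k0] := posnP k.
  apply: (@infinite_Kpow j.+1) => //; apply: finite_iso iZ _; exists [:: fun _ => 0] => e /obj_fin.
  by rewrite dZ k0 inE => h; apply/eqP/funext => i; exact: h.
have [R [sR h1 _ h2 h3]] := iZ.
have sl a : sa (fun e : E => e 0 = a) by apply: sa_eq; [exact: sf_var | exact: sf_const].
pose sli a := orestr (Kpow F j.+1) (sl a).
pose Y a := oimage Z sR (sli a).
have iY a : iso (Kpow F j) (Y a).
  apply: iso_trans (oimage_iso sR h1 h2 h3 _) => [|e []//].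
  apply: iso_sym; apply: iso_trans (@ocell_point F _ (mkfib (A := fun _ t => t = a) (sl a)) (fun _ => a) (sf_const a) _) => //.
  by apply: iso_eq => e /=; split=> [[[]]|[]].
have Yinj a b e : Y a e -> Y b e -> a = b.
  move=> [Ze [x [Xx <-] r]] [_ [x' [Xx' <-] r']]; by rewrite (h3 _ _ _ Xx Xx' Ze r r').
have Yball a : exists e N, fin k e /\ forall e', ball k N e e' -> Y a e'.
  have [//|[h [ph nh hh]]] := @ball_or_zeros k (Y a) dZ; exfalso.
  have [[m hm]|[i /andP[i1 ik] hi]] := @nice_zeros F k (Y a) h ph dZ nh hh k0.
    apply: (@infinite_Kpow j); first exact: leq_trans k0 kj.
    apply: finite_iso (iY a) _; apply: finite_iso hm _; exact: finite_mul.
  have ik' : (i < k)%N by rewrite -(prednK k0) ltnS.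
  have := IH i ik' j (Kpow F i) (odim_Kpow i) (iso_trans (iY a) hi); rewrite odim_Kpow.
  by rewrite leqNgt (leq_trans ik' kj).
pose A N a := exists e, [/\ fin k e, forall i, dv 1 (pi ^+ N * e i) &
    forall e', ball k N e e' -> Y a e'].
have /choice [l hl] : forall N, exists l : seq F, forall a, A N a -> a \in l.
  by move=> N; apply: (@finite_balls k N (A N) (fun a => car (Y a))) => // a.
have [a ha] := uncountable l.
have [e [N [fe he]]] := Yball a.
(* The ball may be shrunk, so N can be enlarged until pi^N e is integral; this puts a into one of
   the finite lists [l N]. *)
have [M hM] : exists M, forall i, dv 1 (pi ^+ M * e i).
  have [M hM] : exists M, forall i, (i < k)%N -> dv 1 (pi ^+ M * e i).
    elim: (k) => [|n [M hM]]; first by exists 0.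
    have [M' hM'] := scale_O (e n); exists (M + M')%N => i; rewrite ltnS leq_eqVlt => /orP[/eqP->|i_n].
      by rewrite exprD -mulrA dv_mull ?dv_pin.
    by rewrite addnC exprD -mulrA dv_mull ?dv_pin ?hM.
  exists M => i; have [ik|ki] := ltnP i k; first exact: hM.
  by rewrite fe // mulr0 dv0.
move/negP: (ha (maxn N M)); apply; apply: hl; exists e; split=> // [i|e' [fe' ne']].
  by rewrite -(subnKC (leq_maxr N M)) addnC exprD -mulrA dv_mull ?dv_pin.
by apply: he; split=> //; apply: near_le ne'; exact: leq_maxl.
Qed.

Lemma disc_def k N c : definable k (fun e : E => fin k e /\ forall i, (i < k)%N -> dv (pi ^+ N) (e i - c i)).
Proof.
split=> [e []//|]; exists (fun e => forall i, (i < k)%N -> dv (pi ^+ N) (e i - c i)).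
  apply: sa_bounded_all => i _; apply: sa_dv; first exact: sf_const.
  by apply: sfB; [exact: sf_var | exact: sf_const].
by move=> e fe; split=> [[]|].
Qed.
Definition disc k N c : obj F := Obj (disc_def k N c).

(** Affine changes of the coordinates reduce the disc to O^k, and [O] = [K]. Thus every open subset
    of K^k contains a copy of K^k. *)
Lemma disc_Kpow k N c : iso (Kpow F k) (disc k N c).
Proof.
elim: k c => [|k IH] c; first by apply: iso_eq => e /=; split=> [|[]].
apply: iso_trans (KpowS F k) _.
have base Y X : iso X Y -> iso (oprod X (uO F)) (oprod Y (uO F)) by exact: ocell_iso_base.
apply: iso_trans (base _ _ (IH (tl c))) _.
have pN0 := pin0 F N.
pose f e := scons (e 0 * pi ^+ N + c 0%N) (tl e).
pose g e := scons ((e 0 - c 0%N) / pi ^+ N) (tl e).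
apply: (@iso_fun2 _ _ _ f g) => [i _|e [[/= fe he] o]|e [/= fe he]].
- apply: sf_scons => [|i']; last exact: sf_tl.
  by apply: sfD; [apply: sfM; [exact: sf_var | exact: sf_const] | exact: sf_const].
- split; last by rewrite /g /f tl_scons scons0 addrK mulfK // scons_tl.
  split; first exact: fin_scons.
  case=> [_|i]; last by rewrite ltnS => /he.
  by rewrite /f scons0 addrK dv_mull ?dv_refl.
split; last by rewrite /g /f tl_scons scons0 divfK // subrK scons_tl.
rewrite /g /= tl_scons; split; last by rewrite -(dvM2r _ _ pN0) divfK // mul1r; exact: (he 0).
by split; [exact: fin_tl | move=> i ik; exact: (he i.+1)].
Qed.

End Dimension.

(** * Finite extensions of Qp are local fields *)

Section ExtendedValuation.
Variables (K : fieldType) (v : K -> \bar int).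
Hypothesis hv : valuation v.
Implicit Types (x y a b : K) (N M n m : int).

Definition vge N x := (N%:E <= v x)%E.

Lemma v_fin x : x != 0 -> exists n, v x = n%:E.
Proof.
move=> x0; case E : (v x) => [n||]; first by exists n.
  by move/(valuation_eqy hv): E x0 => ->; rewrite eqxx.
by have := valuation_neqNy hv x; rewrite E.
Qed.

Lemma vge0 N : vge N 0.
Proof. by rewrite /vge (proj2 (valuation_eqy hv 0)) // leey. Qed.

Lemma vge_le M N x : M <= N -> vge N x -> vge M x.
Proof. by move=> h; apply: Order.POrderTheory.le_trans; rewrite lee_fin. Qed.

Lemma vgeD N x y : vge N x -> vge N y -> vge N (x + y).
Proof.
move=> hx hy; apply: Order.POrderTheory.le_trans (valuationD hv x y).
by rewrite Order.TotalTheory.le_min; apply/andP.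
Qed.

Lemma vge_fin N n x : v x = n%:E -> vge N x = (N <= n).
Proof. by move=> h; rewrite /vge h lee_fin. Qed.

Lemma v_neq0 n x : v x = n%:E -> x != 0.
Proof. by move=> h; apply/eqP => /(valuation_eqy hv); rewrite h. Qed.

Lemma vM n m x y : v x = n%:E -> v y = m%:E -> v (x * y) = (n + m)%:E.
Proof. by move=> hx hy; rewrite (valuationM hv) hx hy. Qed.

Lemma v1 : v 1 = 0%:E.
Proof.
have [n hn] := v_fin (oner_neq0 K); rewrite hn.
have := vM hn hn; rewrite mulr1 hn => -[]; move=> h; congr (_%:E); move: h; clear; lia.
Qed.

Lemma vV n x : v x = n%:E -> v x^-1 = (- n)%:E.
Proof.
move=> hx; have x0 := v_neq0 hx; have [m hm] := v_fin (invr_neq0 x0); rewrite hm.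
have := vM hx hm; rewrite divff // v1 => -[] h; congr (_%:E); move: h; clear; lia.
Qed.

Lemma vX n x (i : nat) : v x = n%:E -> v (x ^+ i) = (n * i%:Z)%:E.
Proof.
move=> hx; elim: i => [|i IH]; first by rewrite expr0 mulr0 v1.
by rewrite exprS (vM hx IH); congr (_%:E); clear; lia.
Qed.

Lemma vN1 : v (-1) = 0%:E.
Proof.
have [|n hn] := @v_fin (-1); first by rewrite oppr_eq0 oner_neq0.
have := vM hn hn; rewrite mulrNN mulr1 v1 hn => -[] h; congr (_%:E); move: h; clear; lia.
Qed.

Lemma vge_mul a n N x : v a = n%:E -> vge (n + N) (a * x) = vge N x.
Proof.
move=> ha; have [->|x0] := eqVneq x 0; first by rewrite mulr0 !vge0.
by have [m hm] := v_fin x0; rewrite (vge_fin _ (vM ha hm)) (vge_fin _ hm) lerD2l.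
Qed.

Lemma vgeM N M x y : vge N x -> vge M y -> vge (N + M) (x * y).
Proof.
have [->|x0] := eqVneq x 0; first by move=> _ _; rewrite mul0r; exact: vge0.
have [n hn] := v_fin x0; rewrite (vge_fin _ hn) => Nn h.
apply: (@vge_le _ (n + M)); first by rewrite lerD2r.
by rewrite vge_mul.
Qed.

Lemma vgeN N x : vge N (- x) = vge N x.
Proof. by have := vge_mul N x vN1; rewrite add0r mulN1r. Qed.

Lemma vgeB N x y : vge N x -> vge N y -> vge N (x - y).
Proof. by move=> hx hy; rewrite vgeD ?vgeN. Qed.

Lemma vge_all x : (forall N, vge N x) -> x = 0.
Proof.
move=> h; apply/eqP/negPn/negP => /v_fin[n hn].
by have := h (n + 1); rewrite (vge_fin _ hn); clear; lia.
Qed.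

Lemma vge_ex x : exists N, vge N x.
Proof.
have [->|x0] := eqVneq x 0; first by exists 0; exact: vge0.
by have [n hn] := v_fin x0; exists n; rewrite (vge_fin _ hn).
Qed.

End ExtendedValuation.

Section Extension.
Variables (Q : fieldType) (K : fieldExtType Q) (v : K -> \bar int).
Hypothesis hv : valuation v.
Let nu (a : Q) := v a%:A.
Hypothesis Qc : val_complete nu.
Implicit Types (x y b : K) (N M L C : int) (c f : nat -> Q) (bs : seq K).

Definition comb c bs : K := \sum_(i < size bs) c i *: bs`_i.

Lemma combB c f bs : comb (fun i => c i - f i) bs = comb c bs - comb f bs.
Proof. by rewrite -sumrB; apply: eq_bigr => i _; rewrite scalerBl. Qed.

Lemma combZ a c bs : comb (fun i => a * c i) bs = a%:A * comb c bs.
Proof. by rewrite mulr_algl scaler_sumr; apply: eq_bigr => i _; rewrite scalerA. Qed.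

Lemma comb_cons c b bs : comb c (b :: bs) = (c 0)%:A * b + comb (tl c) bs.
Proof. by rewrite mulr_algl /comb big_ord_recl. Qed.

Lemma comb_span c bs : comb c bs \in <<bs>>%VS.
Proof.
by apply: memv_suml => i _; apply: memvZ; apply: memv_span; exact: mem_nth.
Qed.

Lemma comb_ge bs : exists L, forall c N,
  (forall i, (i < size bs)%N -> vge v N (c i)%:A) -> vge v (N + L) (comb c bs).
Proof.
elim: bs => [|b bs [L IH]]; first by exists 0 => c N _; rewrite /comb big_ord0; exact: vge0.
have [M hM] := vge_ex hv b; exists (Num.min L M) => c N h; rewrite comb_cons; apply: vgeD => //.
  apply: (@vge_le _ _ _ (N + M)); first by rewrite lerD2l ge_min lexx orbT.
  exact: vgeM (h 0 isT) hM.
apply: (@vge_le _ _ _ (N + L)); first by rewrite lerD2l ge_min lexx.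
by apply: IH => i ib; exact: h i.+1 ib.
Qed.

Definition cauchy (u : nat -> K) :=
  forall N, exists m : nat, forall i j, (m <= i)%N -> (m <= j)%N -> vge v N (u i - u j).
Definition tends (u : nat -> K) l :=
  forall N, exists m : nat, forall i, (m <= i)%N -> vge v N (u i - l).

(** Continuity of the coordinates, uniformly on the span: the valuation is comparable with the
    maximum norm of the coefficients. *)
Definition bounded_coefs bs := exists C, forall c N,
  vge v N (comb c bs) -> forall i, (i < size bs)%N -> vge v (N - C) (c i)%:A.

Lemma span_complete bs : bounded_coefs bs -> forall u : nat -> nat -> Q,
  cauchy (fun k => comb (u k) bs) -> exists l, tends (fun k => comb (u k) bs) (comb l bs).
Proof.
move=> [C hC] u hu.
have /choice [l hl] : forall i, exists l, (i < size bs)%N ->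
    forall N, exists m : nat, forall k, (m <= k)%N -> vge v N (u k i - l)%:A.
  move=> i; have [ib|] := boolP (i < size bs)%N; last by exists 0.
  have [N|l hl] := @Qc (fun k => u k i); last by exists l.
  have [m hm] := hu (N + C); exists m => j k mj mk.
  have := hC (fun i => u j i - u k i) (N + C); rewrite combB addrK => h.
  exact: h (hm _ _ mj mk) i ib.
exists l => N; have [L hL] := comb_ge bs.
have [m hm] : exists m, forall k, (m <= k)%N -> forall i, (i < size bs)%N ->
    vge v (N - L) (u k i - l i)%:A.
  elim: (size bs) hl => [|n IH] hl; first by exists 0.
  have [|m hm] := IH; first by move=> i i_n; apply: hl; exact: leqW.
  have [m' hm'] := hl n (leqnn _) (N - L); exists (maxn m m') => k; rewrite geq_max => /andP[mk mk'] i.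
  by rewrite ltnS leq_eqVlt => /orP[/eqP->|]; [exact: hm' | exact: hm].
exists m => k mk; rewrite -combB -[N](subrK L); apply: hL => i ib; exact: hm.
Qed.

(** The span of [bs] is complete by induction, hence closed, so b stays at positive distance from
    it. This bounds the first coordinate, and the remaining ones follow by induction. *)
Lemma free_bounded bs : free bs -> bounded_coefs bs.
Proof.
elim: bs => [|b bs IH]; first by exists 0.
rewrite free_cons => /andP[nb /IH hb]; have [C1 hC1] := hb.
have b0 : b != 0 by apply: contraNneq nb => ->; exact: mem0v.
have [C0 hC0] : exists C, forall c, ~~ vge v C (b + comb c bs).
  apply: contrapT => no.
  have /choice [u hu] : forall k : nat, exists c, vge v k%:Z (b + comb c bs).
    move=> k; apply: contrapT => nk; apply: no; exists k%:Z => c; apply/negP => h.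
    by apply: nk; exists c.
  have [N|l hl] := span_complete hb (u := u).
    exists `|N|%N => i j iN jN.
    rewrite (_ : _ - _ = (b + comb (u i) bs) - (b + comb (u j) bs)); last by ring.
    by apply: vgeB => //; [apply: vge_le (hu i) | apply: vge_le (hu j)]; move: iN jN; clear; lia.
  have : b + comb l bs = 0.
    apply: (vge_all hv) => N; have [m hm] := hl N; pose k := maxn m `|N|%N.
    rewrite (_ : b + _ = (b + comb (u k) bs) - (comb (u k) bs - comb l bs)); last by ring.
    apply: vgeB => //; last exact/hm/leq_maxl.
    by apply: vge_le (hu k); rewrite /k; clear; lia.
  move=> /eqP; rewrite addr_eq0 => /eqP bl; move: nb.
  by rewrite bl rpredN comb_span.
have [n hn] := v_fin hv b0.
pose D := Num.max 0 (C0 - n).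
have first_coef c N : vge v N (comb c (b :: bs)) -> vge v (N - C0) (c 0%N)%:A.
  rewrite comb_cons => h; have [->|c0] := eqVneq (c 0%N) 0; first by rewrite scale0r vge0.
  have cA0 : (c 0%N)%:A != 0 :> K by rewrite scaler_eq0 negb_or c0 oner_neq0.
  have [m hm] := v_fin hv cA0; rewrite (vge_fin _ hm) leNgt; apply/negP => lt.
  (* Dividing by the first coefficient brings the combination to the form b plus an element of the
     span. *)
  have /negP := hC0 (fun i => (c 0%N)^-1 * tl c i); apply.
  apply: (@vge_le _ _ _ (N - m)); first by move: lt; clear; lia.
  have ci : (c 0%N)%:A * ((c 0%N)^-1)%:A = 1 :> K.
    by rewrite mulr_algl scalerA divff // scale1r.
  rewrite -(vge_mul hv _ _ hm) combZ mulrDr mulrA ci mul1r.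
  by rewrite (_ : m + (N - m) = N) //; ring.
exists (Num.max C0 (D + C1)) => c N h.
have h0 := first_coef c N h.
case=> [_|i]; first by apply: vge_le h0; rewrite lerD2l lerN2 le_max lexx.
rewrite /= ltnS => ib; apply: (@vge_le _ _ _ (N - D - C1)).
  by rewrite -addrA -opprD lerD2l lerN2 le_max lexx orbT.
have /(hC1 (tl c)) : vge v (N - D) (comb (tl c) bs); last exact.
rewrite (_ : comb _ _ = comb c (b :: bs) - (c 0%N)%:A * b); last by rewrite comb_cons; ring.
apply: vgeB => //; first by apply: vge_le h; rewrite /D; clear; lia.
apply: (@vge_le _ _ _ (N - C0 + n)); first by rewrite /D; clear; lia.
by apply: vgeM h0 _; rewrite // (vge_fin _ hn).
Qed.

Let bas : seq K := vbasis (fullv : {vspace K}).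

Lemma bas_bounded : bounded_coefs bas.
Proof. by apply: free_bounded; apply: basis_free; exact: vbasisP. Qed.

Lemma comb_ex x : exists c, x = comb c bas.
Proof.
have sb : size bas = \dim (fullv : {vspace K}) by rewrite size_tuple.
exists (fun i => if insub i is Some j then coord (vbasis fullv) j x else 0).
rewrite {1}(coord_vbasis (memvf x)) /comb sb; apply: eq_bigr => i _.
by rewrite insubT //= => ii; congr (coord _ _ _ *: _); apply: val_inj.
Qed.

Lemma extension_complete : val_complete v.
Proof.
move=> u hu; have /choice [c hc] : forall k, exists c, u k = comb c bas by move=> k; exact: comb_ex.
have [|l hl] := span_complete bas_bounded (u := c).
  by move=> N; have [m hm] := hu N; exists m => i j; rewrite -!hc; exact: hm.
by exists (comb l bas) => N; have [m hm] := hl N; exists m => i; rewrite hc; exact: hm.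
Qed.

Lemma extension_cover N M :
  (forall N M, exists rs : seq Q, forall a, vge v N a%:A -> exists2 r, r \in rs & vge v M (a - r)%:A) ->
  exists rs : seq K, forall x, vge v N x -> exists2 r, r \in rs & vge v M (x - r).
Proof.
move=> hQ; have [C hC] := bas_bounded; have [L hL] := comb_ge bas.
have [rs hrs] := hQ (N - C) (M - L).
have [fs hfs] : exists fs : seq (nat -> Q), forall c, (forall i, (i < size bas)%N -> vge v (N - C) (c i)%:A) ->
    exists2 f, f \in fs & forall i, (i < size bas)%N -> vge v (M - L) (c i - f i)%:A.
  elim: (size bas) => [|n [fs IH]]; first by exists [:: fun _ => 0] => c _; exists (fun _ => 0); rewrite ?mem_head.
  exists [seq scons r f | r <- rs, f <- fs] => c hc.
  have [r rr hr] := hrs _ (hc 0%N isT).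
  have [|f ff hf] := IH (tl c); first by move=> i i_n; exact: hc i.+1 i_n.
  exists (scons r f); first by apply/allpairsP; exists (r, f).
  by case=> // i i_n; exact: hf.
exists (map (comb^~ bas) fs) => x hx; have [c xE] := comb_ex x; rewrite xE in hx *.
have [f ff hf] := hfs c (hC c N hx); exists (comb f bas); first exact: map_f.
by rewrite -combB -[M](subrK L); apply: hL.
Qed.

End Extension.

Section PadicNumbers.
Variables (p : nat) (hp : prime p) (Qp : fieldType) (vp : Qp -> \bar int).
Hypothesis hQp : padic_numbers p vp.
Let hvp : valuation vp := padic_valuation hQp.

Lemma vp_int (z : int) : z != 0 -> vp z%:~R = (logn p `|z|%N)%:Z%:E.
Proof.
move=> z0; rewrite -ratr_int (padic_ratr hQp) /padic_val_rat intr_eq0 (negPf z0).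
by rewrite numq_int denq_int logn1 subr0.
Qed.

Lemma vp_p : vp p%:R = 1%:E.
Proof.
rewrite -[p%:R]/((p%:Z)%:~R) vp_int ?absz_nat ?logn_prime ?eqxx //.
by rewrite eqz_nat -lt0n prime_gt0.
Qed.

Lemma vge_int (z : int) : vge vp 0 z%:~R.
Proof.
have [->|z0] := eqVneq z 0; first exact: vge0.
by rewrite /vge vp_int.
Qed.

Lemma vge_dvd (z : int) (m : nat) : (((p ^ m)%N : int) %| z)%Z -> vge vp m z%:~R.
Proof.
move=> /dvdzP[q ->]; rewrite intrM mulrC -[m%:Z]addr0; apply: vgeM => //; last exact: vge_int.
by rewrite /vge -pmulrn natrX (vX hvp _ vp_p) mul1r.
Qed.

(** A rational q close enough to x is p-integral, so its denominator b is prime to p. By the Chinese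
    remainder theorem some k0 b is congruent to the numerator modulo p^m, and k0 is then reduced
    modulo p^m. *)
Lemma Zp_digits (x : Qp) (m : nat) : vge vp 0 x ->
  exists2 k, (k < p ^ m)%N & vge vp m (x - k%:R).
Proof.
move=> x0; have pm0 : (0 < p ^ m)%N by rewrite expn_gt0 prime_gt0.
have [q hq] := padic_dense hQp x m; have hq' : vge vp m (x - ratr q) by exact: hq.
have rq0 : vge vp 0 (ratr q).
  by rewrite (_ : ratr q = x - (x - ratr q)); [apply: vgeB => //; exact: vge_le hq' | ring].
have [q0|q0] := eqVneq q 0.
  by exists 0%N => //; move: hq'; rewrite q0 (ratr_int Qp 0).
set a := numq q; set b := denq q.
have b0 : b != 0 by exact: denq_neq0.
have pb : ~~ (p %| `|b|)%N.
  apply/negP => pb; have := rq0; rewrite /vge (padic_ratr hQp) /padic_val_rat (negPf q0) lee_fin -/a -/b => h.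
  have lb : (0 < logn p `|b|)%N by rewrite logn_gt0 mem_primes hp pb absz_gt0 b0.
  have la : (0 < logn p `|a|)%N by move: lb h; clear; lia.
  move: la; rewrite logn_gt0 mem_primes => /and3P[_ _ pa].
  have := coprime_num_den q; rewrite -/a -/b /coprime => /eqP g1.
  have := dvdn_gcd p `|a| `|b|; rewrite pa pb g1 dvdn1 => /eqP p1.
  by have := hp; rewrite p1.
have cop : coprimez b (p ^ m)%N%:Z.
  by rewrite coprimezE absz_nat coprime_sym coprimeXl // prime_coprime.
set X := zchinese b (p ^ m)%N%:Z 0 a.
have /dvdzP[k0 Xk] : (b %| X)%Z by apply/dvdz_mod0P; rewrite /X zchinese_modl // mod0z.
have Xa : ((p ^ m)%N%:Z %| a - X)%Z by rewrite -eqz_mod_dvd /X; apply/eqP; rewrite zchinese_modr.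
pose k := `|(k0 %% (p ^ m)%N%:Z)%Z|%N.
have kE : (k%:Z = k0 %% (p ^ m)%N%:Z)%Z by rewrite /k gez0_abs // modz_ge0 // eqz_nat -lt0n.
exists k; first by rewrite -ltz_nat kE ltz_pmod // ltz_nat.
have h1 : vge vp m (ratr q - k0%:~R).
  have bR : b%:~R != 0 :> Qp by apply: (@v_neq0 _ _ hvp (logn p `|b|)); exact: vp_int.
  have vb : vp b%:~R = 0%:E by rewrite vp_int // lognE hp absz_gt0 b0 (negPf pb).
  rewrite (_ : ratr q - _ = b%:~R^-1 * (a - X)%:~R).
    rewrite -[m%:Z]add0r (vge_mul hvp) ?(vV hvp vb) ?oppr0 //; exact: vge_dvd.
  by rewrite /ratr -/a -/b Xk intrB intrM; field.
have h2 : vge vp m (k0%:~R - k%:R).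
  rewrite -[k%:R]/((k%:Z)%:~R) -intrB; apply: vge_dvd.
  by rewrite kE {1}(divz_eq k0 (p ^ m)%N%:Z) addrK dvdz_mull.
rewrite (_ : x - _ = (x - ratr q) + (ratr q - k0%:~R) + (k0%:~R - k%:R)); last by ring.
by apply: vgeD => //; exact: vgeD.
Qed.

Lemma Qp_cover (N M : nat) : exists rs : seq Qp, forall a, vge vp (- N%:Z) a ->
  exists2 r, r \in rs & vge vp M (a - r).
Proof.
exists [seq k%:R / p%:R ^+ N | k <- iota 0 (p ^ (M + N))] => a ha.
have p0 : p%:R != 0 :> Qp by exact: v_neq0 vp_p.
have vN : vp (p%:R ^+ N) = N%:Z%:E by rewrite (vX hvp _ vp_p) mul1r.
have [|k kM hk] := @Zp_digits (p%:R ^+ N * a) (M + N).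
  by rewrite -[0](addrN N%:Z) (vge_mul hvp _ _ vN).
exists (k%:R / p%:R ^+ N); first by apply: map_f; rewrite mem_iota.
rewrite -(vge_mul hvp _ _ vN) mulrBr mulrCA divff ?expf_neq0 // mulr1.
by rewrite addrC -PoszD.
Qed.

Variables (K : fieldExtType Qp) (v : K -> \bar int).
Hypothesis hv : extends_valuation vp v.

Lemma extends_vge : exists2 e : nat, (0 < e)%N & forall a n, vp a = n%:E -> v a%:A = (e%:Z * n)%:E.
Proof.
have [_ [e [e0 he]]] := hv; exists e => // a n h; by rewrite he h.
Qed.

Lemma base_complete : val_complete (fun a : Qp => v a%:A).
Proof.
have hv1 := hv.1; have [e e0 he] := extends_vge => u hu.
have up (a : Qp) N : vge vp `|N| a -> vge v N a%:A.
  have [->|a0] := eqVneq a 0; first by rewrite scale0r => _; exact: vge0.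
  have [n hn] := v_fin hvp a0; rewrite (vge_fin _ hn) (vge_fin _ (he _ _ hn)).
  by move: e0; clear; nia.
have down (a : Qp) N : vge v (e%:Z * N) a%:A -> vge vp N a.
  have [->|a0] := eqVneq a 0; first by move=> _; exact: vge0.
  have [n hn] := v_fin hvp a0; rewrite (vge_fin _ hn) (vge_fin _ (he _ _ hn)).
  by move: e0; clear; nia.
have [N|l hl] := padic_complete hQp (u := u).
  have [M hM] := hu (e%:Z * N); exists M => i j iM jM; apply: down; exact: hM.
by exists l => N; have [M hM] := hl `|N|; exists M => i iM; apply: up; exact: hM.
Qed.

Lemma base_cover (N M : int) : exists rs : seq Qp, forall a, vge v N a%:A ->
  exists2 r, r \in rs & vge v M (a - r)%:A.
Proof.
have hv1 := hv.1; have [e e0 he] := extends_vge.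
have [rs hrs] := Qp_cover `|N| `|M|; exists rs => a ha.
have [|r rr hr] := hrs a.
  move: ha; have [->|a0] := eqVneq a 0; first by move=> _; exact: vge0.
  have [n hn] := v_fin hvp a0; rewrite (vge_fin _ hn) (vge_fin _ (he _ _ hn)).
  by move: e0; clear; nia.
exists r => //; move: hr; have [->|a0] := eqVneq (a - r) 0; first by rewrite scale0r => _; exact: vge0.
have [n hn] := v_fin hvp a0; rewrite (vge_fin _ hn) (vge_fin _ (he _ _ hn)).
by move: e0; clear; nia.
Qed.

(** Since v extends vp only up to a factor, its value group is some d Z: d is the least positive
    value, and Euclidean division shows that it divides all others. An element of value d is the
    uniformizer and v / d the normalized valuation. [Pr] transports statements, as the structure is
    built inside the proof. *)
Theorem local_field_structure (Pr : forall F : fieldType, (F -> \bar int) -> Prop) :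
  (forall (F : lfield) (f : F -> \bar int) (d : nat), (0 < d)%N -> f 0 = +oo%E ->
    (forall x : F, x != 0 -> f x = (d%:Z * w x)%:E) -> Pr F f) -> Pr K v.
Proof.
move=> main; have hv1 := hv.1; have [e e0 he] := extends_vge.
pose P d := `[< (0 < d)%N /\ exists x, v x = d%:Z%:E >].
have exP : exists d, P d.
  by exists e; apply/asboolP; split=> //; exists (p%:R)%:A; rewrite (he _ _ vp_p) mulr1.
case: (ex_minnP exP) => d /asboolP[d0 [q0 hq0]] dmin.
have q00 : q0 != 0 by exact: (@v_neq0 K v hv1 _ _ hq0).
have d_dvd x n : v x = n%:E -> (d%:Z %| n)%Z.
  move=> hx; apply/dvdz_mod0P; apply: contrapT => r0.
  have dz : d%:Z != 0 by rewrite eqz_nat -lt0n.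
  have rge := modz_ge0 n dz; have rlt := ltz_pmod n (_ : 0 < d%:Z).
  have [t ht] : exists t, v t = (n %% d%:Z)%Z%:E.
    have vz (i : int) : exists t, v t = (d%:Z * i)%:E.
      case: i => i; first by exists (q0 ^+ i); exact: (@vX K v hv1 _ _ i hq0).
      exists (q0 ^+ i.+1)^-1; rewrite (vV hv1 (vX hv1 i.+1 hq0)) NegzE; congr (_%:E); clear; lia.
    have [t ht] := vz (- (n %/ d%:Z)%Z); exists (x * t).
    rewrite (vM hv1 hx ht); congr (_%:E).
    by rewrite {1}(divz_eq n d%:Z); ring.
  have /dmin : P `|(n %% d%:Z)%Z|%N.
    apply/asboolP; split; last by exists t; rewrite gez0_abs.
    by rewrite absz_gt0; apply/eqP.
  by move: rge (rlt d0); clear; lia.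
pose w x : int := if v x is EFin n then (n %/ d%:Z)%Z else 0.
have vw x : x != 0 -> v x = (d%:Z * w x)%:E.
  move=> x0; have [n hn] := v_fin hv1 x0; rewrite /w hn; congr (_%:E).
  by rewrite mulrC divzK //; exact: d_dvd hn.
have wE x n : v x = (d%:Z * n)%:E -> w x = n.
  move=> h; rewrite /w h mulrC mulzK // eqz_nat -lt0n //.
have dvE (n : nat) x : dv_of w (q0 ^+ n) x = vge v (d%:Z * n%:Z) x.
  have [->|x0] := eqVneq x 0; first by rewrite /dv_of eqxx vge0.
  rewrite /dv_of (negPf x0) expf_neq0 //= (vge_fin _ (vw _ x0)).
  by rewrite (wE _ n) ?(vX hv1 _ hq0) // ler_pM2l.
have wM x y : x != 0 -> y != 0 -> w (x * y) = w x + w y.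
  by move=> x0 y0; apply: wE; rewrite (vM hv1 (vw _ x0) (vw _ y0)) mulrDr.
have wD x y m : x != 0 -> y != 0 -> x + y != 0 -> m <= w x -> m <= w y -> m <= w (x + y).
  move=> x0 y0 xy0 mx my; have : vge v (d%:Z * m) (x + y).
    by apply: vgeD => //; rewrite (vge_fin _ (vw _ _)) // ler_pM2l.
  by rewrite (vge_fin _ (vw _ _)) // ler_pM2l.
have w_pi : w q0 = 1 by apply: wE; rewrite hq0 mulr1.
have complete : forall u : nat -> K, (forall n, dv_of w (q0 ^+ n) (u n.+1 - u n)) ->
    exists l, forall n, dv_of w (q0 ^+ n) (u n - l).
  move=> u hu; have step (n i : nat) : vge v (d%:Z * n%:Z) (u (n + i)%N - u n).
    elim: i => [|i IH]; first by rewrite addn0 subrr; exact: vge0.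
    rewrite addnS (_ : _ - _ = (u (n + i).+1 - u (n + i)%N) + (u (n + i)%N - u n)); last by ring.
    apply: vgeD => //; have := hu (n + i)%N; rewrite dvE; apply: vge_le.
    by rewrite ler_pM2l // lez_nat leq_addr.
  have [N|l hl] := extension_complete hv1 base_complete (u := u).
    exists `|N|%N => i j iN jN; rewrite -(subnKC iN) -(subnKC jN).
    rewrite (_ : _ - _ = (u (`|N| + (i - `|N|))%N - u `|N|%N) - (u (`|N| + (j - `|N|))%N - u `|N|%N)); last by ring.
    by apply: vgeB => //; apply: vge_le (step _ _); move: d0; clear; nia.
  exists l => n; rewrite dvE; have [m hm] := hl (d%:Z * n%:Z).
  rewrite (_ : u n - l = (u (n + m)%N - l) - (u (n + m)%N - u n)); last by ring.
  by apply: vgeB => //; exact/hm/leq_addl.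
have finite : forall n : nat, exists rs : seq K, forall x,
    dv_of w 1 x -> exists2 r, r \in rs & dv_of w (q0 ^+ n) (x - r).
  move=> n; have [rs hrs] := extension_cover hv1 base_complete (d%:Z * 0%:Z) (d%:Z * n%:Z) base_cover.
  exists rs => x; rewrite -[1](expr0 q0) dvE => /hrs[r rr hr]; exists r => //; by rewrite dvE.
have char0 n : n.+1%:R != 0 :> K.
  have -> : n.+1%:R = (n.+1%:R : Qp)%:A :> K by rewrite scaler_nat.
  rewrite scaler_eq0 negb_or oner_neq0 andbT.
  apply: (@v_neq0 _ _ hvp (logn p n.+1)); exact: (@vp_int n.+1%:Z).
have w_resp : 0 < w p%:R.
  have vpK : v p%:R = e%:Z%:E.
    have -> : p%:R = (p%:R : Qp)%:A :> K by rewrite scaler_nat.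
    by rewrite (he _ _ vp_p) mulr1.
  have := vw _ (v_neq0 hv1 vpK); rewrite vpK => -[] h.
  by move: h e0 d0; move: (w _); clear; nia.
pose mix := isLocalField.Build K wM wD q00 w_pi complete finite char0 (prime_gt1 hp) w_resp.
pose F : lfield := HB.pack (K : fieldType) mix.
by apply: (main F v d d0 _ vw); exact: (proj2 (valuation_eqy hv1 0)).
Qed.

End PadicNumbers.

(** * Transfer to row vectors *)

Section Transfer.
Variable F : lfield.
Notation E := (nat -> F).
Implicit Types (e : E) (n k m : nat).

Definition env n (x : 'rV[F]_n) : E := fun i => if insub i is Some j then x ord0 j else 0.
Definition vec n e : 'rV[F]_n := \row_i e i.

Lemma env_ord n (x : 'rV[F]_n) (i : 'I_n) : env x i = x ord0 i.
Proof. by rewrite /env valK. Qed.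

Lemma env_fin n (x : 'rV[F]_n) : fin n (env x).
Proof. by move=> i ni; rewrite /env insubF // ltnNge ni. Qed.

Lemma envK n (x : 'rV[F]_n) : vec n (env x) = x.
Proof. by apply/rowP => i; rewrite mxE env_ord. Qed.

Lemma vecK n e : fin n e -> env (vec n e) = e.
Proof.
move=> fe; apply: fin_ext (@env_fin _ _) fe _ => i ik.
by rewrite (env_ord _ (Ordinal ik)) mxE.
Qed.

Lemma pf_sum (I : Type) (r : seq I) (p : I -> E -> F) : (forall i, pf (p i)) ->
  pf (fun e => \sum_(i <- r) p i e).
Proof.
move=> hp; elim: r => [|a r IH].
  rewrite (_ : (fun _ => _) = fun _ => 0); [exact: pf_const | by apply: funext => e; rewrite big_nil].
rewrite (_ : (fun _ => _) = fun e => p a e + \sum_(i <- r) p i e); first exact: pf_add.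
by apply: funext => e; rewrite big_cons.
Qed.

Lemma pf_prod (I : Type) (r : seq I) (p : I -> E -> F) : (forall i, pf (p i)) ->
  pf (fun e => \prod_(i <- r) p i e).
Proof.
move=> hp; elim: r => [|a r IH].
  rewrite (_ : (fun _ => _) = fun _ => 1); [exact: pf_const | by apply: funext => e; rewrite big_nil].
rewrite (_ : (fun _ => _) = fun e => p a e * \prod_(i <- r) p i e); first exact: pf_mul.
by apply: funext => e; rewrite big_cons.
Qed.

Lemma pf_exp (p : E -> F) j : pf p -> pf (fun e => p e ^+ j).
Proof. by move=> hp; elim: j => [|j IH]; [exact: pf_const | under eq_fun do rewrite exprS; exact: pf_mul]. Qed.

Lemma pf_meval n (q : {mpoly F[n]}) : pf (fun e => q.@[fun i => e i]).
Proof.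
rewrite (_ : (fun _ => _) = fun e : E => \sum_(u <- msupp q) q@_u * \prod_(i < n) e i ^+ u i).
  by apply: pf_sum => u; apply: pf_mul; [exact: pf_const | apply: pf_prod => i; exact/pf_exp/pf_var].
by apply: funext => e; rewrite mevalE.
Qed.

Lemma meval_pf n (p : E -> F) : pf p -> exists q : {mpoly F[n]},
  forall x : 'rV[F]_n, p (env x) = q.@[fun i => x ord0 i].
Proof.
elim=> [a|i|p1 p2 _ [q1 h1] _ [q2 h2]|p1 p2 _ [q1 h1] _ [q2 h2]].
- by exists a%:MP => x; rewrite mevalC.
- have [i_n|ni] := ltnP i n; last by exists 0 => x; rewrite meval0 env_fin.
  by exists 'X_(Ordinal i_n) => x; rewrite mevalXU (env_ord _ (Ordinal i_n)).
- by exists (q1 + q2) => x; rewrite mevalD h1 h2.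
- by exists (q1 * q2) => x; rewrite mevalM h1 h2.
Qed.

Local Open Scope classical_set_scope.

Lemma semialg_sa n (X : set 'rV[F]_n) : semialgebraic X ->
  exists2 S, sa S & forall x, X x <-> S (env x).
Proof.
elim=> [q j j1|A B _ [S sS SE] _ [S' sS' SE']|A B _ [S sS SE] _ [S' sS' SE']|A _ [S sS SE]].
- exists (fun e => powers j (q.@[fun i => e i])); first exact/sa_powers/pf_meval.
  move=> x; rewrite (_ : (fun i : 'I_n => env x i) = fun i => x ord0 i) //.
  by apply: funext => i; exact: env_ord.
- exists (fun e => S e \/ S' e) => [|x]; first exact: sa_or.
  by rewrite -SE -SE'.
- exists (fun e => S e /\ S' e) => [|x]; first exact: sa_and.
  by rewrite -SE -SE'.
exists (fun e => ~ S e) => [|x]; first exact: sa_not.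
by rewrite -SE.
Qed.

Lemma sa_semialg n S : sa S -> @semialgebraic F n [set x | S (env x)].
Proof.
elim=> {S} [j p j0 /(meval_pf n)[q hq]|S S' _ h _ h'|S S' _ h _ h'|S _ h].
- rewrite (_ : mkset _ = [set x : 'rV[F]_n | powers j (q.@[fun i => x ord0 i])]); first exact: SemialgBasic.
  by apply/predeqP => x /=; rewrite hq.
- exact: SemialgU h h'.
- exact: SemialgI h h'.
exact: SemialgC h.
Qed.

Lemma set_def n (X : set 'rV[F]_n) : semialgebraic X ->
  definable n (fun e => fin n e /\ X (vec n e)).
Proof.
move=> /semialg_sa[S sS SE]; split=> [e []//|]; exists S => // e fe.
by rewrite SE vecK //; split=> [[]|].
Qed.
Definition set_obj n (X : set 'rV[F]_n) (hX : semialgebraic X) : obj F := Obj (set_def hX).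

Lemma set_obj_env n (X : set 'rV[F]_n) (hX : semialgebraic X) x :
  set_obj hX (env x) <-> X x.
Proof. by rewrite /= envK; split=> [[]//|]; split=> //; exact: env_fin. Qed.

Definition cat_env n (x y : E) : E := fun i => if (i < n)%N then x i else y (i - n)%N.

Lemma env_row_mx n k (x : 'rV[F]_n) (y : 'rV[F]_k) : env (row_mx x y) = cat_env n (env x) (env y).
Proof.
apply: (@fin_ext _ (n + k)) => [|i nk|i ik]; first exact: env_fin.
  by rewrite /cat_env ltnNge (leq_trans (leq_addr k n) nk) /= env_fin // leq_subRL // (leq_trans (leq_addr k n)).
rewrite (env_ord _ (Ordinal ik)) /cat_env; have [i_n|ni] := ltnP i n.
  by rewrite (_ : Ordinal ik = lshift k (Ordinal i_n)) ?row_mxEl ?(env_ord _ (Ordinal i_n)) //; exact: val_inj.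
have ink : (i - n < k)%N by rewrite ltn_subLR.
rewrite (_ : Ordinal ik = rshift n (Ordinal ink)) ?row_mxEr ?(env_ord _ (Ordinal ink)) //.
by apply: val_inj; rewrite /= subnKC.
Qed.

Lemma bij_iso n k (X : set 'rV[F]_n) (Y : set 'rV[F]_k) (hX : semialgebraic X) (hY : semialgebraic Y) f :
  semialg_bij X Y f -> iso (set_obj hX) (set_obj hY).
Proof.
move=> [[h1 h2 h3] /semialg_sa[S sS SE]].
have RE x y : X x -> (S (cat_env n (env x) (env y)) <-> y = f x).
  move=> Xx; rewrite -env_row_mx -SE; split=> [[x' Xx' /eq_row_mx[-> ->]]//|->]; by exists x.
exists (fun x y => S (cat_env n x y)); split.
- apply: sa_comp sS _ => i; rewrite /cat_env; case: (i < n)%N; exact: pf_var.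
- move=> e [fe Xe]; exists (env (f (vec n e))); first by apply/set_obj_env; exact: h1.
  by rewrite -{1}(vecK fe); apply/RE.
- move=> e [fe /h3[x Xx fx]]; exists (env x); first exact/set_obj_env.
  by rewrite -(vecK fe); apply/RE.
- move=> e e1 e2 [fe Xe] [fe1 _] [fe2 _]; rewrite -(vecK fe) -(vecK fe1) -(vecK fe2).
  by move=> /RE -> // /RE ->.
move=> e1 e2 e [fe1 X1] [fe2 X2] [fe _]; rewrite -(vecK fe1) -(vecK fe2) -(vecK fe).
move=> /RE e1E /RE e2E; congr env; apply: h2; rewrite ?inE //.
by rewrite -e1E // e2E.
Qed.

Lemma iso_bij n k (X : set 'rV[F]_n) (Y : set 'rV[F]_k) (hX : semialgebraic X) (hY : semialgebraic Y) :
  iso (set_obj hX) (set_obj hY) -> exists f, semialg_bij X Y f.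
Proof.
move=> [R [sR h1 h2 h3 h4]].
have /choice [f hf] : forall x : 'rV[F]_n, exists y : 'rV[F]_k, X x -> Y y /\ R (env x) (env y).
  move=> x; have [Xx|nX] := pselect (X x); last by exists 0.
  have [|e [fe Ye] r] := h1 (env x); first exact/set_obj_env.
  by exists (vec k e) => _; rewrite vecK.
exists f; split; first split.
- by move=> x /hf[].
- move=> x x'; rewrite !inE => Xx Xx' fxx'; have [Yx r] := hf _ Xx; have [_ r'] := hf _ Xx'.
  rewrite -fxx' in r'; rewrite -[x]envK -[x']envK; congr vec.
  by apply: h4 r r'; apply/set_obj_env.
- move=> y Yy; have [|e [fe Xe] r] := h2 (env y); first exact/set_obj_env.
  exists (vec n e) => //; have [Yf r'] := hf _ Xe; rewrite -[y]envK -[f _]envK; congr vec.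
  by apply: (h3 (env (vec n e))); try (by apply/set_obj_env); rewrite ?vecK // -{1}(vecK fe).
have [S sS SE] := semialg_sa hX; have [S' sS' SE'] := semialg_sa hY.
(* The two blocks of a concatenated vector, padded with 0 so that each is the environment of a
   point. *)
pose fi (e : E) : E := fun i => if (i < n)%N then e i else 0.
pose ps (e : E) : E := fun i => if (i < k)%N then e (n + i)%N else 0.
have pfi : pmap fi by move=> i; rewrite /fi; case: (i < n)%N; [exact: pf_var | exact: pf_const].
have pps : pmap ps by move=> i; rewrite /ps; case: (i < k)%N; [exact: pf_var | exact: pf_const].
have sR' : sa (fun e => R (fi e) (ps e)).
  have pm : pmap (fun e => mix (fi e) (ps e)) by pmaps.
  by apply: sa_ext (sa_comp sR pm) _ => e; rewrite ev_mix od_mix.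
have sG : sa (fun e => [/\ S (fi e), S' (ps e) & R (fi e) (ps e)]).
  by apply: sa_ext (sa_and (sa_comp sS pfi) (sa_and (sa_comp sS' pps) sR')) _ => e; split=> [[? []]|[]].
have fiE (x : 'rV[F]_n) (y : 'rV[F]_k) : fi (cat_env n (env x) (env y)) = env x.
  apply: funext => i; rewrite /fi /cat_env; case: ltnP => // ni; by rewrite env_fin.
have psE (x : 'rV[F]_n) (y : 'rV[F]_k) : ps (cat_env n (env x) (env y)) = env y.
  apply: funext => i; rewrite /ps /cat_env [(n + i < n)%N]ltnNge leq_addr /= addKn; case: ltnP => // ni; by rewrite env_fin.
rewrite (_ : graph_on X f = [set z | [/\ S (fi (env z)), S' (ps (env z)) & R (fi (env z)) (ps (env z))]]).
  exact: sa_semialg sG.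
apply/predeqP => z; split=> [[x Xx <-]|/=].
  rewrite /= env_row_mx fiE psE; by have [Yf r] := hf _ Xx; split=> //; [apply/SE | apply/SE'].
rewrite -[z]hsubmxK env_row_mx fiE psE => -[/SE Xl /SE' Yr r].
exists (lsubmx z) => //; congr row_mx; have [Yf r'] := hf _ Xl.
by rewrite -[f _]envK -[rsubmx z]envK; congr vec; apply: h3 r' r; apply/set_obj_env.
Qed.

Variables (p : nat) (hp : prime p) (f : F -> \bar int) (d : nat).
Hypothesis d0 : (0 < d)%N.
Hypothesis f0 : f 0 = +oo%E.
Hypothesis fw : forall x : F, x != 0 -> f x = (d%:Z * w x)%:E.

Lemma abs_small eps : 0 < eps -> exists N : nat, forall x : F, dv (pi ^+ N) x -> padic_abs p f x < eps.
Proof.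
move=> eps0; exists (Num.bound eps^-1) => x; set N := Num.bound _ => h.
have [->|x0] := eqVneq x 0; first by rewrite /padic_abs f0.
rewrite /padic_abs (fw x0); have wN : N%:Z <= d%:Z * w x.
  by move: h; rewrite dv_w ?pin0 // w_pin; move: (w x) d0; clear; nia.
have p1 : 1 < p%:R :> rat by rewrite ltr1n prime_gt1.
have h1 : (p%:R : rat) ^ (- (d%:Z * w x)) <= (p%:R : rat) ^ (- N%:Z).
  by rewrite ler_eXz2l // lerN2.
apply: le_lt_trans h1 _; rewrite -exprz_inv -exprnP exprVn.
have pN : eps^-1 < p%:R ^+ N.
  (* Archimedean bound: eps^-1 < 2^N <= p^N. *)
  apply: lt_le_trans (upper_nthrootP (leqnn _)) _.
  by apply: lerXn2r; rewrite ?nnegrE ?ler0n // ler_nat prime_gt1.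
by rewrite invf_plt // posrE ?(lt_trans _ pN) ?invr_gt0.
Qed.

Lemma open_disc k (U : set 'rV[F]_k) (hU : semialgebraic U) : padic_open p f U -> U !=set0 ->
  exists c N, forall e, disc k N c e -> set_obj hU e.
Proof.
move=> oU [x Ux]; have [eps eps0 he] := oU x Ux; have [N hN] := abs_small eps0.
exists (env x), N => e [fe de]; split=> //; apply: he.
rewrite /padic_norm; elim/big_ind: _ => // [a b a1 b1|i _]; first by rewrite gt_max a1.
by apply: hN; rewrite !mxE -env_ord; exact: de.
Qed.

Theorem semialgebraic_classification n (X : set 'rV[F]_n) : semialgebraic X ->
  finite_set X \/
  exists k : nat, [/\ (1 <= k)%N, is_dim p f X k%:Z &
    exists g : 'rV[F]_n -> 'rV[F]_k, semialg_bij X [set: 'rV[F]_k] g].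
Proof.
move=> hX; have [[m hm]|[k /andP[k1 _] hk]] := classification (set_obj hX).
  left; have [l hl] := finite_iso hm (finite_mul F m).
  apply: (@sub_finite_set _ _ [set` map (vec n) l]); last exact: finite_seq.
  by move=> x Xx /=; rewrite -[x]envK map_f // hl //; apply/set_obj_env.
right; exists k.
have sT : semialgebraic [set: 'rV[F]_k].
  rewrite (_ : setT = [set x | (fun _ => True) (env x)]); first exact: (@sa_semialg k _ (sa_const F True)).
  by apply/predeqP.
have iT : iso (set_obj hX) (set_obj sT).
  apply: iso_trans hk _; apply: iso_eq => e; rewrite KpowP /=; by split=> [|[]].
have [g hg] := iso_bij iT.
have X0 : X !=set0.
  have [[h1 h2 h3] _] := hg; have [x Xx _] := h3 0 I; by exists x.
split=> //; last by exists g.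
right; split=> //; exists k; split=> //.
  exists X, setT, g; split; first by split.
  by split=> //; split=> //; [exists 0 | move=> x _; exists 1].
move=> j [A [U [h [[AX A0 sA] [[U0 sU oU] hb]]]]].
(* The image of a chart contains a disc, a copy of K^j. Carried back through the chart and then
   through the bijection from X to K^k, it becomes a subset of K^k, so [dim_unique] gives j <= k. *)
have [c [N hd]] := open_disc sU oU U0.
have [Y [_ YA] iY] := iso_sub (iso_sym (bij_iso sA sU hb)) hd.
have YX e : Y e -> set_obj hX e by move=> /YA[fe Ae]; split=> //; exact: AX.
have [Z [dZ _] iZ] := iso_sub hk YX.
have := dim_unique (iso_trans (disc_Kpow j N c) (iso_trans iY iZ)).
by rewrite dZ odim_Kpow.
Qed.

End Transfer.

Local Open Scope classical_set_scope.

Theorem theorem2 (p : nat) (hp : prime p)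
    (Qp : fieldType) (vp : Qp -> \bar int) (hQp : padic_numbers p vp)
    (K : fieldExtType Qp) (v : K -> \bar int) (hv : extends_valuation vp v)
    (n : nat) (X : set 'rV[K]_n) (hX : semialgebraic X) :
  finite_set X \/
  exists k : nat, [/\ (1 <= k)%N, is_dim p v X k%:Z &
    exists f : 'rV[K]_n -> 'rV[K]_k, semialg_bij X [set: 'rV[K]_k] f].
Proof.
move: n X hX.
apply: (@local_field_structure p hp Qp vp hQp K v hv (fun F f => forall n (X : set 'rV[F]_n),
  semialgebraic X -> finite_set X \/ exists k : nat, [/\ (1 <= k)%N, is_dim p f X k%:Z &
    exists g : 'rV[F]_n -> 'rV[F]_k, semialg_bij X [set: 'rV[F]_k] g])) => F f d d0 f0 fw n X.
exact: (@semialgebraic_classification F p hp f d d0 f0 fw n X).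
Qed.
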